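(* Let $A=1/\mu$ with $0<\mu\le\mu_0$ ($\mu_0\in(0,1)$ a small absolute constant) and let $\mathbb{G}=\mathbb{G}(x,y,t;x',y')$ be the $2\times2$ Green's function of the linearized micropolar system near Couette flow, $$\partial_t\mathbb{G}+Ay\,\partial_x\mathbb{G}-\overline{B}(D)\mathbb{G}=0,\qquad \mathbb{G}|_{t=0}=\delta(x-x',y-y')\,I_{2\times2}.$$ For all non-negative integers $k_1,k_2$ with $k=k_1+k_2$ and every $p\in[2,\infty]$ there is a constant $C$, independent of $t$ and $A$, such that for all $t>0$ $$|||\partial_x^{k_1}\partial_y^{k_2}\mathbb{G}(t)|||_{L^p}\le C\,t^{-(1-\frac1p)-\frac k2}\bigl(1+(At)^2\bigr)^{-\frac12(1-\frac1p+k_1)},$$ $$|||\partial_{x'}^{k_1}\partial_{y'}^{k_2}\mathbb{G}(t)|||_{L^p}\le C\,t^{-(1-\frac1p)-\frac k2}\bigl(1+(At)^2\bigr)^{-\frac12(1-\frac1p+k_1)}.$$ Moreover, if $(k_1,k_2)\in\{(0,0),(1,0),(0,1)\}$, these inequalities hold for all $p\in[1,\infty]$.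
   Context: $\overline{B}(D)$ is the Fourier multiplier with matrix symbol $$\overline{B}(\xi,\eta)=\begin{pmatrix}-(\xi^2+\eta^2)&\xi^2+\eta^2\\1&-(\xi^2+\eta^2)-2\end{pmatrix},$$ with Fourier transform in $(x,y)$, $\hat f(\xi,\eta)=\int e^{-i(x\xi+y\eta)}f\,dx\,dy$. The Green's function depends on $x,x'$ only through $x-x'$, and one also writes $\mathbb{G}(x-x',y,t;y')$ for $\mathbb{G}(x,y,t;x',y')$. For a kernel $K(x,y,t;x',y')$ (here $K$ is $\mathbb{G}$ or one of its derivatives), $$|||K(t)|||_{L^p}=\max\Bigl\{\sup_{x',y'}\|K(\cdot,\cdot,t;x',y')\|_{L^p(\mathbb{R}^2)},\ \sup_{x,y}\|K(x,y,t;\cdot,\cdot)\|_{L^p(\mathbb{R}^2)}\Bigr\}.$$ Norms of matrices are taken with respect to any fixed norm on $2\times2$ matrices. *)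

(* Defs.v *)
From mathcomp Require Import all_boot all_order all_algebra.
From mathcomp Require Import complex.
From mathcomp Require Import all_classical all_reals all_analysis.

Set Implicit Arguments.
Unset Strict Implicit.
Unset Printing Implicit Defensive.

Import Order.TTheory GRing.Theory Num.Theory.
Import numFieldNormedType.Exports.

Local Open Scope classical_set_scope.
Local Open Scope ring_scope.

Section Plane.
Context {R : realType}.

Definition leb2 : {measure set (measurableTypeR R * measurableTypeR R)%type
                      -> \bar R} :=
  (@lebesgue_measure R \x @lebesgue_measure R)%E.

(* The L^1 norm of a matrix-valued function, for the library's sup norm on
   matrices. *)
Definition L1norm (f : R -> R -> 'M[R]_2) : \bar R :=
  (\int[leb2]_z (`|f z.1 z.2|)%:E)%E.

Definition integralC (g : R -> R -> R[i]) : R[i] :=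
  Complex (\int[leb2]_z (complex.Re (g z.1 z.2)))%R
          (\int[leb2]_z (complex.Im (g z.1 z.2)))%R.

Definition expi (theta : R) : R[i] := Complex (cos theta) (sin theta).

(* hat f (xi, eta) = int e^{-i (x xi + y eta)} f(x, y) dx dy, entrywise; it is
   only used below for functions with finite L^1 norm. *)
Definition fourier (f : R -> R -> 'M[R]_2) (xi eta : R) : 'M[R[i]]_2 :=
  \matrix_(i, j)
    integralC (fun x y => expi (- (x * xi + y * eta)) * (f x y i j)%:C%C).

Definition Bsymbol (xi eta : R) : 'M[R]_2 :=
  let r := xi ^+ 2 + eta ^+ 2 in
  \matrix_(i < 2, j < 2)
    (nth [::] [:: [:: - r ; r ];
                  [:: 1   ; - r - 2 ] ] i)`_j.

(* g = B(D) f, where B(D) is the Fourier multiplier with symbol Bsymbol. *)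
Definition is_BD (f g : R -> R -> 'M[R]_2) : Prop :=
  forall xi eta : R,
    fourier g xi eta = map_mx (real_complex R) (Bsymbol xi eta)
                         *m fourier f xi eta.

(* Continuity on the open half space t > 0. *)
Definition continuous_pos (F : R -> R -> R -> 'M[R]_2) : Prop :=
  forall x y t : R, 0 < t ->
    {for (x, y, t), continuous (fun z : R * R * R => F z.1.1 z.1.2 z.2)}.

Definition d_t (F : R -> R -> R -> 'M[R]_2) (x y t : R) : 'M[R]_2 :=
  derive1 (F x y) t.
Definition d_x (F : R -> R -> R -> 'M[R]_2) (x y t : R) : 'M[R]_2 :=
  derive1 (fun u => F u y t) x.

Definition transport (A : R) (F : R -> R -> R -> 'M[R]_2) (t x y : R) :
    'M[R]_2 :=
  d_t F x y t + (A * y) *: d_x F x y t.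

(* F is the solution of  d_t F + A y d_x F - B(D) F = 0,
   F(t = 0) = delta_(x0, y0) I:  a classical (C^1 in (t, x)) solution for t > 0,
   in the uniqueness class L^oo_loc([0, oo); L^1) and with
   B(D) F = d_t F + A y d_x F in L^oo_loc((0, oo); L^1), so that B(D) acts
   through the Fourier transform of integrable functions.  The initial datum is
   attained in the sense of weak convergence of measures. *)
Record solution_from_delta (A x0 y0 : R) (F : R -> R -> R -> 'M[R]_2) : Prop := {
  sol_cont : continuous_pos F;
  sol_derivable_t : forall x y t : R, 0 < t -> derivable (F x y) t 1;
  sol_derivable_x : forall x y t : R, 0 < t -> derivable (fun u => F u y t) x 1;
  sol_cont_t : continuous_pos (d_t F);
  sol_cont_x : continuous_pos (d_x F);
  sol_L1 : forall T : R, 0 < T -> exists M : R, forall t : R, 0 < t <= T ->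
    (L1norm (fun x y => F x y t) <= M%:E)%E;
  sol_BD_L1 : forall a b : R, 0 < a -> exists M : R, forall t : R, a <= t <= b ->
    (L1norm (transport A F t) <= M%:E)%E;
  sol_eq : forall t : R, 0 < t ->
    is_BD (fun x y => F x y t) (transport A F t);
  sol_init : forall phi : R * R -> R, continuous phi ->
    (exists M : R, forall z, `|phi z| <= M) ->
    (\matrix_(i, j) (\int[leb2]_z (phi z * F z.1 z.2 t i j))%R : 'M[R]_2)
      @[t --> 0^'+] --> (phi (x0, y0))%:M
}.

(* Arguments in the order x, y, t, x', y'. *)
Definition green_function (A : R) (G : R -> R -> R -> R -> R -> 'M[R]_2) : Prop :=
  forall x' y', solution_from_delta A x' y' (fun x y t => G x y t x' y').

Definition is_matrix_norm (N : 'M[R]_2 -> R) : Prop :=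
  [/\ forall M, N M = 0 -> M = 0,
      forall M M', N (M + M') <= N M + N M'
    & forall (a : R) M, N (a *: M) = `|a| * N M].

(* |||K|||_{L^p} for a kernel K(x, y; x', y') at a fixed time. *)
Definition kernel_norm (N : 'M[R]_2 -> R) (p : \bar R)
    (K : R -> R -> R -> R -> 'M[R]_2) : \bar R :=
  let Lpnorm (f : R * R -> R) : \bar R := Lnorm leb2 p (EFin \o f) in
  maxe
    (ereal_sup (range (fun w : R * R => Lpnorm (fun z => N (K z.1 z.2 w.1 w.2)))))
    (ereal_sup (range (fun z : R * R => Lpnorm (fun w => N (K z.1 z.2 w.1 w.2))))).

(* d_a^{k1} d_b^{k2} f *)
Definition partial (k1 k2 : nat) (f : R -> R -> 'M[R]_2) (a b : R) : 'M[R]_2 :=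
  derive1n k1 (fun u => derive1n k2 (f u) b) a.

(* The iterated partial derivative exists everywhere (derive1n is total). *)
Definition has_partial (k1 k2 : nat) (f : R -> R -> 'M[R]_2) : Prop :=
  (forall j a b, (j < k2)%N -> derivable (derive1n j (f a)) b 1) /\
  (forall j a b, (j < k1)%N -> derivable (fun u => partial j k2 f u b) a 1).

Definition green_bound (A : R) (k1 k2 : nat) (p : \bar R) (t : R) : R :=
  let q := 1 - fine (p^-1)%E in
  t `^ (- q - (k1 + k2)%:R / 2)
    * (1 + (A * t) ^+ 2) `^ (- (1 / 2) * (q + k1%:R)).

End Plane.

(* Main.v *)
(* Following the Fourier transform of the Green's function along the
   characteristics of the shear, one finds for each column a linear system
   p' = - r (p - q), q' = p - (r + 2) q with r = xi^2 + (eta - A s xi)^2, whose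
   energy E = (p - q)^2 + q^2 satisfies E' <= - r E.  Solutions are therefore
   unique, so the kernel with source (x', y') is the one with source (0, 0) up to
   a phase, and they decay like a Gaussian of width 1 / (sqrt t L) in xi and
   1 / sqrt t in eta - A t xi / 2, where L^2 = 1 + (A t)^2.  The same energy
   estimate, applied jointly to the finite differences of order at most 4 in the
   frequency, shows that these have the same Gaussian decay.  Translating the
   frequency by half a period of the phase turns the kernel into an integral of
   such a fourth difference; this bounds every derivative of the kernel by its
   scaling factor times 1 / ((1 + X^2) (1 + Y^2)), with
   X = (x - x' - A t (y + y') / 2) / (sqrt t L) and Y = (y - y') / sqrt t, and the
   L^p norms of this product are explicit for all p >= 1. *)

Require Import Defs.
From HB Require Import structures.
From mathcomp Require Import all_boot all_order all_algebra.
From mathcomp Require Import all_classical all_reals all_analysis.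
From mathcomp Require Import measurable_realfun ess_sup_inf complex ring lra.

Import Order.TTheory GRing.Theory Num.Theory.
Import numFieldNormedType.Exports.

Set Implicit Arguments.
Unset Strict Implicit.
Unset Printing Implicit Defensive.

Local Open Scope classical_set_scope.
Local Open Scope ring_scope.

(** * Integration on the plane *)

(** Finite differences are used instead of derivatives because nothing is known beforehand about the
    smoothness of the transform in the frequency, whereas each single frequency has its own linear
    system. The rate is a quadratic form in the frequency, so its differences stop at the second
    order and the differenced systems close. The constants are uniform in [t] and [A] because the
    two frequency steps are chosen with rate at most 1 / t on (0, t]: the energies of the
    differences then grow at a rate constant / t, whose integral over (0, t] is a pure number. Order
    four is what the product (1 + X^2) (1 + Y^2) asks for, as X^2 Y^2 <= (X^4 + Y^4) / 2. On the
    side of the solution, the derivative along the shear is bounded only in L^1, locally uniformly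
    in time, so the linear system is first obtained in integrated form: integrate along each
    characteristic, then exchange the integrals. In the estimates, real cosine transforms with a
    phase stand for complex ones. *)

Section measure_plane.
Context {R : realType}.
Notation TR := (measurableTypeR R).
Notation mu := (@lebesgue_measure R).

(* Caratheodory functions: f is the limit of (x, y) |-> f (floor (n x) / n) y. *)
Lemma measurable_caratheodory d (T : measurableType d) (f : R -> T -> R) :
  (forall y, continuous (f ^~ y)) -> (forall x, measurable_fun setT (f x)) ->
  measurable_fun setT (fun z : TR * T => f z.1 z.2).
Proof.
move=> cf mf.
pose g n (z : TR * T) := f ((Num.floor (z.1 * n.+1%:R))%:~R / n.+1%:R) z.2.
apply: (@measurable_fun_cvg _ _ _ _ g).
- move=> n _ B mB; rewrite setTI.
  rewrite [X in measurable X](_ : _ = \bigcup_(k in [set: int])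
     ([set x : TR | Num.floor (x * n.+1%:R) = k] `*`
       (f (k%:~R / n.+1%:R) @^-1` B))); last first.
    apply/seteqP; split => [[x y]/= h|[x y]/= [k _ [/= <- //]]].
    by exists (Num.floor (x * n.+1%:R)).
  apply: countable_bigcupT_measurable => [|k]; first exact: countableP.
  apply: measurableX; last first.
    by rewrite -[X in measurable X]setTI; exact: mf.
  rewrite [X in measurable X](_ : _ = `[k%:~R / n.+1%:R, (k + 1)%:~R / n.+1%:R[%classic).
    exact: measurable_itv.
  apply/seteqP; split => x /=.
    move=> <-; rewrite in_itv/= ler_pdivrMr// ltr_pdivlMr//.
    by rewrite floor_itv.
  rewrite in_itv/= ler_pdivrMr// ltr_pdivlMr// => h.
  by apply: floor_def.
- move=> [x y] _ /=; rewrite /g/=.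
  apply: (@cvg_comp _ _ _ (fun n => (Num.floor (x * n.+1%:R))%:~R / n.+1%:R : R)
     (f ^~ y) _ (nbhs x)); last exact: cf.
  apply/cvgrPdist_le => e e0.
  near=> n.
  have n0 : (0 : R) < n.+1%:R by [].
  have /andP[h1 h2] := floor_itv (x * n.+1%:R).
  have e1 : n.+1%:R^-1 <= (PosNum e0)%:num.
    apply: ltW; near: n; exact: near_infty_natSinv_lt.
  apply: le_trans e1.
  have -> : x - (Num.floor (x * n.+1%:R))%:~R / n.+1%:R
     = (x * n.+1%:R - (Num.floor (x * n.+1%:R))%:~R) / n.+1%:R.
    by rewrite mulrBl mulfK// gt_eqF.
  rewrite normrM normfV (ger0_norm (ltW n0)) ler_piMl ?invr_ge0 ?(ltW n0)//.
  move: h2; rewrite intrD => h2.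
  rewrite ger0_norm; lra.
Unshelve. all: by end_near. Qed.

Lemma measurable_continuous2 (f : R -> R -> R) :
  (forall y, continuous (f ^~ y)) -> (forall x, continuous (f x)) ->
  measurable_fun setT (fun z : TR * TR => f z.1 z.2).
Proof.
move=> c1 c2; apply: measurable_caratheodory => // x.
exact: continuous_measurable_fun.
Qed.

(** The pushforward of Lebesgue measure under the translation agrees with it on the intervals []a,
    b]], hence everywhere. *)
Lemma ge0_integral_shift (f : R -> \bar R) (c : R) :
  measurable_fun setT f -> (forall x, 0 <= f x)%E ->
  (\int[mu]_x f ((x : R) + c)%R = \int[mu]_x f x)%E.
Proof.
move=> mf f0.
pose phi := (fun x : TR => (x + c : TR)).
have mphi : measurable_fun setT phi by exact: measurable_funD.
have h A : measurable A -> mu A = pushforward mu phi A.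
  move=> mA.
  apply: (@lebesgue_measure_unique R (pushforward mu phi)) => // X [[a b] /= _ <-].
  rewrite /pushforward.
  have -> : phi @^-1` `]a, b] = `](a - c), (b - c)]%classic.
    by apply/seteqP; split => x/=; rewrite !in_itv/= /phi ltrBlDr lerBrDr.
  rewrite !lebesgue_measure_itv/= !lte_fin ltrD2r.
  by case: ifP => // _; rewrite -!EFinB; congr (_%:E); ring.
rewrite -[LHS](@ge0_integral_pushforward _ _ _ _ _ phi mphi mu setT f)//.
by apply: eq_measure_integral => A mA _; exact/esym/h.
Qed.

(** Invariance is asked for nonnegative functions, the form that Tonelli's theorem yields; the
    signed case follows by positive and negative parts. *)
Definition preserving (phi : TR * TR -> TR * TR) :=
  measurable_fun setT phi /\
  forall f : TR * TR -> \bar R, measurable_fun setT f -> (forall z, 0 <= f z)%E ->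
    (\int[leb2]_z f (phi z) = \int[leb2]_z f z)%E.

(** At a fixed second coordinate the shear is a translation, so integrating the first coordinate
    innermost reduces it to [ge0_integral_shift]. *)
Lemma preserving_shear (a b : R) :
  preserving (fun z => (z.1 + (a * z.2 + b), z.2)).
Proof.
have mphi : measurable_fun setT (fun z : TR * TR => (z.1 + (a * z.2 + b), z.2) : TR * TR).
  apply/measurable_fun_pair => //=; apply: measurable_funD => //=.
  by apply: measurable_funD => //; apply: measurable_funM.
split => // f mf f0.
rewrite /leb2 fubini_tonelli2//; last exact: measurableT_comp.
rewrite fubini_tonelli2//; apply: eq_integral => y _.
rewrite /fubini_G/= (@ge0_integral_shift (fun x => f (x, y)))//.
exact: measurableT_comp.
Qed.

Lemma preserving_shift2 (b : R) : preserving (fun z => (z.1, z.2 + b)).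
Proof.
have mphi : measurable_fun setT (fun z : TR * TR => (z.1, z.2 + b) : TR * TR).
  by apply/measurable_fun_pair => //=; apply: measurable_funD.
split => // f mf f0.
rewrite /leb2 fubini_tonelli1//; last exact: measurableT_comp.
rewrite fubini_tonelli1//; apply: eq_integral => x _.
rewrite /fubini_F/= (@ge0_integral_shift (fun y => f (x, y)))//.
exact: measurableT_comp.
Qed.

Lemma preserving_shift (v1 v2 : R) : preserving (fun z => (z.1 + v1, z.2 + v2)).
Proof.
have [m1 p1] := preserving_shear 0 v1.
have [m2 p2] := preserving_shift2 v2.
have E : (fun z : TR * TR => (z.1 + v1, z.2 + v2)) =
   (fun z : TR * TR => (z.1, z.2 + v2)) \o (fun z => (z.1 + (0 * z.2 + v1), z.2)).
  by apply/funext => z /=; rewrite mul0r add0r.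
split; first by rewrite E; exact: measurableT_comp.
move=> f mf f0; rewrite -(p2 f mf f0) -(p1 (fun z => f (z.1, z.2 + v2)))//.
  by apply: eq_integral => z _ /=; rewrite mul0r add0r.
exact: (measurableT_comp mf m2).
Qed.

Lemma preserving_integral phi (f : TR * TR -> R) : preserving phi ->
  measurable_fun setT f ->
  (\int[leb2]_z f (phi z))%R = (\int[leb2]_z f z)%R.
Proof.
move=> [mphi p] mf; rewrite /Rintegral; congr fine.
rewrite [LHS]integralE [RHS]integralE; congr (_ - _)%E.
  rewrite -[RHS]p//; last exact/measurable_funepos/measurable_EFinP.
  by apply: eq_integral => z _; rewrite unlock /=.
rewrite -[RHS]p//; last exact/measurable_funeneg/measurable_EFinP.
by apply: eq_integral => z _; rewrite unlock /=.
Qed.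

Lemma preserving_integrable phi (f : TR * TR -> R) : preserving phi ->
  leb2.-integrable setT (EFin \o f) ->
  leb2.-integrable setT (EFin \o (f \o phi)).
Proof.
move=> [mphi p] /integrableP[mf fi]; apply/integrableP; split.
  exact: (measurableT_comp mf mphi).
by rewrite /= (p (fun z => `|(f z)%:E|)%E)//; exact: measurableT_comp.
Qed.

Lemma ge0_integral_affine (g : R -> R) (s c : R) : continuous g ->
  (forall x, 0 <= g x) -> 0 < s ->
  (\int[mu]_x (g (((x : R) - c) / s))%:E = s%:E * \int[mu]_x (g x)%:E)%E.
Proof.
move=> cg g0 s0.
have s0' : s != 0 by rewrite gt_eqF.
pose F := fun x : R => (x - c) / s.
have dF (x : R) : is_derive x (1 : R) F s^-1.
  by apply: is_derive_eq; rewrite scaler0 add0r subr0 -[LHS]/(_ * _) mulr1.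
have F'E : derive1 F = cst s^-1.
  by apply/funext => x; rewrite derive1E; exact: derive_val.
rewrite [in RHS](@increasing_ge0_integration_by_substitutionT R F g)//.
- rewrite F'E.
  rewrite -ge0_integralZl//.
  + apply: eq_integral => x _; rewrite -EFinM; congr (_%:E).
    by rewrite -[RHS]/(s * (g (F x) * s^-1)) mulrCA divff// mulr1.
  + apply/measurable_EFinP; apply: measurable_funM => //.
    apply: measurableT_comp; first exact: continuous_measurable_fun.
    apply: continuous_measurable_fun => x.
    by apply/differentiable_continuous/derivable1_diffP; have [] := dF x.
  + by move=> x _; rewrite lee_fin mulr_ge0//= invr_ge0 ltW.
  + by rewrite lee_fin ltW.
- by move=> x y xy; rewrite /F ltr_pM2r ?invr_gt0// ltrD2r.
- by rewrite F'E; move=> x; exact: cvg_cst.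
- by rewrite F'E; exact: is_cvg_cst.
- by rewrite F'E; exact: is_cvg_cst.
- apply/cvgrNyPle => A; near=> x; rewrite /F ler_pdivrMr// lerBlDr.
  by near: x; apply: nbhs_ninfty_le; exact: num_real.
- apply/cvgryPge => A; near=> x; rewrite /F ler_pdivlMr// lerBrDr.
  by near: x; apply: nbhs_pinfty_ge; exact: num_real.
Unshelve. all: by end_near. Qed.

Lemma integral_cauchy : (\int[mu]_x ((1 + (x : R) ^+ 2)^-1)%:E = pi%:E :> \bar R)%E.
Proof.
have := @integral0y_oneDsqr R; rewrite /oneDsqr => h.
rewrite ge0_symfun_integralT//.
- rewrite (_ : [set x | 0 <= x] = `[0, +oo[%classic); last first.
    by apply/seteqP; split => x /=; rewrite in_itv/= andbT.
  by rewrite h -EFinM; congr (_%:E); rewrite mulrC divfK.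
- by move=> x; rewrite invr_ge0 addr_ge0// sqr_ge0.
- exact: continuous_oneDsqrV.
- by move=> x /=; rewrite sqrrN.
Qed.

End measure_plane.

(** * The energy estimate along characteristics and finite differences *)

Section energy.
Context {R : realType}.
Implicit Types (r p q f g : R -> R).

Notation is_der f s l := (is_derive (s : R) (1 : R) f l).

(** [Phi * expR (- G)] is nonincreasing on (0, T], and its value at [T] is compared with its right
    limit at 0. Limits replace initial values because the solutions are differentiable at positive
    times only. *)
Lemma gronwall_at0 (Phi dPhi g G : R -> R) (Phi0 T : R) : 0 < T ->
  (forall s, 0 < s <= T -> is_der Phi s (dPhi s)) ->
  (forall s, 0 < s <= T -> is_der G s (g s)) ->
  (forall s, 0 < s <= T -> dPhi s <= g s * Phi s) ->
  Phi s @[s --> 0^'+] --> Phi0 -> G s @[s --> 0^'+] --> G 0 ->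
  Phi T <= Phi0 * expR (G T - G 0).
Proof.
move=> T0 dP dG le cP cG.
pose Psi s := Phi s * expR (- G s).
have dPsi s : 0 < s <= T ->
    is_der Psi s ((dPhi s - g s * Phi s) * expR (- G s)).
  move=> sT; have h1 := dP _ sT; have h2 := dG _ sT.
  by apply: is_derive_eq; rewrite /GRing.scale/=; ring.
have mono s : 0 < s <= T -> Psi T <= Psi s.
  move=> /andP[s0 sT].
  have sub x : s <= x <= T -> 0 < x <= T.
    by move=> /andP[h1 ->]; rewrite (lt_le_trans s0 h1).
  apply: (@ler0_derive1_nincr _ Psi s T) => //.
  - move=> x; rewrite in_itv/= => /andP[/ltW h1 /ltW h2].
    have /dPsi[] // : 0 < x <= T by apply: sub; rewrite h1.
  - move=> x; rewrite in_itv/= => /andP[/ltW h1 /ltW h2].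
    have h : 0 < x <= T by apply: sub; rewrite h1.
    rewrite derive1E; have := dPsi _ h => -[_ ->].
    by rewrite mulr_le0_ge0 ?expR_ge0// subr_le0 le.
  - apply: derivable_within_continuous => x; rewrite in_itv/= => /sub h.
    by have /dPsi[] := h.
have cPsi : Psi s @[s --> 0^'+] --> Phi0 * expR (- G 0).
  apply: cvgM => //; apply: continuous_cvg; first exact: continuous_expR.
  exact: cvgN.
have : Psi T <= Phi0 * expR (- G 0).
  rewrite -(cvg_lim _ cPsi)//; apply: limr_ge; first by apply/cvg_ex; eexists; exact: cPsi.
  near=> s; apply: mono; apply/andP; split=> //.
  by near: s; apply: nbhs_right_le.
rewrite /Psi => h.
have : Phi T * expR (- G T) * expR (G T) <= Phi0 * expR (- G 0) * expR (G T).
  by rewrite ler_pM2r ?expR_gt0.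
by rewrite -!mulrA -!expRD addNr expR0 mulr1 (addrC (- G 0)).
Unshelve. all: by end_near. Qed.

Definition micropolar_ode r p q := forall s, 0 < s ->
  is_der p s (- r s * p s + r s * q s) /\
  is_der q s (p s - (r s + 2) * q s).

Lemma is_derive_energy p q (s p' q' : R) : is_der p s p' -> is_der q s q' ->
  is_der (fun s => (p s - q s) ^+ 2 + q s ^+ 2) s
    (2 * (p s - q s) * (p' - q') + 2 * q s * q').
Proof.
move=> hp hq.
have h1 : is_der (fun s => (p s - q s) ^+ 2) s (2 * (p s - q s) * (p' - q')).
  by apply: is_derive_eq; rewrite /GRing.scale/=; ring.
have h2 : is_der (fun s => q s ^+ 2) s (2 * q s * q').
  by apply: is_derive_eq; rewrite /GRing.scale/=; ring.
exact: is_derive_eq.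
Qed.

Lemma energy_cvg p q (F : set_system R) {FF : Filter F} (p0 q0 : R) :
  p s @[s --> F] --> p0 -> q s @[s --> F] --> q0 ->
  (p s - q s) ^+ 2 + q s ^+ 2 @[s --> F] --> (p0 - q0) ^+ 2 + q0 ^+ 2.
Proof.
move=> hp hq; apply: cvgD.
  rewrite expr2; under eq_fun do rewrite expr2.
  by apply: cvgM; apply: cvgB.
rewrite expr2; under eq_fun do rewrite expr2.
exact: cvgM.
Qed.

Lemma micropolar_ode_unique r p q : (forall s, 0 <= r s) ->
  micropolar_ode r p q ->
  p s @[s --> 0^'+] --> (0 : R) -> q s @[s --> 0^'+] --> (0 : R) ->
  forall s, 0 < s -> p s = 0 /\ q s = 0.
Proof.
move=> r0 ode cp cq T T0.
have h1 : (p T - q T) ^+ 2 + q T ^+ 2 <= 0 * expR (0 - 0).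
  apply: (@gronwall_at0 (fun s => (p s - q s) ^+ 2 + q s ^+ 2)
    (fun s => 2 * (p s - q s) * ((- r s * p s + r s * q s) - (p s - (r s + 2) * q s))
      + 2 * q s * (p s - (r s + 2) * q s)) (fun=> 0) (fun=> 0)) => //.
  - move=> s /andP[s0 _]; have [h1 h2] := ode _ s0.
    exact: is_derive_energy.
  - move=> s /andP[s0 _]; rewrite mul0r.
    have := r0 s; move: (r s) (p s) (q s) => a b c a0.
    (* Minus a sum of squares: E' = - (r + 2) (p - 2 q)^2 - r E. *)
    have -> : 2 * (b - c) * ((- a * b + a * c) - (b - (a + 2) * c)) +
      2 * c * (b - (a + 2) * c) = - (a + 2) * ((b - c - c) ^+ 2) - a * ((b-c)^+2 + c ^+ 2).
      by ring.
    have := sqr_ge0 (b - c - c); have := sqr_ge0 (b - c); have := sqr_ge0 c.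
    move: (_ ^+ 2) (_ ^+ 2) (_ ^+ 2) => x y z x0 y0 z0.
    nra.
  - have E : (0 - 0 : R) ^+ 2 + 0 ^+ 2 = 0 by rewrite subr0 expr0n addr0.
    by have := @energy_cvg p q _ _ 0 0 cp cq; rewrite E; apply.
  - exact: cvg_cst.
rewrite mul0r in h1.
have h2 := sqr_ge0 (p T - q T); have h3 := sqr_ge0 (q T).
have /eqP : q T ^+ 2 = 0 by lra.
have /eqP : (p T - q T) ^+ 2 = 0 by lra.
rewrite !sqrf_eq0 => /eqP h4 /eqP h5; split=> //.
by rewrite -h4 h5 subr0.
Qed.

(** Iterated forward difference quotient in the index, which labels frequencies shifted by multiples
    of [h]; it plays the role of a derivative of order [n] in the frequency, without a factorial. *)
Fixpoint fdiff (h : R) (f : nat -> R -> R) (n j : nat) (s : R) : R :=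
  if n is m.+1 then (fdiff h f m j.+1 s - fdiff h f m j s) / h else f j s.

Section differences.
Variables (h : R) (r rho kap : R -> R) (p q : nat -> R -> R).
Hypothesis h0 : h != 0.

(** Expansion of a quadratic form at a point displaced by [x * h] times a step: [r] is its value at
    the point, [kap] its value at the step and [rho] the associated bilinear form between the
    two. *)
Definition shifted_rate (x : R) (s : R) :=
  r s + 2 * x * h * rho s + x ^+ 2 * h ^+ 2 * kap s.

Hypothesis ode : forall j, micropolar_ode (shifted_rate j%:R) (p j) (q j).

(** The difference quotient of [shifted_rate] between [x - 1] and [x]; the next quotient is the
    constant [2 * kap]. *)
Definition rate_diff (x : R) (s : R) := 2 * rho s + (2 * x - 1) * h * kap s.

(* The rate is quadratic in the frequency, so a difference of order n is forced
   only by those of order n - 1 and n - 2. *)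
Lemma fdiff_ode n j s : 0 < s ->
  let x : R := (j + n)%:R in
  is_der (fdiff h p n j) s
   (- shifted_rate x s * fdiff h p n j s + shifted_rate x s * fdiff h q n j s
    + n%:R * rate_diff x s * (fdiff h q n.-1 j s - fdiff h p n.-1 j s)
    + n%:R * (n%:R - 1) * kap s * (fdiff h q n.-2 j s - fdiff h p n.-2 j s)) /\
  is_der (fdiff h q n j) s
   (fdiff h p n j s - (shifted_rate x s + 2) * fdiff h q n j s
    - n%:R * rate_diff x s * fdiff h q n.-1 j s
    - n%:R * (n%:R - 1) * kap s * fdiff h q n.-2 j s).
Proof.
move=> s0; elim: n j => [|n IH] j /=.
  rewrite addn0 !mul0r !addr0 !subr0; exact: ode.
have [p1 q1] := IH j.+1; have [p0 q0] := IH j.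
have Ej : ((j.+1 + n)%:R : R) = (j + n.+1)%:R by rewrite addSnnS.
have En : ((j + n.+1)%:R : R) = (j + n)%:R + 1 by rewrite addnS -natr1.
have Sn : (n.+1%:R : R) = n%:R + 1 by rewrite -natr1.
rewrite Ej En in p1 q1; rewrite En Sn.
move: ((j + n)%:R : R) p1 q1 p0 q0 => x p1 q1 p0 q0.
have ED P Q (a b : R) : is_der P s a -> is_der Q s b ->
    is_der (fun u => (P u - Q u) / h) s ((a - b) / h).
  move=> dP dQ; apply: is_derive_eq; rewrite /GRing.scale/=.
  by rewrite mulr0 add0r mulrC.
(* At order 0 the truncated predecessor [n.-1] is not a lower order, but its coefficient vanishes;
   the same holds for [n.-2] at order 1. *)
have key : (n%:R = 0 :> R) \/ exists m, n = m.+1.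
  by case: (n) => [|m]; [left|right; exists m].
split.
  apply: (is_derive_eq (ED _ _ _ _ p1 p0)).
  case: key => [E|[m ->]].
    rewrite E /shifted_rate /rate_diff; field.
    by [].
  rewrite /= /shifted_rate /rate_diff -[m.+1%:R]natr1; case: m => [|m] /=; field; by [].
apply: (is_derive_eq (ED _ _ _ _ q1 q0)).
case: key => [E|[m ->]].
  rewrite E /shifted_rate /rate_diff; field.
  by [].
rewrite /= /shifted_rate /rate_diff -[m.+1%:R]natr1; case: m => [|m] /=; field; by [].
Qed.

End differences.

Lemma mul_young (a d m f : R) : 0 < a -> 2 * d * (m * f) <= d ^+ 2 / a * m ^+ 2 + a * f ^+ 2.
Proof.
move=> a0; have := sqr_ge0 (d * m - a * f) => h.
have -> : d ^+ 2 / a * m ^+ 2 + a * f ^+ 2 = 2 * d * (m * f) + (d * m - a * f) ^+ 2 / a.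
  by field; rewrite gt_eqF.
by rewrite lerDl divr_ge0// ltW.
Qed.

(* (m, q), (m1, q1), (m2, q2) stand for the differences of order n, n - 1, n - 2
   in the variables p - q and q, and N for n. *)
Lemma energy_step (r rho kap tau h N m q m1 q1 m2 q2 rn d e : R) :
  0 <= r -> 0 <= kap <= tau -> rho ^+ 2 <= r * kap -> -1 <= h <= 1 ->
  0 <= N <= 4 -> 0 < tau ->
  rn = r + 2 * N * h * rho + N ^+ 2 * h ^+ 2 * kap ->
  d = N * (2 * rho + (2 * N - 1) * h * kap) ->
  e = N * (N - 1) * kap ->
  2 * m * (- (rn + 1) * m + (rn + 1) * q + d * (q1 - m1) + e * (q2 - m2))
  + 2 * q * (m - (rn + 1) * q - d * q1 - e * q2)
  <= - (r / 4) * (m ^+ 2 + q ^+ 2)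
    + 1700 * tau * (m ^+ 2 + q ^+ 2 + (m1 ^+ 2 + q1 ^+ 2) + (m2 ^+ 2 + q2 ^+ 2)).
Proof.
move=> r0 /andP[k0 kt] rk hh NN t0 rnE dE eE.
have h2 : h ^+ 2 <= 1 by rewrite expr2; nra.
have h20 := sqr_ge0 h.
have N2 : N ^+ 2 <= 16 by rewrite expr2; nra.
have N20 := sqr_ge0 N.
have NhE : N ^+ 2 * h ^+ 2 <= 16 by nra.
(* The cross term is absorbed by half of [r], through [rho ^+ 2 <= r * kap]. The inequality is
   proved after multiplication by [kap], which avoids square roots; if [kap] is 0, so is [rho]. *)
have rn_ge : r / 2 - 16 * tau <= rn.
  have := sqr_ge0 (rho + 2 * N * h * kap).
  suff : - 2 * N * h * rho <= r / 2 + 2 * N ^+ 2 * h ^+ 2 * kap.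
    rewrite rnE => H1.
    have : N ^+ 2 * h ^+ 2 * kap <= 16 * tau by nra.
    lra.
  have [k00|kn0] := eqVneq kap 0.
    have : rho ^+ 2 = 0.
      by apply/eqP; rewrite eq_le sqr_ge0 andbT; rewrite k00 mulr0 in rk.
    move/eqP; rewrite sqrf_eq0 => /eqP ->; rewrite k00; lra.
  have kp : 0 < kap by rewrite lt_def kn0.
  have H := sqr_ge0 (rho + 2 * N * h * kap).
  have H' : - 4 * N * h * rho * kap <= r * kap + 4 * N ^+ 2 * h ^+ 2 * kap ^+ 2.
    have -> : - 4 * N * h * rho * kap = rho ^+ 2 + 4 * N ^+ 2 * h ^+ 2 * kap ^+ 2
      - (rho + 2 * N * h * kap) ^+ 2 by ring.
    lra.
  have : (- 4 * N * h * rho) * kap <= (r + 4 * N ^+ 2 * h ^+ 2 * kap) * kap.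
    by apply: le_trans H' _; rewrite le_eqVlt; apply/orP; left; apply/eqP; ring.
  rewrite ler_pM2r//; lra.
have d2 : d ^+ 2 <= 16 * (8 * r + 98 * tau) * tau.
  rewrite dE exprMn.
  have H1 : (2 * rho + (2 * N - 1) * h * kap) ^+ 2 <= (8 * r + 98 * tau) * tau.
    have H2 : (2 * rho + (2 * N - 1) * h * kap) ^+ 2 <=
        8 * rho ^+ 2 + 2 * ((2 * N - 1) ^+ 2 * h ^+ 2 * kap ^+ 2).
      have := sqr_ge0 (2 * rho - (2 * N - 1) * h * kap).
      have -> : (2 * rho - (2 * N - 1) * h * kap) ^+ 2 = 8 * rho ^+ 2 + 2 * ((2 * N - 1) ^+ 2 * h ^+ 2 * kap ^+ 2) - (2 * rho + (2 * N - 1) * h * kap) ^+ 2 by ring.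
      lra.
    have c2 : (2 * N - 1) ^+ 2 <= 49 by rewrite expr2; nra.
    have c20 := sqr_ge0 (2 * N - 1).
    have c3 : (2 * N - 1) ^+ 2 * h ^+ 2 <= 49 by nra.
    have c30 : 0 <= (2 * N - 1) ^+ 2 * h ^+ 2 by exact: mulr_ge0.
    have k2 : kap ^+ 2 <= tau * tau by rewrite expr2; nra.
    have k20 := sqr_ge0 kap.
    have c4 : (2 * N - 1) ^+ 2 * h ^+ 2 * kap ^+ 2 <= 49 * (tau * tau) by apply: ler_pM.
    have c5 : r * kap <= r * tau by rewrite ler_wpM2l.
    have -> : (8 * r + 98 * tau) * tau = 8 * (r * tau) + 2 * (49 * (tau * tau)) by ring.
    lra.
  have := sqr_ge0 (2 * rho + (2 * N - 1) * h * kap).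
  move: H1; move: (_ ^+ 2) => X H1 X0.
  rewrite -mulrA; apply: ler_pM => //.
(* Weights for Young's inequality. With a = 512 tau, d^2 / a takes only r / 4 out of the dissipation
   r / 2, up to a multiple of tau; b = 12 tau bounds |e|, since N (N - 1) <= 12. The largest
   coefficient that results is 3 a = 1536 tau, below 1700 tau. *)
have [a aE] : exists a, a = 512 * tau by exists (512 * tau).
have [b bE] : exists b, b = 12 * tau by exists (12 * tau).
have a0 : 0 < a by lra.
have b0 : 0 < b by lra.
have dtau : d ^+ 2 / a <= r / 4 + 4 * tau.
  rewrite ler_pdivrMr//; apply: le_trans d2 _; rewrite aE.
  have := mulr_ge0 (ltW t0) (ltW t0); have := mulr_ge0 r0 (ltW t0); nra.
have e0 : `|e| <= b.
  rewrite eE bE normrM (ger0_norm k0); apply: ler_pM => //.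
  rewrite ler_norml; apply/andP; split; nra.
have y1 := @mul_young a d m (q1 - m1) a0.
have y2 := @mul_young a d (- q) q1 a0.
have z1 := @mul_young b e m (q2 - m2) b0.
have z2 := @mul_young b e (- q) q2 b0.
have e2 : e ^+ 2 / b <= b.
  rewrite ler_pdivrMr// -expr2 -(ger0_norm (ltW b0)) -real_normK ?num_real//.
  by rewrite ler_pXn2r ?nnegrE ?normr_ge0// (le_trans e0)// ler_norm.
rewrite sqrrN in y2; rewrite sqrrN in z2.
have E2 : 0 <= m ^+ 2 by exact: sqr_ge0.
have E3 : 0 <= q ^+ 2 by exact: sqr_ge0.
have F1 : (q1 - m1) ^+ 2 + q1 ^+ 2 <= 3 * (m1 ^+ 2 + q1 ^+ 2).
  have := sqr_ge0 (m1 + q1); have := sqr_ge0 m1.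
  have -> : (q1 - m1) ^+ 2 = 2 * m1 ^+ 2 + 2 * q1 ^+ 2 - (m1 + q1) ^+ 2 by ring.
  lra.
have F2 : (q2 - m2) ^+ 2 + q2 ^+ 2 <= 3 * (m2 ^+ 2 + q2 ^+ 2).
  have := sqr_ge0 (m2 + q2); have := sqr_ge0 m2.
  have -> : (q2 - m2) ^+ 2 = 2 * m2 ^+ 2 + 2 * q2 ^+ 2 - (m2 + q2) ^+ 2 by ring.
  lra.
have A1 : d ^+ 2 / a * (m ^+ 2 + q ^+ 2) <= (r / 4 + 4 * tau) * (m ^+ 2 + q ^+ 2).
  by rewrite ler_wpM2r// addr_ge0.
have A2 : e ^+ 2 / b * (m ^+ 2 + q ^+ 2) <= b * (m ^+ 2 + q ^+ 2).
  by rewrite ler_wpM2r// addr_ge0.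
have A3 : a * ((q1 - m1) ^+ 2 + q1 ^+ 2) <= a * (3 * (m1 ^+ 2 + q1 ^+ 2)).
  by rewrite ler_wpM2l// ltW.
have A4 : b * ((q2 - m2) ^+ 2 + q2 ^+ 2) <= b * (3 * (m2 ^+ 2 + q2 ^+ 2)).
  by rewrite ler_wpM2l// ltW.
have -> : 2 * m * (- (rn + 1) * m + (rn + 1) * q + d * (q1 - m1) + e * (q2 - m2))
  + 2 * q * (m - (rn + 1) * q - d * q1 - e * q2) =
  - rn * (m ^+ 2 + q ^+ 2) - (rn + 2) * (m - q) ^+ 2 +
  2 * d * (m * (q1 - m1)) + 2 * d * (- q * q1) + 2 * e * (m * (q2 - m2)) + 2 * e * (- q * q2).
  by ring.
(* The shifted rate is nonnegative by the discriminant condition [rho ^+ 2 <= r * kap]. *)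
have rn0 : 0 <= rn.
  have [k00|kn0] := eqVneq kap 0.
    have : rho ^+ 2 = 0.
      by apply/eqP; rewrite eq_le sqr_ge0 andbT; rewrite k00 mulr0 in rk.
    by move/eqP; rewrite sqrf_eq0 rnE => /eqP ->; rewrite k00; lra.
  have kp : 0 < kap by rewrite lt_def kn0.
  rewrite -(pmulr_lge0 _ kp).
  have -> : rn * kap = r * kap - rho ^+ 2 + (rho + N * h * kap) ^+ 2 by rewrite rnE; ring.
  by rewrite addr_ge0 ?sqr_ge0// subr_ge0.
have B1 : 0 <= (rn + 2) * (m - q) ^+ 2 by rewrite mulr_ge0 ?sqr_ge0// addr_ge0.
have B2 : (r / 2 - 16 * tau) * (m ^+ 2 + q ^+ 2) <= rn * (m ^+ 2 + q ^+ 2).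
  by rewrite ler_wpM2r// addr_ge0.
have P1 : 0 <= tau * (m ^+ 2 + q ^+ 2) by rewrite mulr_ge0 ?addr_ge0// ltW.
have P2 : 0 <= tau * (m1 ^+ 2 + q1 ^+ 2) by rewrite mulr_ge0 ?addr_ge0 ?sqr_ge0// ltW.
have P3 : 0 <= tau * (m2 ^+ 2 + q2 ^+ 2) by rewrite mulr_ge0 ?addr_ge0 ?sqr_ge0// ltW.
subst a b; lra.
Qed.

End energy.

(** * Joint decay of the differences of order at most four *)

Section difference_decay.
Context {R : realType}.
Notation is_der f s l := (is_derive (s : R) (1 : R) f l).

Lemma fdiff_cvg (h : R) (f : nat -> R -> R) (a : nat -> R) (F : set_system R) {FF : Filter F} :
  (forall j, f j s @[s --> F] --> a j) ->
  forall n j, fdiff h f n j s @[s --> F] --> fdiff h (fun i _ => a i) n j 0.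
Proof.
move=> fa; elim=> [|n IH] j /=; first exact: fa.
by apply: cvgM; [apply: cvgB; exact: IH|exact: cvg_cst].
Qed.

Lemma fdiff_mulr (h : R) (a : nat -> R) (c : R) n j :
  fdiff h (fun i _ => a i * c) n j 0 = fdiff h (fun i _ => a i) n j 0 * c.
Proof. by elim: n j => [|n IH] j //=; rewrite !IH; ring. Qed.

(** 1700 comes from [energy_step] and 15 from [growth_sum]; a growth rate of [growth_const / t] acts
    during a time [t]. *)
Definition growth_const : R := 1700 * 15.

(** At orders 0 and 1 the truncated predecessors repeat [E0]. Fifteen energies multiply [B] on the
    right altogether, whence the crude factor 15. *)
Lemma growth_sum (A B X1 X2 X3 X4 X5 E0 E1 E2 E3 E4 : R) :
  0 <= E0 -> 0 <= E1 -> 0 <= E2 -> 0 <= E3 -> 0 <= E4 -> 0 <= B ->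
  X1 <= A * E0 + B * (E0 + E0 + E0) ->
  X2 <= A * E1 + B * (E1 + E0 + E0) ->
  X3 <= A * E2 + B * (E2 + E1 + E0) ->
  X4 <= A * E3 + B * (E3 + E2 + E1) ->
  X5 <= A * E4 + B * (E4 + E3 + E2) ->
  X1 + X2 + X3 + X4 + X5 <= (A + 15 * B) * (E0 + E1 + E2 + E3 + E4).
Proof.
move=> h0 h1 h2 h3 h4 b.
have := mulr_ge0 b h0; have := mulr_ge0 b h1; have := mulr_ge0 b h2.
have := mulr_ge0 b h3; have := mulr_ge0 b h4.
have -> : (A + 15 * B) * (E0 + E1 + E2 + E3 + E4) = A * E0 + A * E1 + A * E2 + A * E3 + A * E4 + 15 * (B * E0 + B * E1 + B * E2 + B * E3 + B * E4) by ring.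
rewrite !mulrDr.
move: (A * E0) (A * E1) (A * E2) (A * E3) (A * E4) (B * E0) (B * E1) (B * E2) (B * E3) (B * E4) => *.
lra.
Qed.

(** Each order is forced by the two preceding ones, so Gronwall's inequality is applied to the sum
    of the five energies. The dissipation left by [energy_step] is [r / 4], and [kap <= t^-1] makes
    the growth over (0, t] a factor [expR growth_const]. The factor 10 counts five initial energies,
    each at most [2 * m]: the datum is a scalar [a j] times a fixed column [(c1, c2)]. *)
Lemma difference_decay (h t c1 c2 m : R) (r rho kap G : R -> R)
    (p q : nat -> R -> R) (a : nat -> R) :
  0 < t -> h != 0 -> -1 <= h <= 1 ->
  (forall s, 0 < s <= t -> 0 <= r s) ->
  (forall s, 0 < s <= t -> 0 <= kap s <= t^-1) ->
  (forall s, 0 < s <= t -> rho s ^+ 2 <= r s * kap s) ->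
  (forall s, 0 < s <= t -> is_der G s (r s)) ->
  G s @[s --> 0^'+] --> G 0 ->
  (forall j, micropolar_ode (shifted_rate h r rho kap j%:R) (p j) (q j)) ->
  (forall j, p j s @[s --> 0^'+] --> a j * c1) ->
  (forall j, q j s @[s --> 0^'+] --> a j * c2) ->
  (c1 - c2) ^+ 2 + c2 ^+ 2 <= 2 ->
  (forall n, (n <= 4)%N -> fdiff h (fun j _ => a j) n 0 0 ^+ 2 <= m) ->
  forall n, n = 0%N \/ n = 4%N ->
  (fdiff h p n 0 t - fdiff h q n 0 t) ^+ 2 + fdiff h q n 0 t ^+ 2 <=
  10 * expR growth_const * m * expR (- ((G t - G 0) / 4)).
Proof.
move=> t0 h0 h1 r0 kt rk dG cG ode cp cq cc am.
have tv0 : 0 < t^-1 by rewrite invr_gt0.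
pose E n s := (fdiff h p n 0 s - fdiff h q n 0 s) ^+ 2 + fdiff h q n 0 s ^+ 2.
have E_ge0 n s : 0 <= E n s by rewrite addr_ge0 ?sqr_ge0.
pose dp n s := - shifted_rate h r rho kap n%:R s * fdiff h p n 0 s +
  shifted_rate h r rho kap n%:R s * fdiff h q n 0 s
    + n%:R * rate_diff h rho kap n%:R s * (fdiff h q n.-1 0 s - fdiff h p n.-1 0 s)
    + n%:R * (n%:R - 1) * kap s * (fdiff h q n.-2 0 s - fdiff h p n.-2 0 s).
pose dq n s := (fdiff h p n 0 s - (shifted_rate h r rho kap n%:R s + 2) * fdiff h q n 0 s
    - n%:R * rate_diff h rho kap n%:R s * fdiff h q n.-1 0 s
    - n%:R * (n%:R - 1) * kap s * fdiff h q n.-2 0 s).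
pose dE n s := 2 * (fdiff h p n 0 s - fdiff h q n 0 s) * (dp n s - dq n s)
  + 2 * fdiff h q n 0 s * dq n s.
have E_der n s : 0 < s -> is_der (E n) s (dE n s).
  move=> s0; have [h2 h3] := fdiff_ode h0 ode n 0 s0.
  exact: is_derive_energy.
have dE_le n s : 0 < s <= t -> (n <= 4)%N ->
    dE n s <= - (r s / 4) * E n s + 1700 * t^-1 * (E n s + E n.-1 s + E n.-2 s).
  move=> st n4; have /andP[s0 _] := st.
  have N4 : 0 <= (n%:R : R) <= 4 by rewrite ler0n ler_nat.
  have := @energy_step R (r s) (rho s) (kap s) t^-1 h n%:R
    (fdiff h p n 0 s - fdiff h q n 0 s) (fdiff h q n 0 s)
    (fdiff h p n.-1 0 s - fdiff h q n.-1 0 s) (fdiff h q n.-1 0 s)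
    (fdiff h p n.-2 0 s - fdiff h q n.-2 0 s) (fdiff h q n.-2 0 s) _ _ _
    (r0 _ st) (kt _ st) (rk _ st) h1 N4 tv0 erefl erefl erefl.
  rewrite -/(E n s) -/(E n.-1 s) -/(E n.-2 s); apply: le_trans.
  rewrite le_eqVlt; apply/orP; left; apply/eqP.
  rewrite /dE /dp /dq /shifted_rate /rate_diff; ring.
pose Phi s := E 0%N s + E 1%N s + E 2%N s + E 3%N s + E 4%N s.
pose dPhi s := dE 0%N s + dE 1%N s + dE 2%N s + dE 3%N s + dE 4%N s.
pose g s := - (r s / 4) + 15 * (1700 * t^-1).
pose H s := - (G s / 4) + 15 * (1700 * t^-1) * s.
pose e n := (fdiff h (fun i _ => a i * c1) n 0 0 - fdiff h (fun i _ => a i * c2) n 0 0) ^+ 2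
  + (fdiff h (fun i _ => a i * c2) n 0 0) ^+ 2.
have em n : (n <= 4)%N -> e n <= 2 * m.
  move=> n4; rewrite /e !fdiff_mulr.
  have -> : (fdiff h (fun j _ => a j) n 0 0 * c1 - fdiff h (fun j _ => a j) n 0 0 * c2) ^+ 2 +
     (fdiff h (fun j _ => a j) n 0 0 * c2) ^+ 2 =
     ((c1 - c2) ^+ 2 + c2 ^+ 2) * (fdiff h (fun j _ => a j) n 0 0) ^+ 2 by ring.
  by apply: ler_pM => //; rewrite ?addr_ge0 ?sqr_ge0 ?am.
have Ecvg n : E n s @[s --> 0^'+] --> e n.
  by apply: energy_cvg; apply: fdiff_cvg.
have main : Phi t <= (e 0%N + e 1%N + e 2%N + e 3%N + e 4%N) * expR (H t - H 0).
  apply: (@gronwall_at0 _ Phi dPhi g H).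
  - exact: t0.
  - move=> s /andP[s0 _].
    have := E_der 0%N s s0; have := E_der 1%N s s0; have := E_der 2%N s s0.
    have := E_der 3%N s s0; have := E_der 4%N s s0 => d4 d3 d2 d1 d0.
    exact: is_derive_eq.
  - move=> s st; have := dG _ st => d.
    by apply: is_derive_eq; rewrite /GRing.scale/= /g; ring.
  - move=> s st; rewrite /dPhi /g /Phi.
    have B0 : 0 <= 1700 * t^-1 by lra.
    exact: (growth_sum (E_ge0 _ _) (E_ge0 _ _) (E_ge0 _ _) (E_ge0 _ _)
      (E_ge0 _ _) B0 (dE_le 0%N s st isT) (dE_le 1%N s st isT)
      (dE_le 2%N s st isT) (dE_le 3%N s st isT) (dE_le 4%N s st isT)).
  - exact: (cvgD (cvgD (cvgD (cvgD (Ecvg 0%N) (Ecvg 1%N)) (Ecvg 2%N))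
      (Ecvg 3%N)) (Ecvg 4%N)).
  - apply: cvgD; first by apply: cvgN; apply: cvgM => //; exact: cvg_cst.
    apply: cvgM; first exact: cvg_cst.
    by apply: cvg_at_right_filter; exact: cvg_id.
have HE : H t - H 0 = growth_const - (G t - G 0) / 4.
  by rewrite /H /growth_const; field; rewrite gt_eqF.
have m0 : 0 <= m by apply: le_trans (am 0%N _); rewrite ?sqr_ge0.
have le10 : Phi t <= 10 * expR growth_const * m * expR (- ((G t - G 0) / 4)).
  apply: le_trans main _; rewrite HE expRD.
  have -> : 10 * expR growth_const * m * expR (- ((G t - G 0) / 4)) =
     10 * m * (expR growth_const * expR (- ((G t - G 0) / 4))) by ring.
  rewrite ler_wpM2r ?mulr_ge0 ?expR_ge0//.
  have := em 0%N isT; have := em 1%N isT; have := em 2%N isT.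
  have := em 3%N isT; have := em 4%N isT; lra.
move=> n n04; apply: le_trans le10; rewrite -/(E n t) /Phi.
have := E_ge0 0%N t; have := E_ge0 1%N t; have := E_ge0 2%N t.
have := E_ge0 3%N t; have := E_ge0 4%N t.
by case: n04 => ->; move: (E _ _) (E _ _) (E _ _) (E _ _) (E _ _) => *; lra.
Qed.

End difference_decay.

(** * Domination and differentiation under the integral sign *)

Section integral_helpers.
Context d (T : measurableType d) {R : realType} (mu : {measure set T -> \bar R}).

Lemma integrable_dom (f g : T -> R) : measurable_fun setT f ->
  (forall x, `|f x| <= g x) -> mu.-integrable setT (EFin \o g) ->
  mu.-integrable setT (EFin \o f).
Proof.
move=> mf fg ig; apply: le_integrable ig => //; first exact/measurable_EFinP.
by move=> x _ /=; rewrite lee_fin (le_trans (fg x))// ler_norm.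
Qed.

Lemma integrable_scale (f : T -> R) (c : R) : mu.-integrable setT (EFin \o f) ->
  mu.-integrable setT (EFin \o (fun x => c * f x)).
Proof.
by move=> fi; have := integrableZl measurableT c fi; apply: eq_integrable => // x _.
Qed.

Lemma integrable_bounded (f g : T -> R) (M : R) : measurable_fun setT g ->
  (forall x, `|g x| <= M) -> mu.-integrable setT (EFin \o f) ->
  mu.-integrable setT (EFin \o (fun x => g x * f x)).
Proof.
move=> mg gM fi.
have mf : measurable_fun setT f by apply/measurable_EFinP; exact: measurable_int fi.
apply: (@integrable_dom _ (fun x => M * `|f x|)).
- exact: measurable_funM.
- by move=> x; rewrite normrM ler_wpM2r.
- apply: integrable_scale; move/integrable_abse : fi; exact: eq_integrable.
Qed.

Lemma integrable_add (f g : T -> R) : mu.-integrable setT (EFin \o f) ->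
  mu.-integrable setT (EFin \o g) ->
  mu.-integrable setT (EFin \o (fun x => f x + g x)).
Proof.
move=> fi gi; have := integrableD measurableT fi gi.
by apply: eq_integrable => // x _.
Qed.

Lemma le_norm_Rintegral (f g : T -> R) : mu.-integrable setT (EFin \o f) ->
  mu.-integrable setT (EFin \o g) -> (forall x, `|f x| <= g x) ->
  `|\int[mu]_x f x| <= \int[mu]_x g x.
Proof.
move=> fi gi fg; apply: le_trans (le_normr_Rintegral _ fi) _ => //.
apply: le_Rintegral => //; move/integrable_abse : fi; exact: eq_integrable.
Qed.

Lemma is_derive_under_integral (f df : R -> T -> R) (G : T -> R) (a : R) :
  (forall x y, is_derive x (1 : R) (f ^~ y) (df x y)) ->
  (forall x, mu.-integrable setT (EFin \o f x)) ->
  mu.-integrable setT (EFin \o G) ->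
  (forall x y, `|x - a| < 1 -> `|df x y| <= G y) ->
  is_derive a (1 : R) (fun x => \int[mu]_y f x y) (\int[mu]_y df a y).
Proof.
move=> fdf fi Gi dfG.
have aI : `](a - 1), (a + 1)[%classic a.
  by rewrite /= in_itv/=; apply/andP; split; lra.
have I x : `](a - 1), (a + 1)[%classic x -> `|x - a| < 1.
  by rewrite /= in_itv/= => /andP[h1 h2]; rewrite ltr_norml; apply/andP; split; lra.
have dE x y : partial1of2 f x y = df x y.
  by rewrite partial1of2E; have [_ ->] := fdf x y.
have G0 y : 0 <= G y by apply: le_trans (dfG a y _); rewrite ?subrr ?normr0.
have D1 x y : `](a - 1), (a + 1)[%classic x -> [set: T] y -> derivable (f^~ y) x 1.
  by move=> _ _; have [] := fdf x y.
have D2 x y : `](a - 1), (a + 1)[%classic x -> [set: T] y -> `|partial1of2 f x y| <= G y.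
  by move=> /I xa _; rewrite dE; exact: dfG.
apply: DeriveDef.
  exact: (@derivable_under_integral _ _ _ _ _ _ measurableT _ _ _ aI (fun x _ => fi x) D1 _ G0 Gi D2).
rewrite -derive1E.
rewrite (@differentiation_under_integral _ _ _ _ _ _ measurableT _ _ _ aI (fun x _ => fi x) D1 _ G0 Gi D2).
by apply: eq_Rintegral => y _; rewrite dE.
Qed.

End integral_helpers.

(** * Gaussians and Fourier inversion *)

Section gauss.
Context {R : realType}.
Notation TR := (measurableTypeR R).
Notation mu := (@lebesgue_measure R).

Lemma measurable_cos : measurable_fun setT (@cos R : TR -> TR).
Proof. exact: (continuous_measurable_fun (@continuous_cos R)). Qed.
Lemma measurable_sin : measurable_fun setT (@sin R : TR -> TR).
Proof. exact: (continuous_measurable_fun (@continuous_sin R)). Qed.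

Lemma integral_gauss_scaled (s c : R) : 0 < s ->
  (\int[mu]_x (gauss_fun (((x : R) - c) / s))%:E = (s * Num.sqrt pi)%:E)%E.
Proof.
move=> s0; rewrite ge0_integral_affine//; last exact: gauss_fun_ge0.
  by rewrite integralT_gauss.
exact: continuous_gauss_fun.
Qed.

Lemma measurable_gauss_scaled (s c : R) :
  measurable_fun setT (fun x : TR => gauss_fun ((x - c) / s) : TR).
Proof.
apply: measurableT_comp; first exact: measurable_gauss_fun.
by apply: measurable_funM => //; apply: measurable_funB.
Qed.

Lemma integrable_gauss_scaled (s c : R) : 0 < s ->
  mu.-integrable setT (EFin \o (fun x : TR => gauss_fun ((x - c) / s))).
Proof.
move=> s0; apply/integrableP; split.
  by apply/measurable_EFinP; exact: measurable_gauss_scaled.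
under eq_integral do rewrite /= ger0_norm ?gauss_fun_ge0//.
by rewrite integral_gauss_scaled// ltry.
Qed.

Lemma integrable_gauss (s : R) : 0 < s ->
  mu.-integrable setT (EFin \o (fun x : TR => gauss_fun (x / s))).
Proof.
move=> s0; apply: eq_integrable (integrable_gauss_scaled 0 s0) => // x _ /=.
by rewrite subr0.
Qed.

Lemma integral_gauss (s : R) : 0 < s ->
  (\int[mu]_x (gauss_fun ((x : R) / s)) = s * Num.sqrt pi)%R.
Proof.
move=> s0; rewrite /Rintegral -[RHS]/(fine (s * Num.sqrt pi)%:E).
rewrite -(integral_gauss_scaled 0 s0); congr fine.
by apply: eq_integral => x _; rewrite subr0.
Qed.

(** Follows from |x| <= 1 + 3 x^2 / 4 <= exp (3 x^2 / 4). *)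
Lemma mul_gauss_le (x : R) : `|x| * gauss_fun x <= gauss_fun (x / 2).
Proof.
rewrite /gauss_fun.
have -> : - (x / 2) ^+ 2 = 3 / 4 * x ^+ 2 + - x ^+ 2 :> R by field.
rewrite expRD ler_pM2r ?expR_gt0//.
apply: le_trans (expR_ge1Dx _).
rewrite -(@real_normK _ x) ?num_real//; move: `|x| => y.
have -> : 1 + 3 / 4 * y ^+ 2 = y + (3 / 4 * (y - 2 / 3) ^+ 2 + 2 / 3) by field.
by rewrite lerDl addr_ge0// mulr_ge0 ?sqr_ge0.
Qed.

Lemma mul_gauss_scaled_le (x s : R) : 0 < s ->
  `|x| * gauss_fun (x / s) <= s * gauss_fun (x / (s * 2)).
Proof.
move=> s0; have sn0 : s != 0 by rewrite gt_eqF.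
have := mul_gauss_le (x / s); rewrite normrM normfV (gtr0_norm s0) => h.
have -> : x / (s * 2) = x / s / 2 by field.
rewrite -ler_pdivrMl//; apply: le_trans h.
by rewrite le_eqVlt; apply/orP; left; apply/eqP; ring.
Qed.

Lemma gauss_le_scaled (x k : R) : 1 <= k -> gauss_fun x <= gauss_fun (x / k).
Proof.
move=> k1; rewrite /gauss_fun ler_expR lerN2 expr_div_n ler_pdivrMr ?exprn_gt0//; last lra.
by rewrite ler_peMr ?sqr_ge0// exprn_ege1.
Qed.

Lemma is_derive_gauss (x : R) :
  is_derive x (1 : R) (@gauss_fun R) (- 2 * x * gauss_fun x).
Proof.
rewrite /gauss_fun.
have h : is_derive x (1 : R) (fun x : R => - x ^+ 2) (- 2 * x).
  by apply: is_derive_eq; rewrite /GRing.scale/=; ring.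
have h2 := is_derive1_comp (is_derive_expR _) h; rewrite /comp in h2.
by apply: is_derive_eq; ring.
Qed.

(** Integration by parts on the line, obtained from translation invariance: the integral of [f h], a
    translate of [f 0], does not depend on [h], so its derivative at 0 vanishes. *)
Let gauss_by_parts (s a b : R) : 0 < s ->
  \int[mu]_x ((a * cos (a * (x : R) + b) - 2 * (x / s) / s * sin (a * x + b)) * gauss_fun (x / s)) = 0.
Proof.
move=> s0; have sn0 : s != 0 by rewrite gt_eqF.
pose f (h x : R) := sin (a * (x + h) + b) * gauss_fun ((x + h) / s).
pose df (h x : R) := (a * cos (a * (x + h) + b) - 2 * ((x + h) / s) / s * sin (a * (x + h) + b))
  * gauss_fun ((x + h) / s).
have fdf h x : is_derive h (1 : R) (f ^~ x) (df h x).
  have h1 : is_derive h (1 : R) (fun h => a * (x + h) + b) a.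
    by apply: is_derive_eq; rewrite /GRing.scale/=; ring.
  have h2 : is_derive h (1 : R) (fun h => (x + h) / s) s^-1.
    by apply: is_derive_eq; rewrite /GRing.scale/=; ring.
  have h3 := is_derive1_comp (is_derive_sin _) h1.
  have h4 := is_derive1_comp (is_derive_gauss _) h2.
  rewrite /comp in h3 h4.
  by apply: is_derive_eq; rewrite /df /GRing.scale/=; ring.
have mf h : measurable_fun setT (f h : TR -> TR).
  apply: measurable_funM.
    apply: measurableT_comp; first exact: measurable_sin.
    by apply: measurable_funD => //; apply: measurable_funM => //; apply: measurable_funD.
  apply: measurableT_comp; first exact: measurable_gauss_fun.
  by apply: measurable_funM => //; apply: measurable_funD.
have fi h : mu.-integrable setT (EFin \o (f h : TR -> TR)).
  apply: (@integrable_dom _ _ _ _ _ (fun x : TR => gauss_fun ((x - (- h)) / s))).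
    exact: mf.
    move=> x; rewrite /f normrM opprK (ger0_norm (gauss_fun_ge0 _)) ler_piMl//.
      exact: gauss_fun_ge0.
    by rewrite ler_norml sin_geN1 sin_le1.
  exact: integrable_gauss_scaled.
pose k : R := `|a| + 2 / s.
have Gi : mu.-integrable setT (EFin \o (fun x : TR => k * (expR (s^-1 ^+ 2) * gauss_fun (x / (2 * s * 2))))).
  by do 2 apply: integrable_scale; apply: integrable_gauss; rewrite !mulr_gt0.
have D := @is_derive_under_integral _ _ _ mu f df _ 0 fdf fi Gi.
have [_ ] : is_derive (0 : R) (1 : R) (fun h => \int[mu]_x f h x) (\int[mu]_x df 0 x).
  apply: D => h x; rewrite subr0 => h1.
  rewrite /df normrM (ger0_norm (gauss_fun_ge0 _)).
  (* Since (x + h)^2 >= x^2 / 2 - h^2, all translates with |h| < 1 lie below one wider Gaussian. *)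
  have gg : gauss_fun ((x + h) / s / 2) <= expR (s^-1 ^+ 2) * gauss_fun (x / (2 * s * 2)).
    rewrite /gauss_fun -expRD ler_expR.
    have -> : - ((x + h) / s / 2) ^+ 2 = - ((x + 2 * h) ^+ 2 / 2 + x ^+ 2 / 2 - h ^+ 2) * (s^-1 ^+ 2) / 4.
      by field.
    have -> : s^-1 ^+ 2 - (x / (2 * s * 2)) ^+ 2 = (4 - x ^+ 2 / 4) * (s^-1 ^+ 2) / 4 by field.
    rewrite ler_pM2r ?invr_gt0// ler_pM2r ?exprn_gt0 ?invr_gt0//.
    have := sqr_ge0 (x + 2 * h); have := sqr_ge0 x.
    have : h ^+ 2 <= 1 by move: h1; rewrite ltr_norml expr2 => /andP[]; nra.
    lra.
  have g0 := @gauss_fun_ge0 R ((x + h) / s).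
  have gl := @gauss_le_scaled ((x + h) / s) 2 (ler1n _ 2).
  have gm := mul_gauss_le ((x + h) / s).
  apply: (@le_trans _ _ (k * gauss_fun ((x + h) / s / 2))); last first.
    by rewrite ler_wpM2l// addr_ge0// divr_ge0// ltW.
  rewrite /k [leRHS]mulrDl.
  apply: (@le_trans _ _ ((`|a| + 2 / s * `|(x + h) / s|) * gauss_fun ((x + h) / s))).
    rewrite ler_wpM2r//; apply: le_trans (ler_normB _ _) _; apply: lerD.
      rewrite normrM ler_piMr// ler_norml; by rewrite cos_geN1 cos_le1.
    rewrite normrM -[leRHS]mulr1; apply: ler_pM => //.
      have -> : 2 * ((x + h) / s) / s = (2 / s) * ((x + h) / s) by ring.
      by rewrite normrM (ger0_norm (_ : 0 <= 2 / s))// divr_ge0// ltW.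
    by rewrite ler_norml sin_geN1 sin_le1.
  rewrite [leLHS]mulrDl; apply: lerD; first by rewrite ler_wpM2l.
  by rewrite -[leLHS]mulrA ler_wpM2l// divr_ge0// ltW.
have -> : (fun h => \int[mu]_x f h x) = cst (\int[mu]_x f 0 x).
  apply/funext => h; rewrite /=.
  have mf0 : measurable_fun setT (fun z : TR => (f 0 z)%:E).
    by apply/measurable_EFinP; exact: mf.
  rewrite /Rintegral; congr fine; rewrite [LHS]integralE [RHS]integralE; congr (_ - _)%E.
    rewrite -[RHS](@ge0_integral_shift R _ h)//; last exact: measurable_funepos.
    by apply: eq_integral => x _; rewrite unlock /= /f addr0.
  rewrite -[RHS](@ge0_integral_shift R _ h)//; last exact: measurable_funeneg.
  by apply: eq_integral => x _; rewrite unlock /= /f addr0.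
rewrite derive_cst => E; rewrite [RHS]E.
by apply: eq_Rintegral => x _; rewrite /df addr0.
Qed.

(** By [gauss_by_parts] the integral I satisfies I'(a) = - (a s^2 / 2) I(a), so I times exp ((a s /
    2)^2) is constant in [a]. *)
Lemma fourier_gauss (s a b : R) : 0 < s ->
  \int[mu]_x (cos (a * (x : R) + b) * gauss_fun (x / s)) =
  s * Num.sqrt pi * expR (- (a * s / 2) ^+ 2) * cos b.
Proof.
move=> s0; have sn0 : s != 0 by rewrite gt_eqF.
pose f (a x : R) := cos (a * x + b) * gauss_fun (x / s).
pose df (a x : R) := - x * sin (a * x + b) * gauss_fun (x / s).
have fdf h x : is_derive h (1 : R) (f ^~ x) (df h x).
  have h1 : is_derive h (1 : R) (fun h => h * x + b) x.
    by apply: is_derive_eq; rewrite /GRing.scale/=; ring.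
  have h3 := is_derive1_comp (is_derive_cos _) h1; rewrite /comp in h3.
  by apply: is_derive_eq; rewrite /df /GRing.scale/=; ring.
have mc a' : measurable_fun setT (fun x : TR => cos (a' * x + b) : TR).
  apply: measurableT_comp; first exact: measurable_cos.
  by apply: measurable_funD => //; apply: measurable_funM.
have ms a' : measurable_fun setT (fun x : TR => sin (a' * x + b) : TR).
  apply: measurableT_comp; first exact: measurable_sin.
  by apply: measurable_funD => //; apply: measurable_funM.
have fi a' : mu.-integrable setT (EFin \o (f a' : TR -> TR)).
  apply: (@integrable_bounded _ _ _ _ _ _ 1); [exact: mc| |exact: integrable_gauss].
  by move=> x; rewrite ler_norml cos_geN1 cos_le1.
have Gi : mu.-integrable setT (EFin \o (fun x : TR => s * gauss_fun (x / (s * 2)))).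
  by apply: integrable_scale; apply: integrable_gauss; rewrite mulr_gt0.
have D a' : is_derive a' (1 : R) (fun a => \int[mu]_x f a x) (\int[mu]_x df a' x).
  apply: (@is_derive_under_integral _ _ _ mu f df _ a' fdf fi Gi) => a'' x _.
  rewrite /df mulrAC normrM -[leRHS]mulr1; apply: ler_pM => //.
    by rewrite normrM normrN (ger0_norm (gauss_fun_ge0 _)) mul_gauss_scaled_le.
  by rewrite ler_norml sin_geN1 sin_le1.
have dE a' : \int[mu]_x df a' x = - (a' * s ^+ 2 / 2) * \int[mu]_x f a' x.
  have := @gauss_by_parts s a' b s0.
  have -> : \int[mu]_x ((a' * cos (a' * (x : R) + b) - 2 * (x / s) / s * sin (a' * x + b)) * gauss_fun (x / s))
     = \int[mu]_x (a' * f a' x + 2 / s ^+ 2 * df a' x).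
    by apply: eq_Rintegral => x _; rewrite /f /df; field.
  have dfi : mu.-integrable setT (EFin \o (df a' : TR -> TR)).
    apply: integrable_dom Gi.
      apply: measurable_funM; last first.
        apply: measurableT_comp; first exact: measurable_gauss_fun.
        exact: measurable_funM.
      apply: measurable_funM; last exact: ms.
      by apply: oppr_measurable.
    move=> x; rewrite /df mulrAC normrM -[leRHS]mulr1; apply: ler_pM => //.
      by rewrite normrM normrN (ger0_norm (gauss_fun_ge0 _)) mul_gauss_scaled_le.
    by rewrite ler_norml sin_geN1 sin_le1.
  rewrite RintegralD//; [|exact: integrable_scale..].
  rewrite !RintegralZl// => /eqP; rewrite addr_eq0 => /eqP h.
  have -> : \int[mu]_x df a' x = s ^+ 2 / 2 * (2 / s ^+ 2 * \int[mu]_x df a' x) by field.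
  by rewrite -[2 / _ * _]opprK -h; field.
pose J a := (\int[mu]_x f a x) * expR ((a * s / 2) ^+ 2).
have dJ a' : is_derive a' (1 : R) J 0.
  have h1 : is_derive a' (1 : R) (fun a => (a * s / 2) ^+ 2) (a' * s ^+ 2 / 2).
    by apply: is_derive_eq; rewrite /GRing.scale/=; field.
  have h2 := is_derive1_comp (is_derive_expR _) h1; rewrite /comp in h2.
  have h3 := D a'; rewrite dE in h3.
  by apply: is_derive_eq; rewrite /GRing.scale/=; ring.
have := is_derive_0_is_cst a 0 dJ; rewrite /J !mul0r expr0n expR0 mulr1 => h.
have {h} : \int[mu]_x f a x = \int[mu]_x f 0 x * expR (- (a * s / 2) ^+ 2).
  by rewrite -h -mulrA -expRD subrr expR0 mulr1.
rewrite -/(f a) => ->.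
have -> : \int[mu]_x f 0 x = \int[mu]_x (gauss_fun (x / s) * cos b).
  by apply: eq_Rintegral => x _; rewrite /f mul0r add0r mulrC.
rewrite RintegralZr//; last exact: integrable_gauss.
by rewrite integral_gauss//; ring.
Qed.

End gauss.

Section product_integrals.
Context d1 d2 (T1 : measurableType d1) (T2 : measurableType d2) {R : realType}.
Variables (m1 : {sigma_finite_measure set T1 -> \bar R})
          (m2 : {sigma_finite_measure set T2 -> \bar R}).

Lemma Rintegral_prod1 (f : T1 * T2 -> R) :
  (m1 \x m2)%E.-integrable setT (EFin \o f) ->
  (forall x, m2.-integrable setT (EFin \o (fun y => f (x, y)))) ->
  \int[m1]_x (\int[m2]_y f (x, y)) = \int[(m1 \x m2)%E]_z f z.
Proof.
move=> fi fxi; rewrite /Rintegral; congr fine.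
rewrite -(integral12_prod_meas1 fi); apply: eq_integral => x _.
by rewrite fineK//; exact: (integrable_fin_num _ (fxi x)).
Qed.

Lemma Rintegral_prod2 (f : T1 * T2 -> R) :
  (m1 \x m2)%E.-integrable setT (EFin \o f) ->
  (forall y, m1.-integrable setT (EFin \o (fun x => f (x, y)))) ->
  \int[m2]_y (\int[m1]_x f (x, y)) = \int[(m1 \x m2)%E]_z f z.
Proof.
move=> fi fyi; rewrite /Rintegral; congr fine.
rewrite -(integral21_prod_meas1 fi); apply: eq_integral => y _.
by rewrite fineK//; exact: (integrable_fin_num _ (fyi y)).
Qed.

Lemma integrable_prod (f : T1 -> R) (g : T2 -> R) :
  m1.-integrable setT (EFin \o f) -> m2.-integrable setT (EFin \o g) ->
  (m1 \x m2)%E.-integrable setT (EFin \o (fun z => f z.1 * g z.2)).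
Proof.
move=> fi gi.
have mf : measurable_fun setT f by apply/measurable_EFinP; exact: measurable_int fi.
have mg : measurable_fun setT g by apply/measurable_EFinP; exact: measurable_int gi.
apply/integrable12ltyP.
  apply/measurable_EFinP; apply: measurable_funM.
    exact: (measurableT_comp mf measurable_fst).
  exact: (measurableT_comp mg measurable_snd).
have [_ fl] := integrableP _ _ _ fi; have [_ gl] := integrableP _ _ _ gi.
have E : (\int[m2]_y `|(g y)%:E| = (\int[m2]_y `|g y|)%:E)%E.
  rewrite /Rintegral fineK// ge0_fin_numE ?integral_ge0//.
under eq_integral => x _.
  have -> : (\int[m2]_y `|(EFin \o (fun z => f z.1 * g z.2)%R) (x, y)| =
     `|(f x)%:E| * \int[m2]_y `|(g y)%:E|)%E.
    rewrite -ge0_integralZl//; last by apply/measurableT_comp => //; exact/measurable_EFinP.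
    by apply: eq_integral => y _ /=; rewrite normrM EFinM.
  rewrite E; over.
rewrite /= ge0_integralZr//.
- have fF : (\int[m1]_x `|f x|%:E)%E \is a fin_num by rewrite ge0_fin_numE ?integral_ge0.
  by rewrite lte_mul_pinfty ?integral_ge0 ?ltry.
- by apply/measurable_EFinP; exact: measurableT_comp.
- by rewrite lee_fin Rintegral_ge0.
Qed.

End product_integrals.

Section inversion.
Context {R : realType}.
Notation TR := (measurableTypeR R).
Notation mu := (@lebesgue_measure R).

(* leb2 under a name of its own, to carry the sigma-finite structure, which is
   not inferred through the product. *)
Definition lebm : set (TR * TR)%type -> \bar R := (mu \x mu)%E.
HB.instance Definition _ := Measure.on lebm.

Let lebm_sigma_finite : sigma_finite setT lebm.
Proof.
have /sigma_finiteP[F [TF ndF Foo]] := sigma_finiteT mu.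
exists (fun n => F n `*` F n).
  rewrite -setXTT TF predeqE => -[x y]; split.
    move=> [/= [n _ Fnx] [k _ Fky]]; exists (maxn n k) => //; split.
    - by move: x Fnx; exact/subsetPset/ndF/leq_maxl.
    - by move: y Fky; exact/subsetPset/ndF/leq_maxr.
  by move=> [n _ []/= ? ?]; split; exists n.
move=> k; have [mF Fk] := Foo k.
split; first exact: measurableX.
by rewrite /lebm product_measure1E// lte_mul_pinfty// ge0_fin_numE.
Qed.

HB.instance Definition _ := Measure_isSigmaFinite.Build _ _ _ lebm
  lebm_sigma_finite.

Definition gauss2 (s : R) (z : TR * TR) : R :=
  gauss_fun (z.1 / s) * gauss_fun (z.2 / s).

Lemma gauss2_ge0 s z : 0 <= gauss2 s z.
Proof. by rewrite mulr_ge0 ?gauss_fun_ge0. Qed.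

Lemma gauss2_le1 s z : gauss2 s z <= 1.
Proof. by rewrite mulr_ile1 ?gauss_fun_ge0 ?gauss_fun_le1. Qed.

Lemma integrable_gauss2 (s : R) : 0 < s ->
  leb2.-integrable setT (EFin \o gauss2 s).
Proof. by move=> s0; exact: (integrable_prod (integrable_gauss s0) (integrable_gauss s0)). Qed.

Lemma measurable_gauss2 (s : R) : measurable_fun setT (gauss2 s).
Proof.
have mg : measurable_fun setT (fun x : TR => gauss_fun (x / s) : TR).
  by apply: measurableT_comp; [exact: measurable_gauss_fun|exact: measurable_funM].
apply: measurable_funM; first exact: (measurableT_comp mg measurable_fst).
exact: (measurableT_comp mg measurable_snd).
Qed.

Lemma measurable_cos2 (a b c : R) :
  measurable_fun setT (fun z : TR * TR => cos (a * z.1 + b * z.2 + c) : TR).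
Proof.
apply: measurableT_comp; first exact: measurable_cos.
by repeat apply: measurable_funD => //; apply: measurable_funM.
Qed.

Lemma normr_cos_le1 (x : R) : `|cos x| <= 1.
Proof. by rewrite ler_norml cos_geN1 cos_le1. Qed.

Lemma fourier_gauss2 (s X Y c : R) : 0 < s ->
  (\int[leb2]_z (cos (X * z.1 + Y * z.2 + c) * gauss2 s z) =
   (s ^+ 2 * pi) * (gauss_fun (X * s / 2) * gauss_fun (Y * s / 2)) * cos c)%R.
Proof.
move=> s0.
have i2 : leb2.-integrable setT (EFin \o (fun z : TR * TR => cos (X * z.1 + Y * z.2 + c) * gauss2 s z)).
  apply: (@integrable_bounded _ _ _ _ _ _ 1) (integrable_gauss2 s0).
    exact: measurable_cos2.
  by move=> x; exact: normr_cos_le1.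
rewrite -[LHS](@Rintegral_prod1 _ _ _ _ _ mu mu _ i2); last first.
  move=> x.
  apply: (@eq_integrable _ _ _ mu setT measurableT (EFin \o (fun y : TR => (gauss_fun (x / s) * cos (X * x + Y * y + c)) * gauss_fun (y / s)))).
    by move=> y _ /=; rewrite /gauss2/=; congr (_%:E); ring.
  apply: (@integrable_bounded _ _ _ _ _ _ 1) (integrable_gauss s0).
    apply: measurable_funM => //; apply: measurableT_comp; first exact: measurable_cos.
    by repeat apply: measurable_funD => //; apply: measurable_funM.
  move=> y; rewrite normrM mulr_ile1// ?normr_cos_le1//.
  by rewrite ger0_norm ?gauss_fun_ge0 ?gauss_fun_le1.
have inner (x : TR) : \int[mu]_y (cos (X * x + Y * (y : TR) + c) * gauss2 s (x, y)) =
   (s * Num.sqrt pi * gauss_fun (Y * s / 2)) * (cos (X * x + c) * gauss_fun (x / s)).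
  have := @fourier_gauss R s Y (X * x + c) s0 => h.
  transitivity (\int[mu]_y ((cos (Y * y + (X * x + c)) * gauss_fun (y / s)) * gauss_fun (x / s))).
    apply: eq_Rintegral => y _; rewrite /gauss2/=.
    have -> : X * x + Y * y + c = Y * y + (X * x + c) by ring.
    ring.
  rewrite RintegralZr// ?h; first by rewrite /gauss_fun; ring.
  apply: (@integrable_bounded _ _ _ _ _ _ 1) (integrable_gauss s0).
    apply: measurableT_comp; first exact: measurable_cos.
    by apply: measurable_funD => //; apply: measurable_funM.
  by move=> y; exact: normr_cos_le1.
under eq_Rintegral do rewrite inner.
rewrite RintegralZl//.
  rewrite fourier_gauss//.
  have -> : gauss_fun (X * s / 2) = expR (- (X * s / 2) ^+ 2) by [].
  have : Num.sqrt (pi : R) ^+ 2 = pi by rewrite sqr_sqrtr// pi_ge0.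
  by rewrite expr2 => {3}<-; ring.
apply: (@integrable_bounded _ _ _ _ _ _ 1) (integrable_gauss s0).
  apply: measurableT_comp; first exact: measurable_cos.
  by apply: measurable_funD => //; apply: measurable_funM.
by move=> y; exact: normr_cos_le1.
Qed.

Let exponent_split (a b : R) : b <= a -> - (a / 4) <= - (b / 8) - b / 8.
Proof. lra. Qed.

Let exponent_le (a b : R) : 0 < b -> b <= a -> - (3 * a / 16) <= - (b / 8).
Proof. lra. Qed.

Variables (f : TR * TR -> R) (x0 y0 : R).
Hypothesis fi : leb2.-integrable setT (EFin \o f).
Hypothesis fc : forall e : R, 0 < e -> exists2 d : R, 0 < d &
  forall x y : R, `|x - x0| < d -> `|y - y0| < d -> `|f (x, y) - f (x0, y0)| <= e.

(** The real part of the transform of [f] times the phase that recentres it at [(x0, y0)]; for a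
    real [f] the imaginary part is odd and does not contribute to the inversion integral. *)
Let g (z : TR * TR) : R :=
  (\int[leb2]_w (f w * cos ((w.1 - x0) * z.1 + (w.2 - y0) * z.2)))%R.
Hypothesis gi : leb2.-integrable setT (EFin \o g).

(** The transform of the cutoff [gauss2 s], recentred at [(x0, y0)]: an approximate identity of mass
    4 pi^2 as [s] grows. *)
Let K (s : R) (w : TR * TR) : R :=
  s ^+ 2 * pi * (gauss_fun ((w.1 - x0) * s / 2) * gauss_fun ((w.2 - y0) * s / 2)).

Let mf : measurable_fun setT f.
Proof. by apply/measurable_EFinP; exact: measurable_int fi. Qed.

Let swap_gauss (s : R) : 0 < s ->
  (\int[leb2]_z (g z * gauss2 s z) = \int[leb2]_w (f w * K s w))%R.
Proof.
move=> s0.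
pose F (v : (TR * TR) * (TR * TR)) : R :=
  cos ((v.2.1 - x0) * v.1.1 + (v.2.2 - y0) * v.1.2) * (gauss2 s v.1 * f v.2).
have mc : measurable_fun setT (fun v : (TR * TR) * (TR * TR) =>
    cos ((v.2.1 - x0) * v.1.1 + (v.2.2 - y0) * v.1.2) : TR).
  apply: measurableT_comp; first exact: measurable_cos.
  have m21 : measurable_fun setT (fun v : (TR * TR) * (TR * TR) => v.2.1 : TR).
    exact: (measurableT_comp measurable_fst measurable_snd).
  have m22 : measurable_fun setT (fun v : (TR * TR) * (TR * TR) => v.2.2 : TR).
    exact: (measurableT_comp measurable_snd measurable_snd).
  have m11 : measurable_fun setT (fun v : (TR * TR) * (TR * TR) => v.1.1 : TR).
    exact: (measurableT_comp measurable_fst measurable_fst).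
  have m12 : measurable_fun setT (fun v : (TR * TR) * (TR * TR) => v.1.2 : TR).
    exact: (measurableT_comp measurable_snd measurable_fst).
  by apply: measurable_funD; apply: measurable_funM => //; apply: measurable_funB.
have Fi : (lebm \x lebm)%E.-integrable setT (EFin \o F).
  apply: (@integrable_bounded _ _ _ _ _ _ 1) => //.
    by move=> v; exact: normr_cos_le1.
  exact: (@integrable_prod _ _ _ _ _ lebm lebm _ _ (integrable_gauss2 s0) fi).
have c1 (z : TR * TR) : measurable_fun setT (fun w : TR * TR => cos ((w.1 - x0) * z.1 + (w.2 - y0) * z.2) : TR).
  exact: (measurableT_comp mc (@pair1_measurable _ _ (TR * TR)%type (TR * TR)%type z)).
have E w z : cos ((w.1 - x0) * z.1 + (w.2 - y0) * z.2 + 0) = cos ((w.1 - x0) * z.1 + (w.2 - y0) * z.2) :> R.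
  by rewrite addr0.
transitivity (\int[lebm]_z (\int[lebm]_w F (z, w))).
  apply: eq_Rintegral => z _; rewrite /g -RintegralZr//.
    by apply: eq_Rintegral => w _; rewrite /F/=; ring.
  apply: (@eq_integrable _ _ _ leb2 setT measurableT (EFin \o (fun w : TR * TR => cos ((w.1 - x0) * z.1 + (w.2 - y0) * z.2) * f w))).
    by move=> y _ /=; rewrite mulrC.
  apply: (@integrable_bounded _ _ _ _ _ _ 1); [exact: c1| |exact: fi].
  by move=> y; exact: normr_cos_le1.
rewrite Rintegral_prod1//; last first.
  move=> z; rewrite /F/=.
  apply: (@integrable_bounded _ _ _ _ _ _ 1); [exact: c1| |exact: integrable_scale].
  by move=> y; exact: normr_cos_le1.
rewrite -Rintegral_prod2//; last first.
  move=> w; rewrite /F/=.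
  apply: (@eq_integrable _ _ _ leb2 setT measurableT (EFin \o (fun z : TR * TR => f w * (cos ((w.1 - x0) * z.1 + (w.2 - y0) * z.2 + 0) * gauss2 s z)))).
    by move=> z _ /=; rewrite addr0; congr (_%:E); ring.
  apply: integrable_scale.
  apply: (@integrable_bounded _ _ _ _ _ _ 1) (integrable_gauss2 s0).
    exact: measurable_cos2.
  by move=> y; exact: normr_cos_le1.
apply: eq_Rintegral => w _.
have := fourier_gauss2 (w.1 - x0) (w.2 - y0) 0 s0; rewrite cos0 mulr1 -/(K s w) => <-.
rewrite -RintegralZl//.
  by apply: eq_Rintegral => z _; rewrite /F/= addr0; ring.
apply: (@integrable_bounded _ _ _ _ _ _ 1) (integrable_gauss2 s0).
  exact: measurable_cos2.
by move=> y; exact: normr_cos_le1.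
Qed.

Let center_integral (s : R) : 0 < s ->
  leb2.-integrable setT (EFin \o (fun w : TR * TR => gauss_fun ((w.1 - x0) / s) * gauss_fun ((w.2 - y0) / s))) /\
  (\int[leb2]_w (gauss_fun ((w.1 - x0) / s) * gauss_fun ((w.2 - y0) / s)) = s ^+ 2 * pi)%R.
Proof.
move=> s0.
have i2 := integrable_prod (integrable_gauss_scaled x0 s0) (integrable_gauss_scaled y0 s0).
split; first exact: i2.
rewrite -[LHS](@Rintegral_prod1 _ _ _ _ _ mu mu _ i2); last first.
  by move=> x /=; apply: integrable_scale; exact: integrable_gauss_scaled.
have h c : \int[mu]_x gauss_fun (((x : TR) - c) / s) = s * Num.sqrt pi.
  by rewrite /Rintegral integral_gauss_scaled.
under eq_Rintegral => x _ /=.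
  rewrite RintegralZl//; last exact: integrable_gauss_scaled.
  rewrite h; over.
rewrite RintegralZr//; last exact: integrable_gauss_scaled.
rewrite h.
have : Num.sqrt (pi : R) ^+ 2 = pi by rewrite sqr_sqrtr// pi_ge0.
by rewrite expr2 => {3}<-; ring.
Qed.

Let KE s w : 0 < s -> K s w = s ^+ 2 * pi *
  (gauss_fun ((w.1 - x0) / (2 / s)) * gauss_fun ((w.2 - y0) / (2 / s))).
Proof.
move=> s0; rewrite /K; congr (_ * (gauss_fun _ * gauss_fun _)).
  by field; rewrite gt_eqF.
by field; rewrite gt_eqF.
Qed.

(** Near [(x0, y0)] the oscillation of [f] is at most [e] and the kernel has mass 4 pi^2. At
    distance [d] or more, the part with |f| is controlled by the supremum of the kernel there, and
    the part with the constant f(x0, y0) by comparing the kernel with a wider Gaussian; both are O(1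
    / s). *)
Let approx (e d : R) : 0 < e -> 0 < d ->
  (forall x y : R, `|x - x0| < d -> `|y - y0| < d -> `|f (x, y) - f (x0, y0)| <= e) ->
  exists C : R, forall s, 1 <= s ->
   `|\int[leb2]_w (f w * K s w) - 4 * pi ^+ 2 * f (x0, y0)| <= 4 * pi ^+ 2 * e + C / s.
Proof.
move=> e0 d0 fd.
set f0 := f (x0, y0).
exists (64 * pi / d ^+ 4 * \int[leb2]_w `|f w| + `|f0| * (8 / d ^+ 2) * (16 * pi ^+ 2)).
move=> s s1; have s0 : 0 < s by exact: lt_le_trans s1.
have sn0 : s != 0 by rewrite gt_eqF.
have d1 : 0 < 2 / s by rewrite divr_gt0.
have d2 : 0 < 4 / s by rewrite divr_gt0.
have [i1 I1] := center_integral d1; have [i2 I2] := center_integral d2.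
(* The same Gaussian at twice the width: [K s] is [K'] times a factor that is small away from the
   centre, and [K'] still has a finite mass, 16 pi^2. *)
pose K' w := s ^+ 2 * pi * (gauss_fun ((w.1 - x0) / (4 / s)) * gauss_fun ((w.2 - y0) / (4 / s))).
have Ki : leb2.-integrable setT (EFin \o K s).
  have := integrable_scale (s ^+ 2 * pi) i1; apply: eq_integrable => // w _ /=.
  by rewrite KE.
have K'i : leb2.-integrable setT (EFin \o K') by exact: integrable_scale.
have IK : (\int[leb2]_w K s w = 4 * pi ^+ 2)%R.
  under eq_Rintegral do rewrite KE//.
  by rewrite RintegralZl// I1; field.
have IK' : (\int[leb2]_w K' w = 16 * pi ^+ 2)%R.
  by rewrite RintegralZl// I2; field.
have pi0 := pi_gt0 R.
have K0 w : 0 <= K s w.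
  by rewrite /K !mulr_ge0 ?gauss_fun_ge0 ?sqr_ge0// ltW.
have K'0 w : 0 <= K' w.
  by rewrite /K' !mulr_ge0 ?gauss_fun_ge0 ?sqr_ge0// ltW.
have KE2 w : K s w = s ^+ 2 * pi * expR (- (((w.1 - x0) ^+ 2 + (w.2 - y0) ^+ 2) * s ^+ 2 / 4)).
  by rewrite /K /gauss_fun -expRD; congr (_ * expR _); field.
have K'E2 w : K' w = s ^+ 2 * pi * expR (- (((w.1 - x0) ^+ 2 + (w.2 - y0) ^+ 2) * s ^+ 2 / 16)).
  by rewrite /K' /gauss_fun -expRD; congr (_ * expR _); field.
have mK : measurable_fun setT (K s) by apply/measurable_EFinP; exact: measurable_int Ki.
have fKi : leb2.-integrable setT (EFin \o (fun w => f w * K s w)).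
  apply: (@eq_integrable _ _ _ leb2 setT measurableT (EFin \o (fun w => K s w * f w))).
    by move=> y _ /=; rewrite mulrC.
  apply: (@integrable_bounded _ _ _ _ _ _ (s ^+ 2 * pi)) => //.
  move=> w; rewrite ger0_norm// /K ler_piMr ?(mulr_ge0 (sqr_ge0 s) (ltW pi0))//.
  by rewrite mulr_ile1 ?gauss_fun_ge0 ?gauss_fun_le1.
have -> : (\int[leb2]_w (f w * K s w))%R - 4 * pi ^+ 2 * f0 =
    (\int[leb2]_w ((f w - f0) * K s w))%R.
  rewrite -IK -RintegralZr// -RintegralB//; last exact: (integrable_scale f0 Ki) || idtac.
    by apply: eq_Rintegral => w _; rewrite mulrBl [K s w * f0]mulrC.
  by have := integrable_scale f0 Ki; apply: eq_integrable => // w _ /=; rewrite mulrC.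
have afi : leb2.-integrable setT (EFin \o (fun w => `|f w|)).
  by move/integrable_abse : fi; exact: eq_integrable.
apply: (@le_trans _ _ (\int[leb2]_w (e * K s w + ((64 * pi / d ^+ 4 / s) * `|f w| + (`|f0| * (8 / d ^+ 2) / s) * K' w)))%R).
  apply: le_norm_Rintegral.
  - have := integrable_add fKi (integrable_scale (- f0) Ki).
    by apply: eq_integrable => // w _ /=; rewrite mulrBl mulNr.
  - by do 2 (apply: integrable_add; first exact: integrable_scale); exact: integrable_scale.
  - move=> [x y]; rewrite normrM (ger0_norm (K0 _)).
    have t2 : 0 <= 64 * pi / d ^+ 4 / s * `|f (x, y)|.
      by rewrite !mulr_ge0 ?invr_ge0 ?exprn_ge0 ?(ltW s0) ?(ltW d0) ?(ltW pi0).
    have t3 : 0 <= `|f0| * (8 / d ^+ 2) / s * K' (x, y).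
      by rewrite mulr_ge0// mulr_ge0 ?invr_ge0 ?(ltW s0)// mulr_ge0// divr_ge0// exprn_ge0// ltW.
    have [/andP[xd yd]|far] := boolP ((`|x - x0| < d) && (`|y - y0| < d)).
      apply: (@le_trans _ _ (e * K s (x, y))); last by rewrite lerDl addr_ge0.
      by rewrite ler_wpM2r// fd.
    have dd : d ^+ 2 <= (x - x0) ^+ 2 + (y - y0) ^+ 2.
      move: far; rewrite negb_and -!leNgt => /orP[h|h].
        apply: (@le_trans _ _ ((x - x0) ^+ 2)); last by rewrite lerDl sqr_ge0.
        by rewrite -[leRHS]real_normK ?num_real// ler_pXn2r ?nnegrE ?(ltW d0).
      apply: (@le_trans _ _ ((y - y0) ^+ 2)); last by rewrite lerDr sqr_ge0.
      by rewrite -[leRHS]real_normK ?num_real// ler_pXn2r ?nnegrE ?(ltW d0).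
    apply: (@le_trans _ _ (`|f (x, y)| * K s (x, y) + `|f0| * K s (x, y))).
      by rewrite -mulrDl ler_wpM2r// ler_normB.
    apply: (@le_trans _ _ (0 + (64 * pi / d ^+ 4 / s * `|f (x, y)| + `|f0| * (8 / d ^+ 2) / s * K' (x, y)))); last first.
      by rewrite lerD2r mulr_ge0// ltW.
    rewrite add0r.
    have expV (u : R) : 0 < u -> expR (- u) <= u^-1.
      move=> u0; rewrite expRN lef_pV2 ?posrE ?expR_gt0//.
      by apply: le_trans (expR_ge1Dx u); rewrite lerDr.
    have dds := ler_wpM2r (sqr_ge0 s) dd.
    have s2 : s <= s ^+ 2 by rewrite expr2 ler_peMl// ltW.
    have ds0 : 0 < d ^+ 2 * s ^+ 2 by rewrite mulr_gt0 ?exprn_gt0.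
    apply: lerD.
      rewrite [leRHS]mulrC ler_wpM2l//.
      rewrite KE2/=.
      apply: (@le_trans _ _ (s ^+ 2 * pi * (expR (- (d ^+ 2 * s ^+ 2 / 8)) * expR (- (d ^+ 2 * s ^+ 2 / 8))))).
        rewrite ler_wpM2l ?(mulr_ge0 (sqr_ge0 s) (ltW pi0))// -expRD ler_expR.
        exact: exponent_split.
      have h1 : expR (- (d ^+ 2 * s ^+ 2 / 8)) <= 8 / (d ^+ 2 * s ^+ 2).
        by apply: le_trans (expV _ _) _; [rewrite divr_gt0|rewrite invf_div].
      apply: (@le_trans _ _ (s ^+ 2 * pi * (8 / (d ^+ 2 * s ^+ 2) * (8 / (d ^+ 2 * s ^+ 2))))).
        rewrite ler_wpM2l ?(mulr_ge0 (sqr_ge0 s) (ltW pi0))//.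
        by apply: ler_pM; rewrite ?expR_ge0.
      have -> : s ^+ 2 * pi * (8 / (d ^+ 2 * s ^+ 2) * (8 / (d ^+ 2 * s ^+ 2))) =
          64 * pi / d ^+ 4 / s ^+ 2 by field; rewrite sn0 gt_eqF.
      rewrite ler_wpM2l// ?mulr_ge0 ?invr_ge0 ?exprn_ge0 ?(ltW d0) ?(ltW pi0)//.
      by rewrite lef_pV2 ?posrE ?exprn_gt0.
    suff KK : K s (x, y) <= 8 / d ^+ 2 / s * K' (x, y).
      by apply: le_trans (ler_wpM2l (normr_ge0 f0) KK) _; rewrite !mulrA.
    have -> : K s (x, y) = K' (x, y) * expR (- (3 * (((x - x0) ^+ 2 + (y - y0) ^+ 2) * s ^+ 2) / 16)).
      by rewrite KE2 K'E2 -[RHS]mulrA -expRD; congr (_ * expR _); rewrite /=; field.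
    rewrite [leLHS]mulrC; apply: ler_wpM2r => //.
    apply: (@le_trans _ _ (expR (- (d ^+ 2 * s ^+ 2 / 8)))).
      by rewrite ler_expR; exact: exponent_le.
    apply: le_trans (expV _ _) _; first by rewrite divr_gt0.
    rewrite invf_div -mulrA -invfM ler_wpM2l// lef_pV2 ?posrE ?mulr_gt0 ?exprn_gt0//.
    by rewrite ler_wpM2l// exprn_ge0// ltW.
rewrite !RintegralD//; do ?exact: integrable_scale; last first.
  by apply: integrable_add; exact: integrable_scale.
rewrite (RintegralZl e measurableT Ki) (RintegralZl _ measurableT afi).
rewrite (RintegralZl _ measurableT K'i) IK IK'.
by rewrite le_eqVlt; apply/orP; left; apply/eqP; field; rewrite sn0 gt_eqF.
Qed.

(** Insert the cutoff [gauss2 n.+1]: by dominated convergence it disappears from the integral of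
    [g], while [swap_gauss] turns that integral into a mean of [f] which [approx] evaluates. Hence
    only continuity at the single point is asked of [f]. *)
Theorem fourier_inversion : (\int[leb2]_z g z)%R = 4 * pi ^+ 2 * f (x0, y0).
Proof.
pose L n := (\int[leb2]_z (g z * gauss2 n.+1%:R z))%R.
have mg : measurable_fun setT g by apply/measurable_EFinP; exact: measurable_int gi.
have cL : L n @[n --> \oo] --> (\int[leb2]_z g z)%R.
  apply: fine_cvg; rewrite /Rintegral fineK; last exact: (integrable_fin_num _ gi).
  apply: (@dominated_cvg _ _ _ leb2 setT measurableT (fun n z => (g z * gauss2 n.+1%:R z)%:E) _ (fun z => `|g z|%:E)).
  - move=> n; apply/measurable_EFinP; apply: measurable_funM => //.
    exact: measurable_gauss2.
  - move=> z _; apply: cvg_EFin; first exact: nearW.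
    rewrite -[X in _ --> X](mulr1 (g z)) /=.
    apply: cvgM; first exact: cvg_cst.
    have h (x : R) : gauss_fun (x / n.+1%:R) @[n --> \oo] --> (1 : R).
      have E : gauss_fun (x * 0) = 1 :> R by rewrite mulr0 /gauss_fun expr0n oppr0 expR0.
      have c0 : x / n.+1%:R @[n --> \oo] --> x * (0 : R).
        by apply: cvgM; [exact: cvg_cst|exact: cvg_harmonic].
      rewrite -[X in _ --> X]E.
      exact: (cvg_comp (fun n : nat => x / n.+1%:R) gauss_fun c0 (@continuous_gauss_fun R (x * 0))).
    by rewrite -[X in _ --> X](mulr1 1); apply: cvgM; exact: h.
  - by [].
  - by move/integrable_abse : gi; exact: eq_integrable.
  - move=> n z _; rewrite lee_fin normrM ler_piMr//.
    by rewrite ger0_norm ?gauss2_ge0 ?gauss2_le1.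
have cR : L n @[n --> \oo] --> 4 * pi ^+ 2 * f (x0, y0).
  apply/cvgrPdist_le => e e0.
  have pi2 : 0 < 4 * pi ^+ 2 :> R by rewrite mulr_gt0 ?exprn_gt0 ?pi_gt0.
  have e1 : 0 < e / 2 / (4 * pi ^+ 2) by rewrite !divr_gt0.
  have [d d0 fd] := fc e1.
  have [C hC] := approx e1 d0 fd.
  have C0 : 0 < `|C| + 1 by rewrite ltr_wpDl.
  have e2 : 0 < e / 2 / (`|C| + 1) by rewrite !divr_gt0.
  near=> n.
  rewrite distrC /L swap_gauss//; apply: le_trans (hC _ _) _; first by rewrite ler1n.
  have -> : 4 * pi ^+ 2 * (e / 2 / (4 * pi ^+ 2)) = e / 2.
    by rewrite mulrC divfK// gt_eqF.
  have h : n.+1%:R^-1 <= (PosNum e2)%:num.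
    by apply: ltW; near: n; exact: near_infty_natSinv_lt.
  rewrite [leRHS](splitr e) lerD2l.
  apply: (@le_trans _ _ ((`|C| + 1) * (e / 2 / (`|C| + 1)))).
    apply: (@le_trans _ _ (`|C| / n.+1%:R)).
      by rewrite ler_wpM2r ?invr_ge0 ?ler0n// ler_norm.
    by apply: ler_pM => //; rewrite lerDl.
  by rewrite mulrC divfK// gt_eqF.
exact: (cvg_unique _ cL cR).
Unshelve. all: by end_near. Qed.

End inversion.

(** * The transform of a solution along characteristics *)

Section joint_continuity.
Context {R : realType}.
Implicit Types f g : R -> R -> R -> R.

Definition jcont f := forall x y t : R, 0 < t ->
  f z.1.1 z.1.2 z.2 @[z --> (x, y, t)] --> f x y t.

Lemma jcont_entry (F : R -> R -> R -> 'M[R]_2) i j :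
  continuous_pos F -> jcont (fun x y t => F x y t i j).
Proof.
move=> cF x y t t0.
exact: (cvg_comp (fun z : R * R * R => F z.1.1 z.1.2 z.2) (fun M : 'M[R]_2 => M i j)
  (cF x y t t0) (@coord_continuous R 2 2 i j (F x y t))).
Qed.

Lemma jcont_add f g : jcont f -> jcont g -> jcont (fun x y t => f x y t + g x y t).
Proof. by move=> cf cg x y t t0; apply: cvgD; [exact: cf|exact: cg]. Qed.

Lemma jcont_mul f g : jcont f -> jcont g -> jcont (fun x y t => f x y t * g x y t).
Proof. by move=> cf cg x y t t0; apply: cvgM; [exact: cf|exact: cg]. Qed.

Lemma jcont_cst (c : R) : jcont (fun _ _ _ => c).
Proof. by move=> x y t _; exact: cvg_cst. Qed.

Lemma jcont_snd : jcont (fun _ y _ => y).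
Proof.
move=> x y t _ /=.
apply: (@cvg_comp _ _ _ (fun z : R * R * R => z.1) (fun z : R * R => z.2) _ (nbhs (x, y))).
  exact: cvg_fst.
exact: cvg_snd.
Qed.

Lemma jcont_comp f (a b c : R -> R) (s : R) : jcont f ->
  {for s, continuous a} -> {for s, continuous b} -> {for s, continuous c} ->
  0 < c s -> {for s, continuous (fun u => f (a u) (b u) (c u))}.
Proof.
move=> cf ca cb cc c0.
have h : (a u, b u, c u) @[u --> s] --> (a s, b s, c s).
  exact: (cvg_pair (cvg_pair ca cb) cc).
exact: (cvg_comp (fun u => (a u, b u, c u)) (fun z : R * R * R => f z.1.1 z.1.2 z.2) h (cf _ _ _ c0)).
Qed.

Lemma jcont_dist f (x y t e : R) : jcont f -> 0 < t -> 0 < e ->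
  exists2 d : R, 0 < d & forall x' y' t', `|x' - x| < d -> `|y' - y| < d ->
    `|t' - t| < d -> `|f x' y' t' - f x y t| <= e.
Proof.
move=> cf t0 e0; have /cvgrPdist_le/(_ _ e0) := cf x y t t0.
move=> /nbhs_ballP[d /= d0 H]; exists d => // x' y' t' h1 h2 h3.
rewrite distrC; apply: (H (x', y', t')).
by split; [split|]; rewrite /ball/= distrC.
Qed.

(* Only the derivative in x has to be jointly continuous: the increment in x is
   treated by the mean value theorem. *)
Lemma chain_rule f fx (y s v ft x : R) : 0 < s ->
  (forall u t, 0 < t -> is_derive u (1 : R) (fun w => f w y t) (fx u y t)) ->
  jcont fx ->
  is_derive s (1 : R) (f x y) ft ->
  is_derive s (1 : R) (fun t => f (x + v * (t - s)) y t) (ft + v * fx x y s).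
Proof.
move=> s0 dfx cfx dft.
pose r t := f (x + v * (t - s)) y t - f x y t.
have dr : is_derive s (1 : R) r (v * fx x y s).
  suff H : h^-1 *: (r (h *: (1 : R) + s) - r s) @[h --> 0^'] --> v * fx x y s.
    apply: DeriveDef.
      by apply/cvg_ex; exists (v * fx x y s).
    exact: (cvg_lim _ H).
  apply/cvgrPdist_le => e e0.
  have e1 : 0 < e / (`|v| + 1) by rewrite divr_gt0// ltr_wpDl.
  have [d d0 H] := jcont_dist x y cfx s0 e1.
  near=> h.
  have hn0 : h != 0 by near: h; exact: nbhs_dnbhs_neq.
  have hs : `|h| < s by near: h; apply: dnbhs0_lt.
  have hd : `|h| < d by near: h; apply: dnbhs0_lt.
  have hvd : `|h| < d / (`|v| + 1) by near: h; apply: dnbhs0_lt; rewrite divr_gt0// ltr_wpDl.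
  have sh : 0 < s + h by move: hs; rewrite ltr_norml => /andP[]; lra.
  have vh : `|v * h| < d.
    rewrite normrM; apply: (@le_lt_trans _ _ ((`|v| + 1) * `|h|)); first by rewrite ler_wpM2r// lerDl.
    by rewrite mulrC -ltr_pdivlMr// ltr_wpDl.
  have [c cx Ec] : exists2 c, `|c - x| < d & f (x + v * h) y (s + h) - f x y (s + h) = fx c y (s + h) * (v * h).
    have D (u : R) : is_derive u (1 : R) (fun w => f w y (s + h)) (fx u y (s + h)) by exact: dfx.
    have C a b : {within `[a, b], continuous (fun w => f w y (s + h))}.
      by apply: derivable_within_continuous => u _; have [] := D u.
    have [vh0|vh0] := lerP 0 (v * h).
      have le : x <= x + v * h by rewrite lerDl.
      have [c ch ->] := MVT_segment le (fun u _ => D u) (C _ _).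
      exists c; last by rewrite addrAC subrr add0r.
      move: ch vh; rewrite in_itv/= => /andP[h1 h2]; rewrite !ltr_norml => /andP[h3 h4].
      by apply/andP; split; lra.
    have le : x + v * h <= x by lra.
    have [c ch E] := MVT_segment le (fun u _ => D u) (C _ _).
    exists c; last by rewrite -opprB E; ring.
    move: ch vh; rewrite in_itv/= => /andP[h1 h2]; rewrite !ltr_norml => /andP[h3 h4].
    by apply/andP; split; lra.
  have -> : h^-1 *: (r (h *: (1 : R) + s) - r s) = v * fx c y (s + h).
    have -> : h *: (1 : R) = h by rewrite -[LHS]/(h * 1) mulr1.
    have -> : h + s = s + h by rewrite addrC.
    have E : s + h - s = h by ring.
    rewrite /r E Ec subrr mulr0 addr0 subrr subr0.
    by rewrite -[LHS]/(h^-1 * _); field.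
  rewrite -mulrBr normrM distrC.
  apply: (@le_trans _ _ ((`|v| + 1) * (e / (`|v| + 1)))); last by rewrite mulrC divfK// gt_eqF// ltr_wpDl.
  apply: ler_pM => //; first by rewrite lerDl.
  by apply: H => //; rewrite ?subrr ?normr0// addrAC subrr add0r.
have -> : (fun t => f (x + v * (t - s)) y t) = (fun t => f x y t + r t).
  by apply/funext => t; rewrite /r; ring.
exact: is_deriveD.
Unshelve. all: by end_near. Qed.

Lemma jcont_measurable f (t : R) : jcont f -> 0 < t ->
  measurable_fun setT (fun z : measurableTypeR R * measurableTypeR R => f z.1 z.2 t).
Proof.
move=> cf t0; apply: (@measurable_continuous2 R (fun x y => f x y t)).
  by move=> y x; apply: (@jcont_comp f id (cst y) (cst t)) => //; exact: cvg_cst.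
by move=> x y; apply: (@jcont_comp f (cst x) id (cst t)) => //; exact: cvg_cst.
Qed.

End joint_continuity.

Section transforms.
Context {R : realType}.
Notation TR := (measurableTypeR R).
Notation mu := (@lebesgue_measure R).
Implicit Types f g : TR * TR -> R.

Definition fcos (c : R) f (xi eta : R) : R :=
  (\int[leb2]_z (cos (z.1 * xi + z.2 * eta + c) * f z))%R.

Definition L1bound f (M : R) := leb2.-integrable setT (EFin \o f) /\
  (\int[leb2]_z `|f z|)%R <= M.

Lemma measurable_phase (a b c : R) :
  measurable_fun setT (fun z : TR * TR => cos (z.1 * a + z.2 * b + c) : TR).
Proof.
by have := measurable_cos2 a b c; apply: eq_measurable_fun => z _; rewrite /= ![_ * a]mulrC ![_ * b]mulrC.
Qed.

Lemma fcos_integrable c f a b : leb2.-integrable setT (EFin \o f) ->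
  leb2.-integrable setT (EFin \o (fun z : TR * TR => cos (z.1 * a + z.2 * b + c) * f z)).
Proof.
move=> fi; apply: (@integrable_bounded _ _ _ _ _ _ 1) => //; first exact: measurable_phase.
by move=> z; exact: normr_cos_le1.
Qed.

Lemma integrable_norm d (T : measurableType d) (m : {measure set T -> \bar R}) (f : T -> R) :
  m.-integrable setT (EFin \o f) -> m.-integrable setT (EFin \o (fun z => `|f z|)).
Proof. by move/integrable_abse; exact: eq_integrable. Qed.

Lemma fcos_le c f a b M : L1bound f M -> `|fcos c f a b| <= M.
Proof.
move=> [fi fM]; apply: le_trans fM; apply: le_norm_Rintegral.
- exact: fcos_integrable.
- exact: integrable_norm.
- by move=> z; rewrite normrM ler_piMl// normr_cos_le1.
Qed.

(* The phase shift lets one transform play the role of both the cosine (c = 0)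
   and the sine (c = - pi / 2) transform. *)
Lemma fcos_shift c f a b : leb2.-integrable setT (EFin \o f) ->
  fcos c f a b = cos c * fcos 0 f a b - sin c * (\int[leb2]_z (sin (z.1 * a + z.2 * b) * f z))%R.
Proof.
move=> fi.
have si : leb2.-integrable setT (EFin \o (fun z : TR * TR => sin (z.1 * a + z.2 * b) * f z)).
  apply: (@integrable_bounded _ _ _ _ _ _ 1) => //.
    apply: measurableT_comp; first exact: measurable_sin.
    by apply: measurable_funD => //; apply: measurable_funM.
  by move=> z; rewrite ler_norml sin_geN1 sin_le1.
have ci := fcos_integrable 0 a b fi.
rewrite /fcos -(RintegralZl _ measurableT ci) -(RintegralZl _ measurableT si).
rewrite -RintegralB//; [|exact: integrable_scale..].
by apply: eq_Rintegral => z _; rewrite cosD addr0; ring.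
Qed.

(** Undoing the shear in space is a drift of the second frequency; with [k = A * s] this is the
    motion of the frequency along the characteristics. *)
Lemma fcos_shear c f (a b k : R) : measurable_fun setT f ->
  (\int[leb2]_z (cos (z.1 * a + z.2 * b + c) * f ((z.1 : R) + k * z.2, z.2)))%R =
  fcos c f a (b - k * a).
Proof.
move=> mf; rewrite /fcos.
rewrite -[RHS](preserving_integral (preserving_shear k 0)).
  by apply: eq_Rintegral => z _ /=; rewrite addr0; congr (cos _ * _); ring.
by apply: measurable_funM => //; exact: measurable_phase.
Qed.

Lemma integral_shear f (k : R) : measurable_fun setT f ->
  (\int[leb2]_z `|f ((z.1 : R) + k * z.2, z.2)|)%R = (\int[leb2]_z `|f z|)%R.
Proof.
move=> mf; rewrite -[RHS](preserving_integral (preserving_shear k 0)).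
  by apply: eq_Rintegral => z _ /=; rewrite addr0.
exact: measurableT_comp.
Qed.

Lemma integrable_shear f (k : R) : leb2.-integrable setT (EFin \o f) ->
  leb2.-integrable setT (EFin \o (fun z : TR * TR => f ((z.1 : R) + k * z.2, z.2))).
Proof.
move/(preserving_integrable (preserving_shear k 0)).
by apply: eq_integrable => // z _ /=; rewrite addr0.
Qed.

Lemma normr_entry (M : 'M[R]_2) i j : `|M i j| <= `|M|.
Proof. by rewrite [leRHS]mx_normrE (le_bigmax _ (fun ij => `|M ij.1 ij.2|) (i, j)). Qed.

Lemma L1norm_bound (F : R -> R -> 'M[R]_2) i j M :
  (forall i j, measurable_fun setT (fun z : TR * TR => F z.1 z.2 i j : TR)) ->
  (L1norm F <= M%:E)%E -> L1bound (fun z => F z.1 z.2 i j) M.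
Proof.
move=> mF FM.
have mN : measurable_fun setT (fun z : TR * TR => `|F z.1 z.2| : TR).
  (* The matrix norm is written as a maximum of four entries to inherit their measurability. *)
  have -> : (fun z : TR * TR => `|F z.1 z.2| : TR) = (fun z =>
     Num.max (Num.max `|F z.1 z.2 ord0 ord0| `|F z.1 z.2 ord0 ord_max|)
       (Num.max `|F z.1 z.2 ord_max ord0| `|F z.1 z.2 ord_max ord_max|)).
    apply/funext => z; apply/eqP; rewrite eq_le; apply/andP; split; last first.
      by rewrite !ge_max !normr_entry.
    have E (k : 'I_2) : k = ord0 \/ k = ord_max.
      by case: k => [[|[|k]] kk] //; [left|right]; apply/val_inj.
    rewrite [leLHS]mx_normrE; apply: bigmax_le => [|[k l] _].
      by rewrite !le_max normr_ge0.
    by case: (E k) => ->; case: (E l) => -> /=; rewrite !le_max lexx ?orbT.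
  by do 2 apply: measurable_maxr; apply: measurableT_comp => //; exact: mF.
have le : (\int[leb2]_z `|F z.1 z.2 i j|%:E <= M%:E)%E.
  apply: le_trans FM; apply: ge0_le_integral => //.
  - by apply/measurable_EFinP; apply: measurableT_comp => //; exact: mF.
  - exact/measurable_EFinP.
  - by move=> z _; rewrite lee_fin normr_entry.
have fin : (\int[leb2]_z `|F z.1 z.2 i j|%:E)%E \is a fin_num.
  by rewrite ge0_fin_numE ?integral_ge0// (le_lt_trans le)// ltry.
split.
  apply/integrableP; split; first by apply/measurable_EFinP; exact: mF.
  by rewrite (le_lt_trans le)// ltry.
by rewrite -lee_fin /Rintegral fineK.
Qed.

End transforms.

(** * The integrated equation along characteristics *)

Section characteristics.
Context {R : realType}.
Notation TR := (measurableTypeR R).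
Notation mu := (@lebesgue_measure R).
Variables (A : R) (f g : R -> R -> R -> R).
Hypothesis cf : jcont f.
Hypothesis cg : jcont g.
Hypothesis dfg : forall x y s : R, 0 < s ->
  is_derive s (1 : R) (fun t => f (x + A * t * y) y t) (g (x + A * s * y) y s).

Let char_cont x y (a : R -> R) : (forall s, 0 < a s) -> continuous a ->
  continuous (fun s => g (x + A * s * y) y (a s)).
Proof.
move=> a0 ca s.
apply: (@jcont_comp _ g (fun s => x + A * s * y) (cst y) a s cg _ _ (ca s) (a0 s)); last exact: cvg_cst.
apply: cvgD; first exact: cvg_cst.
apply: cvgM; last exact: cvg_cst.
by apply: cvgM; [exact: cvg_cst|exact: cvg_id].
Qed.

(** Times below [t1] are replaced by [t1]: the integrand is then continuous on the whole line,
    although [g] is controlled at positive times only. *)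
Let clamp (t1 s : R) := Num.max t1 s.

Let clamp_gt0 t1 s : 0 < t1 -> 0 < clamp t1 s.
Proof. by move=> h; rewrite /clamp lt_max h. Qed.

Let clamp_cont t1 : continuous (clamp t1).
Proof. by move=> s; apply: continuous_max; [exact: cvg_cst|exact: cvg_id]. Qed.

Lemma char_FTC x y t1 t2 : 0 < t1 -> t1 < t2 ->
  \int[mu]_(s in `[t1, t2]) g (x + A * s * y) y (clamp t1 s) =
  f (x + A * t2 * y) y t2 - f (x + A * t1 * y) y t1.
Proof.
move=> t10 t12; rewrite /Rintegral.
have D s : t1 <= s -> is_derive s (1 : R) (fun t => f (x + A * t * y) y t) (g (x + A * s * y) y s).
  by move=> h; apply: dfg; exact: lt_le_trans h.
have C s : t1 <= s -> {for s, continuous (fun t => f (x + A * t * y) y t)}.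
  by move=> h; apply/differentiable_continuous/derivable1_diffP; have [] := D s h.
rewrite (@continuous_FTC2 R _ (fun t => f (x + A * t * y) y t))//.
- apply: continuous_subspaceT; apply: char_cont => //.
  by move=> s; exact: clamp_gt0.
- split.
  + by move=> s; rewrite in_itv/= => /andP[/ltW h _]; have [] := D s h.
  + by apply: cvg_at_right_filter; apply: C.
  + by apply: cvg_at_left_filter; apply: C; exact: ltW.
- move=> s; rewrite in_itv/= => /andP[/ltW h _].
  by rewrite derive1E; have [_ ->] := D s h; rewrite /clamp (max_idPr h).
Qed.

Variables (t1 t2 M xi eta c : R).
Hypothesis t10 : 0 < t1.
Hypothesis t12 : t1 < t2.
Hypothesis fi : forall t, 0 < t -> leb2.-integrable setT (EFin \o (fun z : TR * TR => f z.1 z.2 t)).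
Hypothesis gM : forall t, t1 <= t <= t2 -> L1bound (fun z : TR * TR => g z.1 z.2 t) M.

Let G (s : R) (z : TR * TR) : R :=
  cos (z.1 * xi + z.2 * eta + c) * g (z.1 + A * s * z.2) z.2 (clamp t1 s).

Let mG : measurable_fun setT (fun w : TR * (TR * TR) => G w.1 w.2 : TR).
Proof.
apply: (@measurable_caratheodory R _ (TR * TR)%type G).
  move=> z s; apply: cvgM; first exact: cvg_cst.
  apply: char_cont => //; by move=> u; exact: clamp_gt0.
move=> s; apply: measurable_funM; first exact: measurable_phase.
have := measurableT_comp (jcont_measurable cg (clamp_gt0 s t10)) (preserving_shear (A * s) 0).1.
by apply: eq_measurable_fun => z _ /=; rewrite addr0.
Qed.

Let Th (w : TR * (TR * TR)) : R := \1_(`[t1, t2]%classic : set TR) w.1 * G w.1 w.2.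

Let slice_integrable s : t1 <= s <= t2 -> leb2.-integrable setT (EFin \o G s).
Proof.
move=> st; have [gi _] := gM st.
have := integrable_shear (A * s) gi => h.
have := fcos_integrable c xi eta h; apply: eq_integrable => // z _.
by rewrite /G/= /clamp (max_idPr _)//; case/andP: st.
Qed.

Let slice_le s : t1 <= s <= t2 -> (\int[leb2]_z `|G s z| <= M)%R.
Proof.
move=> st; have [gi gMs] := gM st.
have gsi := integrable_shear (A * s) gi.
have mg : measurable_fun setT (fun z : TR * TR => g z.1 z.2 s : TR).
  by apply/measurable_EFinP; exact: measurable_int gi.
apply: le_trans gMs; rewrite -(integral_shear (A * s) mg).
apply: le_Rintegral => //.
- exact/integrable_norm/slice_integrable.
- exact: integrable_norm gsi.
- move=> z _; rewrite /G normrM /clamp (max_idPr _); last by case/andP: st.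
  by rewrite ler_piMl// normr_cos_le1.
Qed.

Let Th_integrable : (mu \x lebm)%E.-integrable setT (EFin \o Th).
Proof.
apply/integrable12ltyP.
  apply/measurable_EFinP; apply: measurable_funM => //.
  by apply: measurableT_comp measurable_fst; apply: measurable_indic.
apply: (@le_lt_trans _ _ (\int[mu]_s (\1_(`[t1, t2]%classic : set TR) s * M)%:E)%E).
  apply: ge0_le_integral => //.
  - by move=> s _; exact: integral_ge0.
  - apply: (@measurable_fun_fubini_tonelli_F _ _ TR (TR * TR)%type R lebm (fun w => `|(Th w)%:E|%E)) => //.
    apply/measurableT_comp => //; apply/measurable_EFinP; apply: measurable_funM => //.
    by apply: measurableT_comp measurable_fst; apply: measurable_indic.
  - by apply/measurable_EFinP; apply: measurable_funM => //; apply: measurable_indic.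
  - move=> s _; rewrite indicE; have [/set_mem|] := boolP (s \in _).
      rewrite /= in_itv/= => st; rewrite mul1r.
      have iG := integrable_norm (slice_integrable st).
      rewrite -[leRHS]/(M%:E) (le_trans _ (_ : (\int[leb2]_z `|G s z|)%:E <= M%:E)%E)//; last first.
        by rewrite lee_fin slice_le.
      rewrite /Rintegral fineK; last exact: (integrable_fin_num _ iG).
      rewrite le_eqVlt; apply/orP; left; apply/eqP; apply: eq_integral => z _.
      by rewrite /Th/= indicE mem_set ?mul1r//= in_itv.
    move=> sD; rewrite mul0r integral0_eq// => z _.
    by rewrite /Th/= indicE (negbTE sD) mul0r normr0.
under eq_integral do rewrite EFinM.
rewrite ge0_integralZr//; last 2 first.
- by apply/measurable_EFinP; apply: measurable_indic.
- have t11 : t1 <= t1 <= t2 by rewrite lexx ltW.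
  by have [_ h] := gM t11; rewrite lee_fin (le_trans _ h)// Rintegral_ge0.
rewrite integral_indic// setIT/= lebesgue_measure_itv/= lte_fin t12.
by rewrite -EFinB -EFinM ltry.
Qed.

Let slice_Th s : leb2.-integrable setT (EFin \o (fun z => Th (s, z))).
Proof.
rewrite /Th/= indicE; have [/set_mem|] := boolP (s \in _).
  rewrite /= in_itv/= => st; have := slice_integrable st.
  by apply: eq_integrable => // z _ /=; rewrite mul1r.
move=> _; have := @integrable0 _ _ R leb2 setT.
by apply: eq_integrable => // z _ /=; rewrite mul0r.
Qed.

Let phi s := fcos c (fun z : TR * TR => g z.1 z.2 s) xi (eta - A * s * xi).

Let Th_phi s : (\int[leb2]_z Th (s, z))%R = (phi \_ `[t1, t2]) s.
Proof.
rewrite patchE; have [sD|sD] := boolP (s \in _); last first.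
  rewrite /Th/= indicE (negbTE sD).
  by under eq_Rintegral do rewrite mul0r; rewrite /Rintegral integral0.
have st : t1 <= s <= t2 by move/set_mem : (sD); rewrite /= in_itv.
have [gi gMs] := gM st.
have mg : measurable_fun setT (fun z : TR * TR => g z.1 z.2 s : TR).
  by apply/measurable_EFinP; exact: measurable_int gi.
rewrite /phi -(fcos_shear c xi eta (A * s) mg); apply: eq_Rintegral => z _.
by rewrite /Th/= indicE sD mul1r /G /clamp (max_idPr _)//; case/andP: st.
Qed.

(** The fundamental theorem of calculus on each characteristic, multiplied by the cosine and
    integrated over the plane, with Fubini's theorem on [t1, t2] times the plane. An L^1 bound on
    [g] uniform in time is exactly what Fubini needs, whereas differentiation under the integral
    would require a common majorant. *)
Lemma char_increment :
  mu.-integrable `[t1, t2] (EFin \o phi) /\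
  fcos c (fun z : TR * TR => f z.1 z.2 t2) xi (eta - A * t2 * xi) -
  fcos c (fun z : TR * TR => f z.1 z.2 t1) xi (eta - A * t1 * xi) =
  \int[mu]_(s in `[t1, t2]) phi s.
Proof.
split.
  apply/integrable_mkcond => //; rewrite restrict_EFin.
  have := integrable_fubini_F Th_integrable.
  apply: eq_integrable => // s _; rewrite /fubini_F/= -Th_phi /Rintegral fineK//.
  exact: (integrable_fin_num _ (slice_Th s)).
rewrite Rintegral_mkcond.
have -> : \int[mu]_s (phi \_ `[t1, t2]) s = \int[mu]_s (\int[lebm]_z Th (s, z)).
  by apply: eq_Rintegral => s _; rewrite -Th_phi.
rewrite (Rintegral_prod1 Th_integrable slice_Th).
have row z s : Th (s, z) = ((fun s => cos (z.1 * xi + z.2 * eta + c) * g (z.1 + A * s * z.2) z.2 (clamp t1 s)) \_ `[t1, t2]) s.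
  rewrite patchE /Th/= indicE /G; case: ifP => _; by rewrite ?mul1r ?mul0r.
have cont (z : TR * TR) : continuous (fun s => g ((z.1 : R) + A * s * z.2) z.2 (clamp t1 s)).
  by apply: char_cont => //; move=> u; exact: clamp_gt0.
have ci (z : TR * TR) : mu.-integrable `[t1, t2] (EFin \o (fun s => g ((z.1 : R) + A * s * z.2) z.2 (clamp t1 s))).
  by apply: continuous_compact_integrable; [exact: segment_compact|exact: continuous_subspaceT].
have rowi (z : TR * TR) : mu.-integrable setT (EFin \o (fun s => Th (s, z))).
  rewrite (_ : EFin \o _ = (EFin \o (fun s => cos (z.1 * xi + z.2 * eta + c) * g (z.1 + A * s * z.2) z.2 (clamp t1 s))) \_ `[t1, t2]); last first.
    by rewrite restrict_EFin; apply/funext => s /=; rewrite row.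
  have h : mu.-integrable `[t1, t2] (EFin \o (fun s => cos (z.1 * xi + z.2 * eta + c) * g (z.1 + A * s * z.2) z.2 (clamp t1 s))).
    apply: continuous_compact_integrable; first exact: segment_compact.
    by apply: continuous_subspaceT => s; apply: cvgM; [exact: cvg_cst|exact: cont].
  by move/integrable_mkcond : h; apply; exact: measurable_itv.
rewrite -(Rintegral_prod2 Th_integrable rowi).
have t20 : 0 < t2 by exact: lt_trans t12.
have m1 : measurable_fun setT (fun z : TR * TR => f z.1 z.2 t1 : TR) by exact: jcont_measurable.
have m2 : measurable_fun setT (fun z : TR * TR => f z.1 z.2 t2 : TR) by exact: jcont_measurable.
rewrite -(fcos_shear c xi eta (A * t2) m2) -(fcos_shear c xi eta (A * t1) m1).
have i1 := fcos_integrable c xi eta (integrable_shear (A * t1) (fi t10)).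
have i2 := fcos_integrable c xi eta (integrable_shear (A * t2) (fi t20)).
rewrite -(RintegralB measurableT i2 i1); apply: eq_Rintegral => z _ /=.
rewrite -mulrBr -char_FTC//.
have mD : measurable (`[t1, t2]%classic : set TR) by exact: measurable_itv.
have -> := esym (RintegralZl (cos (z.1 * xi + z.2 * eta + c)) mD (ci z)).
by rewrite Rintegral_mkcond; apply: eq_Rintegral => s _; rewrite row.
Qed.

End characteristics.

Section primitive.
Context {R : realType}.
Notation mu := (@lebesgue_measure R).

Lemma le_norm_integral_itv (phi : R -> R) (t1 t2 K : R) : t1 < t2 ->
  mu.-integrable `[t1, t2] (EFin \o phi) ->
  (forall s, t1 <= s <= t2 -> `|phi s| <= K) ->
  `|\int[mu]_(s in `[t1, t2]) phi s| <= K * (t2 - t1).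
Proof.
move=> t12 ip pK.
have mD : measurable (`[t1, t2]%classic : set (measurableTypeR R)) by exact: measurable_itv.
have fin : mu `[t1, t2] = (t2 - t1)%:E by rewrite lebesgue_measure_itv/= lte_fin t12.
apply: le_trans (le_normr_Rintegral mD ip) _.
have -> : K * (t2 - t1) = \int[mu]_(s in (`[t1, t2]%classic : set (measurableTypeR R))) K.
  rewrite (@Rintegral_cst _ _ _ mu _ mD); congr (_ * _).
  exact: (esym (congr1 fine fin)).
apply: le_Rintegral => //.
- by move/integrable_abse : ip; exact: eq_integrable.
- apply/integrableP; split; first exact: measurable_cst.
  have E : (\int[mu]_(x in (`[t1, t2]%classic : set (measurableTypeR R))) `|K|%:E = `|K|%:E * (t2 - t1)%:E)%E.
    by rewrite (@integral_cst _ _ _ mu _ mD); congr (_ * _)%E.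
  by rewrite -EFinM in E; rewrite [ltLHS]E ltry.
Qed.

Lemma is_derive_primitive (P phi : R -> R) (t : R) : 0 < t ->
  (forall t1 t2, 0 < t1 -> t1 < t2 -> mu.-integrable `[t1, t2] (EFin \o phi) /\
     P t2 - P t1 = \int[mu]_(s in `[t1, t2]) phi s) ->
  {for t, continuous phi} -> is_derive t (1 : R) P (phi t).
Proof.
move=> t0 H cphi; pose a := t / 2.
have a0 : 0 < a by rewrite /a; lra.
have at_ : a < t by rewrite /a; lra.
have tu : t < t + 1 by lra.
have [ip _] := H a (t + 1) a0 (lt_trans at_ tu).
have [d1 d2] := @continuous_FTC1_closed R phi a t (t + 1) tu ip at_ cphi.
pose I x := \int[mu]_(s in `[a, x]) phi s.
have dI : is_derive t (1 : R) I (phi t) by apply: DeriveDef; [exact: d1|rewrite -derive1E; exact: d2].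
apply: (@near_eq_is_derive _ _ _ (fun x => P a + I x)).
  near=> x; have ax : a < x by near: x; exact: lt_nbhsr.
  by have [_ h] := H a x a0 ax; rewrite /I -h; ring.
by have := is_deriveD (is_derive_cst (P a) t 1) dI; rewrite add0r.
Unshelve. all: by end_near. Qed.

End primitive.

Lemma continuous_near_pos {R : realType} (a b : R -> R) (s : R) : 0 < s ->
  (forall u, 0 < u -> a u = b u) -> {for s, continuous a} -> {for s, continuous b}.
Proof.
move=> s0 E ca; apply/cvgrPdist_le => e e0; near=> u.
have u0 : 0 < u by near: u; exact: lt_nbhsr.
by rewrite -!E//; near: u; move/cvgrPdist_le : ca; apply.
Unshelve. all: by end_near. Qed.

Section fcos_continuity.
Context {R : realType}.
Notation TR := (measurableTypeR R).

Lemma fcos_continuous (c a : R) (f : TR * TR -> R) :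
  leb2.-integrable setT (EFin \o f) -> continuous (fcos c f a).
Proof.
move=> fi b; rewrite /fcos.
have bI : b \in `](b - 1), (b + 1)[%classic.
  by apply/mem_set; rewrite /= in_itv/=; apply/andP; split; lra.
apply: (@continuity_under_integral R _ _ leb2 (fun b z => cos (z.1 * a + z.2 * b + c) * f z)
  setT measurableT (b - 1) (b + 1) _ _ (fun z => `|f z|)) => //.
- by move=> x _; exact: fcos_integrable.
- apply/aeW => z _ x _; apply: cvgM; last exact: cvg_cst.
  apply: continuous_comp; last exact: continuous_cos.
  apply: cvgD; last exact: cvg_cst.
  apply: cvgD; first exact: cvg_cst.
  by apply: cvgM; [exact: cvg_cst|exact: cvg_id].
- exact: integrable_norm.
- by move=> x _; apply/aeW => z _; rewrite normrM ler_piMl// normr_cos_le1.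
Qed.

End fcos_continuity.

(** * The linear system of the transform and its initial value *)

Section solution.
Context {R : realType}.
Notation TR := (measurableTypeR R).
Notation mu := (@lebesgue_measure R).
Variables (A x0 y0 : R) (F : R -> R -> R -> 'M[R]_2).
Hypothesis sol : solution_from_delta A x0 y0 F.

Let f (i j : 'I_2) (x y t : R) : R := F x y t i j.
Let g (i j : 'I_2) (x y t : R) : R := transport A F t x y i j.

Let cf i j : jcont (f i j).
Proof. exact/jcont_entry/(sol_cont sol). Qed.

Let cg i j : jcont (g i j).
Proof.
have -> : g i j = (fun x y t => d_t F x y t i j + (A * y) * d_x F x y t i j).
  by apply/funext => x; apply/funext => y; apply/funext => t; rewrite /g /transport !mxE.
apply: jcont_add; first exact/jcont_entry/(sol_cont_t sol).
apply: jcont_mul; last exact/jcont_entry/(sol_cont_x sol).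
by apply: jcont_mul; [exact: jcont_cst|exact: jcont_snd].
Qed.

Let dfg i j (x y s : R) : 0 < s ->
  is_derive s (1 : R) (fun t => f i j (x + A * t * y) y t) (g i j (x + A * s * y) y s).
Proof.
move=> s0.
have dx u t : 0 < t -> is_derive u (1 : R) (fun w => f i j w y t) (d_x F u y t i j).
  move=> t0; have D : derivable (fun w => F w y t) u 1 := sol_derivable_x sol t0.
  apply: DeriveDef; first exact: ((derivable_mxP _ _ _).1 D i j).
  by rewrite /d_x derive1E (derive_mx D) mxE.
have D : derivable (F (x + A * s * y) y) s 1 := sol_derivable_t sol s0.
have dt : is_derive s (1 : R) (f i j (x + A * s * y) y) (d_t F (x + A * s * y) y s i j).
  apply: DeriveDef; first exact: ((derivable_mxP _ _ _).1 D i j).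
  by rewrite /d_t derive1E (derive_mx D) mxE.
have := chain_rule (A * y) s0 dx (jcont_entry (sol_cont_x sol)) dt.
have -> : (fun t => f i j (x + A * s * y + A * y * (t - s)) y t) = (fun t => f i j (x + A * t * y) y t).
  by apply/funext => t; congr (f i j _ y t); ring.
by rewrite /g /transport !mxE.
Qed.

Let f_bound T : 0 < T -> exists M, forall i j t, 0 < t <= T -> L1bound (fun z : TR * TR => f i j z.1 z.2 t) M.
Proof.
move=> T0; have [M HM] := sol_L1 sol T0; exists M => i j t tT.
apply: (@L1norm_bound _ (fun x y => F x y t)); last exact: HM.
by move=> k l; apply: (@jcont_measurable _ (f k l)); [exact: cf|case/andP: tT].
Qed.

Let f_integrable i j t : 0 < t -> leb2.-integrable setT (EFin \o (fun z : TR * TR => f i j z.1 z.2 t)).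
Proof.
by move=> t0; have [M HM] := f_bound t0; have [] // := HM i j t; rewrite t0 lexx.
Qed.

Let g_bound t1 t2 : 0 < t1 -> exists M, forall i j t, t1 <= t <= t2 -> L1bound (fun z : TR * TR => g i j z.1 z.2 t) M.
Proof.
move=> t10; have [M HM] := sol_BD_L1 sol t2 t10; exists M => i j t tt.
apply: (@L1norm_bound _ (transport A F t)); last exact: HM.
move=> k l; apply: (@jcont_measurable _ (g k l)); first exact: cg.
by case/andP: tt => h _; exact: lt_le_trans h.
Qed.

(* The Fourier transform followed along the characteristics of the shear, where
   the frequency (xi, eta) has moved to (xi, eta - A s xi) at time s. *)
Definition hat (i j : 'I_2) (c xi eta s : R) : R :=
  fcos c (fun z : TR * TR => F z.1 z.2 s i j) xi (eta - A * s * xi).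

Let integralC_re (h : R -> R -> R) a b :
  complex.Re (integralC (fun x y => expi (- (x * a + y * b)) * (h x y)%:C%C)) =
  fcos 0 (fun z => h z.1 z.2) a b.
Proof.
rewrite /integralC /fcos /=; apply: eq_Rintegral => z _ /=.
by rewrite mulr0 subr0 cosN addr0.
Qed.

Let integralC_im (h : R -> R -> R) a b :
  leb2.-integrable setT (EFin \o (fun z : TR * TR => h z.1 z.2)) ->
  complex.Im (integralC (fun x y => expi (- (x * a + y * b)) * (h x y)%:C%C)) =
  - (\int[leb2]_z (sin (z.1 * a + z.2 * b) * h z.1 z.2))%R.
Proof.
move=> hi; rewrite /integralC /=.
have si : leb2.-integrable setT (EFin \o (fun z : TR * TR => sin (z.1 * a + z.2 * b) * h z.1 z.2)).
  apply: (@integrable_bounded _ _ _ _ _ _ 1) hi.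
    apply: measurableT_comp; first exact: measurable_sin.
    by apply: measurable_funD => //; apply: measurable_funM.
  by move=> z; rewrite ler_norml sin_geN1 sin_le1.
rewrite -mulN1r -(RintegralZl _ measurableT si); apply: eq_Rintegral => z _ /=.
by rewrite mulr0 add0r sinN mulN1r mulNr.
Qed.

(** The real and imaginary parts of [sol_eq] are the cosine and sine transforms, which a real symbol
    does not mix; [fcos_shift] recombines them into an arbitrary phase. *)
Let BD_entry (c a b t : R) i j : 0 < t ->
  fcos c (fun z : TR * TR => g i j z.1 z.2 t) a b =
  \sum_k Bsymbol a b i k * fcos c (fun z : TR * TR => f k j z.1 z.2 t) a b.
Proof.
move=> t0; have gi k l : leb2.-integrable setT (EFin \o (fun z : TR * TR => g k l z.1 z.2 t)).
  by have [M HM] := g_bound t t0; have [] // := HM k l t; rewrite lexx.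
have /matrixP/(_ i j) := sol_eq sol t0 a b.
rewrite !mxE; under eq_bigr do rewrite !mxE.
move=> E; have Ere := congr1 (@complex.Re R) E; have Eim := congr1 (@complex.Im R) E.
rewrite integralC_re raddf_sum in Ere.
rewrite (integralC_im _ _ (gi i j)) raddf_sum in Eim.
rewrite (fcos_shift _ _ _ (gi i j)).
under eq_bigr do rewrite (fcos_shift _ _ _ (f_integrable _ _ t0)) mulrBr.
rewrite sumrB; congr (_ - _).
  rewrite Ere mulr_sumr; apply: eq_bigr => k _ /=.
  have := integralC_re (fun x y => f k j x y t) a b; rewrite /= => ->.
  rewrite mul0r subr0 [Bsymbol _ _ _ _]mxE; ring.
rewrite -[LHS]opprK -mulrN Eim mulr_sumr -sumrN; apply: eq_bigr => k _ /=.
have := @integralC_im (fun x y => f k j x y t) a b (@f_integrable k j t t0).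
rewrite /= => ->.
rewrite mul0r addr0 [Bsymbol _ _ _ _]mxE; ring.
Qed.

Let r (xi eta s : R) := xi ^+ 2 + (eta - A * s * xi) ^+ 2.

Let phi (i j : 'I_2) (c xi eta s : R) := fcos c (fun z : TR * TR => g i j z.1 z.2 s) xi (eta - A * s * xi).

Let phi0 j c xi eta s : 0 < s -> phi ord0 j c xi eta s =
  - r xi eta s * hat ord0 j c xi eta s + r xi eta s * hat ord_max j c xi eta s.
Proof.
move=> s0; rewrite /phi BD_entry// !big_ord_recl big_ord0 addr0 !mxE /=.
have -> : lift ord0 ord0 = ord_max :> 'I_2 by apply/val_inj.
by [].
Qed.

Let phi1 j c xi eta s : 0 < s -> phi ord_max j c xi eta s =
  hat ord0 j c xi eta s - (r xi eta s + 2) * hat ord_max j c xi eta s.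
Proof.
move=> s0; rewrite /phi BD_entry// !big_ord_recl big_ord0 addr0 !mxE /=.
have -> : lift ord0 ord0 = ord_max :> 'I_2 by apply/val_inj.
by rewrite mul1r /r /hat /f; ring.
Qed.

Let two (i : 'I_2) : i = ord0 \/ i = ord_max.
Proof. by case: i => [[|[|k]] kk] //; [left|right]; apply/val_inj. Qed.

Let hat_le M T : (forall i j t, 0 < t <= T -> L1bound (fun z : TR * TR => f i j z.1 z.2 t) M) ->
  forall i j c xi eta s, 0 < s <= T -> `|hat i j c xi eta s| <= M.
Proof. by move=> HM i j c xi eta s sT; apply: fcos_le; exact: HM. Qed.

Let rmax (xi eta T : R) := xi ^+ 2 + (`|eta| + `|A| * T * `|xi|) ^+ 2.

Let r_le xi eta T s : 0 < s <= T -> r xi eta s <= rmax xi eta T.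
Proof.
move=> /andP[s0 sT]; rewrite /r /rmax lerD2l -real_normK ?num_real//.
have T0 : 0 <= T by rewrite (le_trans (ltW s0)).
rewrite ler_pXn2r ?nnegrE ?addr_ge0 ?mulr_ge0//.
apply: le_trans (ler_normB _ _) _; rewrite lerD2l !normrM ler_wpM2r// ler_wpM2l//.
by rewrite gtr0_norm.
Qed.

Let r_ge0 xi eta s : 0 <= r xi eta s.
Proof. by rewrite addr_ge0 ?sqr_ge0. Qed.

(** The bound in [sol_BD_L1] may blow up as the time tends to 0. Expressing [phi] by the symbol and
    [hat] gives a bound from the L^1 norm of [F] alone, valid down to time 0, so [hat] is Lipschitz
    uniformly on (0, T]. *)
Let phi_le M T : (forall i j t, 0 < t <= T -> L1bound (fun z : TR * TR => f i j z.1 z.2 t) M) ->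
  forall i j c xi eta s, 0 < s <= T -> `|phi i j c xi eta s| <= (2 * rmax xi eta T + 3) * M.
Proof.
move=> HM i j c xi eta s sT; have s0 : 0 < s by case/andP: sT.
have h0 := hat_le HM ord0 j c xi eta sT; have h1 := hat_le HM ord_max j c xi eta sT.
have M0 : 0 <= M by exact: le_trans (normr_ge0 _) h0.
have rl := r_le xi eta sT; have r0 := r_ge0 xi eta s.
have m0 (u v : R) : 0 <= u -> `|v| <= M -> u <= rmax xi eta T + 2 -> `|u * v| <= (rmax xi eta T + 2) * M.
  by move=> u0 vM ul; rewrite normrM ger0_norm//; apply: ler_pM.
have rm0 : 0 <= rmax xi eta T by exact: le_trans rl.
case: (two i) => ->.
  rewrite phi0//; apply: le_trans (ler_normD _ _) _; rewrite mulNr normrN.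
  have e1 : `|r xi eta s * hat ord0 j c xi eta s| <= rmax xi eta T * M.
    by rewrite normrM ger0_norm//; apply: ler_pM.
  have e2 : `|r xi eta s * hat ord_max j c xi eta s| <= rmax xi eta T * M.
    by rewrite normrM ger0_norm//; apply: ler_pM.
  have -> : (2 * rmax xi eta T + 3) * M = rmax xi eta T * M + rmax xi eta T * M + 3 * M by ring.
  lra.
rewrite phi1//; apply: le_trans (ler_normB _ _) _.
have e2 : `|(r xi eta s + 2) * hat ord_max j c xi eta s| <= (rmax xi eta T + 2) * M.
  by apply: m0 => //; [rewrite addr_ge0|rewrite lerD2r].
have := mulr_ge0 rm0 M0.
have E2 : (rmax xi eta T + 2) * M = rmax xi eta T * M + 2 * M by ring.
rewrite E2 in e2.
have -> : (2 * rmax xi eta T + 3) * M = rmax xi eta T * M + rmax xi eta T * M + 3 * M by ring.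
lra.
Qed.

Let incr i j c xi eta t1 t2 : 0 < t1 -> t1 < t2 ->
  mu.-integrable `[t1, t2] (EFin \o phi i j c xi eta) /\
  hat i j c xi eta t2 - hat i j c xi eta t1 = \int[mu]_(s in `[t1, t2]) phi i j c xi eta s.
Proof.
move=> t10 t12; have [M HM] := g_bound t2 t10.
have [h1 h2] := (@char_increment R A (f i j) (g i j) (@cf i j) (@cg i j)
  (fun x y s s0 => @dfg i j x y s s0) t1 t2 M xi eta c t10 t12
  (fun t t0 => @f_integrable i j t t0) (HM i j)).
split; [exact: h1|exact: h2].
Qed.

Let lip M T : (forall i j t, 0 < t <= T -> L1bound (fun z : TR * TR => f i j z.1 z.2 t) M) ->
  forall i j c xi eta t1 t2, 0 < t1 -> t1 < t2 -> t2 <= T ->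
  `|hat i j c xi eta t2 - hat i j c xi eta t1| <= (2 * rmax xi eta T + 3) * M * (t2 - t1).
Proof.
move=> HM i j c xi eta t1 t2 t10 t12 t2T; have [ip ->] := incr i j c xi eta t10 t12.
apply: le_norm_integral_itv => // s /andP[s1 s2]; apply: (phi_le HM).
by rewrite (lt_le_trans t10 s1) (le_trans s2).
Qed.

Let hat_cont i j c xi eta t : 0 < t -> {for t, continuous (hat i j c xi eta)}.
Proof.
move=> t0; have T0 : 0 < t + 1 by lra.
have [M HM] := f_bound T0.
pose K := (2 * rmax xi eta (t + 1) + 3) * M.
have M0 : 0 <= M.
  have h : 0 < t <= t + 1 by rewrite t0/=; lra.
  exact: le_trans (normr_ge0 _) (hat_le HM ord0 ord0 0 0 0 h).
have K0 : 0 <= K.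
  rewrite mulr_ge0// addr_ge0// mulr_ge0// /rmax addr_ge0 ?sqr_ge0//.
apply/cvgrPdist_le => e e0; near=> s.
have es : `|t - s| <= e / (K + 1).
  by near: s; apply: cvgr_dist_le; [exact: cvg_id|rewrite divr_gt0// ltr_wpDl].
have s0 : 0 < s by near: s; exact: lt_nbhsr.
have sT : s <= t + 1.
  have : `|t - s| <= 1 by near: s; apply: cvgr_dist_le; [exact: cvg_id|exact: ltr01].
  by rewrite ler_norml => /andP[]; lra.
have H : `|hat i j c xi eta t - hat i j c xi eta s| <= K * `|t - s|.
  have [ts|st|->] := ltgtP t s.
  - rewrite distrC [in leRHS]distrC (gtr0_norm (_ : 0 < s - t)) ?subr_gt0//.
    exact: (lip HM).
  - rewrite (gtr0_norm (_ : 0 < t - s)) ?subr_gt0//.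
    by apply: (lip HM) => //; lra.
  - by rewrite !subrr normr0 mulr0.
apply: le_trans H _; apply: (@le_trans _ _ ((K + 1) * (e / (K + 1)))).
  by apply: ler_pM => //; rewrite lerDl.
by rewrite mulrC divfK// gt_eqF// ltr_wpDl.
Unshelve. all: by end_near. Qed.

Let r_cont xi eta : continuous (r xi eta).
Proof.
move=> s; apply: cvgD; first exact: cvg_cst.
have h : eta - A * u * xi @[u --> s] --> eta - A * s * xi.
  apply: cvgB; first exact: cvg_cst.
  by apply: cvgM; [apply: cvgM; [exact: cvg_cst|exact: cvg_id]|exact: cvg_cst].
rewrite expr2; under eq_fun do rewrite expr2.
exact: cvgM.
Qed.

(** A bootstrap: the integrated equation makes [hat] Lipschitz, hence continuous, so the integrand
    [phi] is continuous and [hat] is differentiable with derivative [phi]. *)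
Lemma hat_ode j c xi eta :
  micropolar_ode (fun s => xi ^+ 2 + (eta - A * s * xi) ^+ 2)
    (hat ord0 j c xi eta) (hat ord_max j c xi eta).
Proof.
move=> s s0; rewrite -/(r xi eta s).
have c0 : {for s, continuous (hat ord0 j c xi eta)} by exact: hat_cont.
have c1 : {for s, continuous (hat ord_max j c xi eta)} by exact: hat_cont.
have cr := @r_cont xi eta s.
split.
  rewrite -phi0//; apply: is_derive_primitive => //; first by move=> t1 t2; exact: incr.
  apply: (continuous_near_pos s0 (fun u u0 => esym (phi0 j c xi eta u0))).
  by apply: cvgD; apply: cvgM => //; apply: cvgN.
rewrite -phi1//; apply: is_derive_primitive => //; first by move=> t1 t2; exact: incr.
apply: (continuous_near_pos s0 (fun u u0 => esym (phi1 j c xi eta u0))).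
apply: cvgB => //; apply: cvgM => //; apply: cvgD => //; exact: cvg_cst.
Qed.

Let datum (i j : 'I_2) (c xi eta : R) : R := cos (x0 * xi + y0 * eta + c) *+ (i == j).

Let fcos_init i j c xi eta :
  fcos c (fun z : TR * TR => f i j z.1 z.2 s) xi eta @[s --> 0^'+] --> datum i j c xi eta.
Proof.
pose ph (z : R * R) : R := cos (z.1 * xi + z.2 * eta + c).
have cph : continuous ph.
  move=> z; apply: continuous_comp; last exact: continuous_cos.
  apply: cvgD; last exact: cvg_cst.
  apply: cvgD; apply: cvgM; try exact: cvg_cst.
    exact: cvg_fst.
  exact: cvg_snd.
have bph : exists M : R, forall z, `|ph z| <= M by exists 1 => z; exact: normr_cos_le1.
have E1 : datum i j c xi eta = ((ph (x0, y0))%:M : 'M[R]_2) i j by rewrite mxE.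
have E2 : (fun s => fcos c (fun z : TR * TR => f i j z.1 z.2 s) xi eta) =
    (fun M : 'M[R]_2 => M i j) \o
    (fun s => \matrix_(i, j) (\int[leb2]_z (ph z * F z.1 z.2 s i j))%R).
  by apply/funext => s; rewrite /= mxE.
rewrite E1 E2.
exact: (cvg_comp _ _ (sol_init sol cph bph) (@coord_continuous R 2 2 i j _)).
Qed.

(** The datum is attained at a fixed frequency, whereas in [hat] the frequency moves with time. The
    value at time [s] for [eta] is compared with the value for [eta + A * s * xi], which at time [s]
    is the transform at the fixed frequency [eta], by passing through a small later time [tau]: two
    uniform Lipschitz estimates, continuity in the frequency at time [tau], and the weak limit each
    cost e / 4. *)
Lemma hat_init i j c xi eta :
  hat i j c xi eta s @[s --> 0^'+] --> cos (x0 * xi + y0 * eta + c) *+ (i == j).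
Proof.
rewrite -/(datum i j c xi eta); apply/cvgrPdist_le => e e0.
have [M HM] := f_bound (@ltr01 R).
pose eta' := `|eta| + `|A| * `|xi|.
pose K := (2 * rmax xi eta' 1 + 3) * M.
have M0 : 0 <= M.
  have h : 0 < (1 : R) <= 1 by rewrite ltr01/=.
  exact: le_trans (normr_ge0 _) (hat_le HM ord0 ord0 0 0 0 h).
have eta'0 : 0 <= eta' by rewrite addr_ge0// mulr_ge0.
have K0 : 0 <= K.
  by rewrite mulr_ge0// addr_ge0// mulr_ge0// /rmax addr_ge0 ?sqr_ge0.
have lipK b t1 t2 : `|b| <= eta' -> 0 < t1 -> t1 < t2 -> t2 <= 1 ->
    `|hat i j c xi b t2 - hat i j c xi b t1| <= K * (t2 - t1).
  move=> be t10 t12 t21; apply: le_trans (lip HM i j c xi b t10 t12 t21) _.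
  rewrite ler_wpM2r ?subr_ge0 ?(ltW t12)// ler_wpM2r// lerD2r ler_wpM2l// /rmax lerD2l.
  rewrite ler_pXn2r ?nnegrE ?addr_ge0 ?mulr_ge0// lerD2r.
  by rewrite (ger0_norm eta'0).
pose tau := Num.min 1 (e / 4 / (K + 1)).
have K1 : 0 < K + 1 by rewrite ltr_wpDl.
have tau0 : 0 < tau by rewrite /tau lt_min ltr01/= !divr_gt0.
have tau1 : tau <= 1 by rewrite /tau ge_min lexx.
have Ktau : K * tau <= e / 4.
  apply: (@le_trans _ _ ((K + 1) * (e / 4 / (K + 1)))); last by rewrite mulrC divfK// gt_eqF.
  by apply: ler_pM => //; [exact: ltW|rewrite lerDl|rewrite /tau ge_min lexx orbT].
have cb : fcos c (fun z : TR * TR => f i j z.1 z.2 tau) xi (eta + A * s * xi - A * tau * xi) @[s --> 0^'+]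
   --> fcos c (fun z : TR * TR => f i j z.1 z.2 tau) xi (eta - A * tau * xi).
  apply: cvg_at_right_filter.
  have h : eta + A * s * xi - A * tau * xi @[s --> (0:R)] --> eta - A * tau * xi.
    rewrite -[X in _ --> X - _]addr0; apply: cvgB; last exact: cvg_cst.
    apply: cvgD; first exact: cvg_cst.
    rewrite -[X in _ --> X](_ : A * 0 * xi = 0); last by rewrite mulr0 mul0r.
    by apply: cvgM; [apply: cvgM; [exact: cvg_cst|exact: cvg_id]|exact: cvg_cst].
  exact: (cvg_comp _ _ h (@fcos_continuous R c xi _ (f_integrable i j tau0) _)).
near=> s.
have s0 : 0 < s by [].
have stau : s < tau by near: s; exact: nbhs_right_lt.
have s1 : s <= 1 by exact: le_trans (ltW stau) _.
have d1 : `|datum i j c xi eta - fcos c (fun z : TR * TR => f i j z.1 z.2 s) xi eta| <= e / 4.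
  near: s; have /cvgrPdist_le := @fcos_init i j c xi eta; apply.
  by rewrite divr_gt0.
have d2 : `|fcos c (fun z : TR * TR => f i j z.1 z.2 tau) xi (eta - A * tau * xi) -
   fcos c (fun z : TR * TR => f i j z.1 z.2 tau) xi (eta + A * s * xi - A * tau * xi)| <= e / 4.
  by near: s; move/cvgrPdist_le : cb; apply; rewrite divr_gt0.
have d3 := lipK eta s tau (ler_wpDr (mulr_ge0 (normr_ge0 A) (normr_ge0 xi)) (lexx _)) s0 stau tau1.
have be : `|eta + A * s * xi| <= eta'.
  apply: le_trans (ler_normD _ _) _; rewrite lerD2l !normrM ler_wpM2r//.
  by rewrite (gtr0_norm s0) ler_piMr.
have d4 := lipK (eta + A * s * xi) s tau be s0 stau tau1.
have E : hat i j c xi (eta + A * s * xi) s = fcos c (fun z : TR * TR => f i j z.1 z.2 s) xi eta.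
  by rewrite /hat addrK.
have Ks : K * (tau - s) <= e / 4 by apply: le_trans Ktau; rewrite ler_wpM2l// gerBl ltW.
rewrite E in d4.
rewrite -/(hat i j c xi eta tau) -/(hat i j c xi (eta + A * s * xi) tau) in d2.
move: (datum _ _ _ _ _) (fcos _ _ _ _) d1 d2 d3 d4 => a1 a2.
move: (hat i j c xi eta tau) (hat i j c xi eta s) (hat i j c xi (eta + A * s * xi) tau) => b1 b2 b3.
rewrite !ler_norml => /andP[? ?] /andP[? ?] /andP[? ?] /andP[? ?].
apply/andP; split; lra.
Unshelve. all: by end_near. Qed.

End solution.

(** * Gaussian decay of fourth differences *)

Section polynomial_differences.
Context {R : realType}.

(** Discrete Leibniz rule for an affine factor: its differences beyond the first vanish, which
    leaves two terms. *)
Lemma fdiff_leibniz (h l d : R) (a : nat -> R) n j : h != 0 ->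
  fdiff h (fun i _ => (l + i%:R * h * d) * a i) n j 0 =
  (l + (j + n)%:R * h * d) * fdiff h (fun i _ => a i) n j 0 +
  n%:R * d * fdiff h (fun i _ => a i) n.-1 j 0.
Proof.
move=> h0; elim: n j => [|n IH] j /=; first by rewrite addn0 !mul0r addr0.
rewrite !IH addSnnS.
have -> : ((j + n.+1)%:R : R) = (j + n)%:R + 1 by rewrite addnS -natr1.
have -> : (n.+1%:R : R) = n%:R + 1 by rewrite -natr1.
case: n {IH} => [|n] /=; first by rewrite addn0; field.
rewrite -!natr1; move: (fdiff _ _ n j.+1 0) (fdiff _ _ n j 0) (fdiff _ _ n j.+2 0) => x y z.
by move: (j + n.+1)%:R n%:R => u v; field.
Qed.

(** 9 = 5 + 4: the affine factor is at most [m + 4 <= 5 * m] at indices up to 4, and the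
    first-difference term has coefficient at most 4. *)
Lemma fdiff_mul_bound (h l d m K : R) (a : nat -> R) : h != 0 -> `|h| <= 1 ->
  1 <= m -> `|l| <= m -> `|d| <= 1 -> 0 <= K ->
  (forall n j, (j + n <= 4)%N -> `|fdiff h (fun i _ => a i) n j 0| <= K) ->
  forall n j, (j + n <= 4)%N ->
  `|fdiff h (fun i _ => (l + i%:R * h * d) * a i) n j 0| <= 9 * m * K.
Proof.
move=> h0 h1 m1 lm d1 K0 aK n j nj; rewrite fdiff_leibniz//.
apply: le_trans (ler_normD _ _) _; rewrite !normrM.
have -> : 9 * m * K = 5 * m * K + 4 * m * K by ring.
have nj4 : ((j + n)%:R : R) <= 4 by rewrite ler_nat.
have n4 : (n%:R : R) <= 4 by rewrite ler_nat (leq_trans _ nj)// leq_addl.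
apply: lerD; apply: ler_pM => //; rewrite ?normr_ge0 ?mulr_ge0//.
- apply: le_trans (ler_normD _ _) _.
  have : `|(j + n)%:R * h * d| <= 4.
    rewrite !normrM normr_nat -[leRHS]mulr1; apply: ler_pM; rewrite ?mulr_ge0//.
    by rewrite -[leRHS]mulr1; apply: ler_pM.
  lra.
- exact: aK.
- rewrite normr_nat; apply: (@le_trans _ _ (4 * 1)); first by apply: ler_pM.
  by rewrite ler_wpM2l.
- apply: aK; apply: leq_trans nj; rewrite leq_add2l; exact: leq_pred.
Qed.

Lemma fdiff_poly_bound (h l d l' d' m : R) k1 k2 : h != 0 -> `|h| <= 1 ->
  1 <= m -> `|l| <= m -> `|d| <= 1 -> `|l'| <= m -> `|d'| <= 1 ->
  forall n j, (j + n <= 4)%N ->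
  `|fdiff h (fun i _ => (l + i%:R * h * d) ^+ k1 * (l' + i%:R * h * d') ^+ k2) n j 0|
  <= (9 * m) ^+ (k1 + k2).
Proof.
move=> h0 h1 m1 lm d1 lm' d1'.
have m0 : 0 <= 9 * m by rewrite mulr_ge0// (le_trans _ m1).
elim: k1 => [|k1 IH] n j nj.
  rewrite add0n; elim: k2 n j nj => [|k2 IH] n j nj.
    have -> : (fun (i : nat) (_ : R) => (l + i%:R * h * d) ^+ 0 * (l' + i%:R * h * d') ^+ 0) = (fun _ _ => 1).
      by apply/funext => i; apply/funext => s; rewrite !expr0 mul1r.
    rewrite expr0.
    case: n nj => [|n] nj /=; first by rewrite normr1.
    have E u v : fdiff h (fun i _ => 1 : R) n u 0 = fdiff h (fun i _ => 1) n v 0.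
      by elim: n u v {nj} => [|n IHn] u v //=; rewrite (IHn u.+1 v.+1) (IHn u v).
    by rewrite (E j.+1 j) subrr mul0r normr0 ler01.
  have -> : (fun (i : nat) (_ : R) => (l + i%:R * h * d) ^+ 0 * (l' + i%:R * h * d') ^+ k2.+1) =
     (fun i _ => (l' + i%:R * h * d') * ((l + i%:R * h * d) ^+ 0 * (l' + i%:R * h * d') ^+ k2)).
    by apply/funext => i; apply/funext => s; rewrite exprS !expr0; ring.
  by rewrite exprS; apply: fdiff_mul_bound => //; exact: exprn_ge0.
have -> : (fun (i : nat) (_ : R) => (l + i%:R * h * d) ^+ k1.+1 * (l' + i%:R * h * d') ^+ k2) =
     (fun i _ => (l + i%:R * h * d) * ((l + i%:R * h * d) ^+ k1 * (l' + i%:R * h * d') ^+ k2)).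
  by apply/funext => i; apply/funext => s; rewrite exprS; ring.
by rewrite addSn exprS; apply: fdiff_mul_bound => //; exact: exprn_ge0.
Qed.

(** 1 + u <= N exp (u / N) for N >= 1; the power [k] gives exp (k u / N), and k / N <= c by the
    choice of N. *)
Lemma poly_le_exp (k : nat) (N c u : R) : 0 <= u -> 0 < c -> N = 1 + k%:R / c ->
  (1 + u) ^+ k <= N ^+ k * expR (c * u).
Proof.
move=> u0 c0 NE.
have N1 : 1 <= N by rewrite NE lerDl divr_ge0// ltW.
have N0 : 0 < N by exact: lt_le_trans N1.
have h : 1 + u <= N * expR (u / N).
  apply: (@le_trans _ _ (N * (1 + u / N))).
    by rewrite mulrDr mulr1 mulrCA divff ?gt_eqF// mulr1 lerD2r.
  by rewrite ler_wpM2l ?(ltW N0)// expR_ge1Dx.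
apply: (@le_trans _ _ ((N * expR (u / N)) ^+ k)).
  by apply: lerXn2r; rewrite ?nnegrE ?addr_ge0 ?mulr_ge0 ?expR_ge0// ltW.
rewrite exprMn ler_wpM2l ?exprn_ge0 ?(ltW N0)// -expRM_natl ler_expR.
rewrite mulrA mulrAC ler_wpM2r// ler_pdivrMr// NE mulrDr mulr1.
by rewrite mulrCA divff ?gt_eqF// mulr1 lerDr ltW.
Qed.

End polynomial_differences.

Section spectral.
Context {R : realType}.
Notation is_der f s l := (is_derive (s : R) (1 : R) f l).

Lemma micropolar_ode_scale (r p q : R -> R) (k : R) : micropolar_ode r p q ->
  micropolar_ode r (fun s => k * p s) (fun s => k * q s).
Proof.
move=> ode s s0; have [h1 h2] := ode s s0.
by split; apply: is_derive_eq; rewrite /GRing.scale/=; ring.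
Qed.

Definition rate (A xi eta s : R) := xi ^+ 2 + (eta - A * s * xi) ^+ 2.

Definition rate_prim (A xi eta s : R) :=
  (xi ^+ 2 + eta ^+ 2) * s - A * xi * eta * s ^+ 2 + A ^+ 2 * xi ^+ 2 * s ^+ 3 / 3.

Lemma is_derive_rate_prim A xi eta s : is_der (rate_prim A xi eta) s (rate A xi eta s).
Proof.
rewrite /rate_prim /rate; apply: is_derive_eq; rewrite /GRing.scale/=.
by field.
Qed.

(* W0 and W1 are functions of the initial frequency (xi, eta) and of time. *)
Record spectral_solution (A c0 c1 : R) (W0 W1 : R -> R -> R -> R) : Prop := {
  spec_ode : forall xi eta, micropolar_ode (rate A xi eta) (W0 xi eta) (W1 xi eta);
  spec_init0 : forall xi eta, W0 xi eta s @[s --> 0^'+] --> c0;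
  spec_init1 : forall xi eta, W1 xi eta s @[s --> 0^'+] --> c1;
  spec_data : (c0 - c1) ^+ 2 + c1 ^+ 2 <= 2
}.

Variables (A t : R).
Hypothesis t0 : 0 < t.

Definition shear_len : R := Num.sqrt (1 + (A * t) ^+ 2).
Let L := shear_len.
Let S := Num.sqrt t.

Lemma shear_len_sqr : L ^+ 2 = 1 + (A * t) ^+ 2.
Proof. by rewrite sqr_sqrtr// addr_ge0// sqr_ge0. Qed.
Lemma shear_len_gt0 : 0 < L.
Proof. by rewrite sqrtr_gt0 ltr_pwDl// sqr_ge0. Qed.
Let SS : S ^+ 2 = t. Proof. by rewrite sqr_sqrtr// ltW. Qed.
Let S0 : 0 < S. Proof. by rewrite sqrtr_gt0. Qed.

(* The decay of the transform at time t is Gaussian in alpha and beta; gam is the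
   rescaled dual variable of y (sg = 1) or of y' (sg = 0). *)
Definition alpha (xi : R) := S * L * xi.
Definition beta (xi eta : R) := S * (eta - A * t / 2 * xi).
Definition gam (sg xi eta : R) := S * (eta - sg * (A * t) * xi).

Let weight xi eta := 1 + `|alpha xi| + `|beta xi eta|.

(** [gam] is [beta] plus [alpha] times (1/2 - sg) A t / L, a coefficient of modulus at most 1
    because A t <= L in modulus. *)
Let gam_le sg xi eta : 0 <= sg <= 1 -> `|gam sg xi eta| <= weight xi eta.
Proof.
move=> /andP[s0 s1].
have -> : gam sg xi eta = beta xi eta + (1 / 2 - sg) * (A * t / L) * alpha xi.
  by rewrite /gam /beta /alpha; field; rewrite gt_eqF// shear_len_gt0.
have k1 : `|A * t / L| <= 1.
  rewrite normrM normfV (gtr0_norm shear_len_gt0) ler_pdivrMr ?shear_len_gt0// mul1r.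
  rewrite -[leRHS](ger0_norm (ltW shear_len_gt0)) -ler_sqr ?nnegrE//.
  by rewrite !real_normK ?num_real// shear_len_sqr lerDr.
apply: le_trans (ler_normD _ _) _; rewrite /weight addrC lerD2r [leLHS]normrM.
apply: (@le_trans _ _ `|alpha xi|); last by rewrite lerDr.
rewrite ler_piMl// normrM mulr_ile1//.
by rewrite ler_norml; apply/andP; split; lra.
Qed.

(** The mean of (eta - A s xi)^2 over 0 <= s <= t is the square of the midpoint value plus the
    variance (A t xi)^2 / 12. This is the origin of the slope A t / 2 in [beta] and of the constant
    12. *)
Let exponent xi eta : (alpha xi ^+ 2 + beta xi eta ^+ 2) / 12 <= rate_prim A xi eta t - rate_prim A xi eta 0.
Proof.
have -> : rate_prim A xi eta t - rate_prim A xi eta 0 =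
   t * (xi ^+ 2 + (eta - A * t / 2 * xi) ^+ 2 + (A * t) ^+ 2 * xi ^+ 2 / 12).
  by rewrite /rate_prim; field.
rewrite /alpha /beta ![(S * _) ^+ 2]exprMn [(_ * xi) ^+ 2]exprMn [(S * L) ^+ 2]exprMn SS shear_len_sqr.
have h1 := mulr_ge0 (ltW t0) (sqr_ge0 xi).
have h2 := mulr_ge0 (ltW t0) (sqr_ge0 (eta - A * t / 2 * xi)).
move: (xi ^+ 2) ((eta - A * t / 2 * xi) ^+ 2) ((A * t) ^+ 2) h1 h2 => a b c h1 h2.
have -> : (t * (1 + c) * a + t * b) / 12 = (t * a) / 12 + (t * b) / 12 + t * (c * a / 12) by field.
rewrite !mulrDr; lra.
Qed.

(* The factor 27 (1 + 192 k) is what it costs to absorb a polynomial of degree k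
   into a part of the Gaussian. *)
Definition spec_const (k : nat) : R :=
  Num.sqrt (20 * expR growth_const) * (27 * (1 + k%:R / 192^-1)) ^+ k.

Definition spec_gauss (xi eta : R) := gauss_fun (alpha xi / 16) * gauss_fun (beta xi eta / 16).

Lemma spec_const_ge0 k : 0 <= spec_const k.
Proof.
by rewrite mulr_ge0 ?sqrtr_ge0// exprn_ge0// mulr_ge0// addr_ge0// divr_ge0// invr_ge0.
Qed.

(** With u = alpha^2 + beta^2, the energy decays like exp (- u / 48), its root like exp (- u / 96).
    The polynomial weight uses up exp (u / 192), and the remaining exp (- u / 192) is at most exp (-
    u / 256), which is [spec_gauss]. *)
Let from_energy (k : nat) (E xi eta : R) :
  E <= 20 * expR growth_const * ((9 * weight xi eta) ^+ k) ^+ 2 *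
    expR (- ((rate_prim A xi eta t - rate_prim A xi eta 0) / 4)) ->
  Num.sqrt E <= spec_const k * spec_gauss xi eta.
Proof.
move=> hE.
pose u := alpha xi ^+ 2 + beta xi eta ^+ 2.
have u0 : 0 <= u by rewrite addr_ge0 ?sqr_ge0.
have w1 : 1 <= weight xi eta by rewrite /weight -addrA lerDl addr_ge0.
have w0 : 0 <= weight xi eta by exact: le_trans w1.
have wu : weight xi eta <= 3 * (1 + u).
  apply: (@le_trans _ _ (weight xi eta ^+ 2)); first by rewrite expr2 ler_peMr.
  rewrite /weight /u -[alpha xi ^+ 2]real_normK ?num_real// -[beta xi eta ^+ 2]real_normK ?num_real//.
  move: `|alpha xi| `|beta xi eta| => a b.
  have := sqr_ge0 (1 - a); have := sqr_ge0 (1 - b); have := sqr_ge0 (a - b).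
  have -> : (1 + a + b) ^+ 2 = 3 * (1 + (a ^+ 2 + b ^+ 2)) - (1 - a) ^+ 2 - (1 - b) ^+ 2 - (a - b) ^+ 2 by ring.
  lra.
have c0 : 0 < 192^-1 :> R by rewrite invr_gt0.
have pe := poly_le_exp u0 c0 (erefl (1 + k%:R / 192^-1)).
have wk : (9 * weight xi eta) ^+ k <= (27 * (1 + k%:R / 192^-1)) ^+ k * expR (u / 192).
  apply: (@le_trans _ _ (27 ^+ k * (1 + u) ^+ k)).
    have u1 : 0 <= 1 + u by rewrite addr_ge0.
    rewrite -exprMn; apply: lerXn2r; rewrite ?nnegrE ?mulr_ge0//.
    have -> : 27 * (1 + u) = 9 * (3 * (1 + u)) by ring.
    by rewrite ler_wpM2l.
  by rewrite exprMn -mulrA ler_wpM2l ?exprn_ge0// [u / _]mulrC.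
have wk0 : 0 <= (9 * weight xi eta) ^+ k by rewrite exprn_ge0// mulr_ge0.
have e1 : expR (- ((rate_prim A xi eta t - rate_prim A xi eta 0) / 4)) <= expR (- (u / 96)) ^+ 2.
  rewrite expr2 -expRD ler_expR.
  have := exponent xi eta; rewrite -/u; move: (rate_prim _ _ _ _ - _) => x; lra.
have -> : spec_const k * spec_gauss xi eta = Num.sqrt ((spec_const k * spec_gauss xi eta) ^+ 2).
  by rewrite sqrtr_sqr ger0_norm// mulr_ge0 ?spec_const_ge0// /spec_gauss mulr_ge0 ?gauss_fun_ge0.
apply: ler_wsqrtr; apply: le_trans hE _.
have K0 : 0 <= 20 * expR growth_const :> R by rewrite mulr_ge0 ?expR_ge0.
rewrite /spec_const -[_ * _ * spec_gauss _ _]mulrA [leRHS]exprMn sqr_sqrtr//.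
have gE : spec_gauss xi eta = expR (- (u / 256)).
  by rewrite /spec_gauss /gauss_fun -expRD /u; congr expR; field.
rewrite {}gE -[leLHS]mulrA ler_wpM2l//.
apply: (@le_trans _ _ (((9 * weight xi eta) ^+ k * expR (- (u / 96))) ^+ 2)).
  by rewrite [leRHS]exprMn ler_wpM2l// sqr_ge0.
apply: lerXn2r; rewrite ?nnegrE; [exact: mulr_ge0 wk0 (expR_ge0 _)| |].
  by apply: mulr_ge0 (expR_ge0 _); apply: exprn_ge0; apply: mulr_ge0.
apply: (@le_trans _ _ ((27 * (1 + k%:R / 192^-1)) ^+ k * expR (u / 192) * expR (- (u / 96)))).
  by rewrite ler_wpM2r ?expR_ge0.
rewrite -mulrA ler_wpM2l//.
rewrite -expRD ler_expR; lra.
Qed.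

Variables (c0 c1 : R) (W0 W1 : R -> R -> R -> R).
Hypothesis spec : spectral_solution A c0 c1 W0 W1.
Variables (k1 k2 : nat) (sg : R).
Hypothesis sg01 : 0 <= sg <= 1.

(** The Fourier factor of a derivative of orders [k1] and [k2], rescaled so that a step of the
    frequency changes each base by at most 1. *)
Definition poly_weight (xi eta : R) := alpha xi ^+ k1 * gam sg xi eta ^+ k2.

(** The weight does not depend on time, so weighted solutions solve the same systems, with the
    weight as datum, and [difference_decay] applies to them. A step [(v1, v2)] is admissible if its
    own rate stays below 1 / t and both bases of the weight vary by at most 1 along it. *)
Lemma spectral_difference (v1 v2 h : R) : h != 0 -> -1 <= h <= 1 ->
  (forall s, 0 < s <= t -> v1 ^+ 2 + (v2 - A * s * v1) ^+ 2 <= t^-1) ->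
  `|alpha v1| <= 1 -> `|gam sg v1 v2| <= 1 ->
  forall n, n = 0%N \/ n = 4%N -> forall xi eta,
  let Q W j (s : R) := poly_weight (xi + j%:R * h * v1) (eta + j%:R * h * v2) *
    W (xi + j%:R * h * v1) (eta + j%:R * h * v2) s in
  `|fdiff h (Q W0) n 0 t| <= spec_const (k1 + k2) * spec_gauss xi eta /\
  `|fdiff h (Q W1) n 0 t| <= spec_const (k1 + k2) * spec_gauss xi eta.
Proof.
move=> h0 h1 kap_le av gv n n04 xi eta Q.
(* The bilinear form of the rate between the frequency and the step; [D3] below is the
   Cauchy-Schwarz inequality. *)
pose rho s := xi * v1 + (eta - A * s * xi) * (v2 - A * s * v1).
pose kap s := v1 ^+ 2 + (v2 - A * s * v1) ^+ 2.
have nh1 : `|h| <= 1 by rewrite ler_norml.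
have kap0 s : 0 <= kap s by rewrite addr_ge0 ?sqr_ge0.
have w1 : 1 <= weight xi eta by rewrite /weight -addrA lerDl addr_ge0.
pose a (j : nat) := poly_weight (xi + j%:R * h * v1) (eta + j%:R * h * v2).
have aE : (fun (j : nat) (_ : R) => a j) = (fun i _ =>
    (alpha xi + i%:R * h * alpha v1) ^+ k1 * (gam sg xi eta + i%:R * h * gam sg v1 v2) ^+ k2).
  apply/funext => j; apply/funext => _; rewrite /a /poly_weight.
  by congr (_ ^+ _ * _ ^+ _); rewrite /alpha /gam; ring.
have := @difference_decay R h t c0 c1 (((9 * weight xi eta) ^+ (k1 + k2)) ^+ 2)
  (rate A xi eta) rho kap (rate_prim A xi eta) (Q W0) (Q W1) a t0 h0 h1.
have D1 s : 0 < s <= t -> 0 <= rate A xi eta s by rewrite addr_ge0 ?sqr_ge0.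
have D2 s : 0 < s <= t -> 0 <= kap s <= t^-1 by move=> st; rewrite kap0 kap_le.
have D3 s : 0 < s <= t -> rho s ^+ 2 <= rate A xi eta s * kap s.
  move=> _; rewrite /rho /rate /kap; move: (eta - A * s * xi) (v2 - A * s * v1) => b d.
  have := sqr_ge0 (xi * d - b * v1).
  have -> : (xi ^+ 2 + b ^+ 2) * (v1 ^+ 2 + d ^+ 2) = (xi * v1 + b * d) ^+ 2 + (xi * d - b * v1) ^+ 2 by ring.
  lra.
have D4 s : 0 < s <= t -> is_der (rate_prim A xi eta) s (rate A xi eta s).
  by move=> _; exact: is_derive_rate_prim.
have D5 : rate_prim A xi eta s @[s --> 0^'+] --> rate_prim A xi eta 0.
  apply: cvg_at_right_filter; apply/differentiable_continuous/derivable1_diffP.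
  by have [] := is_derive_rate_prim A xi eta 0.
have D6 j : micropolar_ode (shifted_rate h (rate A xi eta) rho kap j%:R) (Q W0 j) (Q W1 j).
  have -> : shifted_rate h (rate A xi eta) rho kap j%:R = rate A (xi + j%:R * h * v1) (eta + j%:R * h * v2).
    by apply/funext => s; rewrite /shifted_rate /rate /rho /kap; ring.
  exact: (micropolar_ode_scale _ (spec_ode spec _ _)).
have D7 j : Q W0 j s @[s --> 0^'+] --> a j * c0.
  by apply: cvgM; [exact: cvg_cst|exact: (spec_init0 spec)].
have D8 j : Q W1 j s @[s --> 0^'+] --> a j * c1.
  by apply: cvgM; [exact: cvg_cst|exact: (spec_init1 spec)].
have D9 i : (i <= 4)%N -> fdiff h (fun j _ => a j) i 0 0 ^+ 2 <= ((9 * weight xi eta) ^+ (k1 + k2)) ^+ 2.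
  move=> i4; rewrite aE -real_normK ?num_real// ler_pXn2r ?nnegrE ?normr_ge0 ?exprn_ge0 ?mulr_ge0 ?(le_trans _ w1)//.
  apply: fdiff_poly_bound => //.
    by rewrite /weight addrAC lerDr addr_ge0.
  exact: gam_le.
move=> /(_ D1 D2 D3 D4 D5 D6 D7 D8 (spec_data spec) D9 n n04).
move: (fdiff h (Q W0) n 0 t) (fdiff h (Q W1) n 0 t) => p q.
set E := 10 * _ * _ * _ => le.
(* Returning from (p - q, q) to (p, q) costs a factor 2, which turns 10 into 20. *)
have q2 : q ^+ 2 <= 2 * E by have := sqr_ge0 (p - q); have := sqr_ge0 q; lra.
have p2 : p ^+ 2 <= 2 * E.
  have := sqr_ge0 (p - q - q).
  have -> : (p - q - q) ^+ 2 = 2 * (p - q) ^+ 2 + 2 * q ^+ 2 - p ^+ 2 by ring.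
  lra.
have E2 : 2 * E = 20 * expR growth_const * ((9 * weight xi eta) ^+ (k1 + k2)) ^+ 2 *
    expR (- ((rate_prim A xi eta t - rate_prim A xi eta 0) / 4)).
  by rewrite /E; ring.
rewrite E2 in p2 q2.
by split; rewrite -sqrtr_sqr; exact: from_energy.
Qed.

End spectral.

(** * Decay of the kernel *)

Section oscillation.
Context {R : realType}.
Notation TR := (measurableTypeR R).

(* Translating by half a period of the cosine flips its sign, so a fourth
   difference of V can be traded for a factor 16. *)
Lemma fcos_decay (c a b v1 v2 K : R) (V g : TR * TR -> R) :
  leb2.-integrable setT (EFin \o V) -> leb2.-integrable setT (EFin \o g) ->
  0 <= K ->
  (forall z, `|V z| <= K * g z) ->
  (forall h, h != 0 -> -1 <= h <= 1 -> forall z : TR * TR,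
    `|fdiff h (fun j _ => V ((z.1 : R) + j%:R * h * v1, (z.2 : R) + j%:R * h * v2)%R) 4 0 0| <= K * g z) ->
  `|fcos c V a b| * (a * v1 + b * v2) ^+ 4 <= pi ^+ 4 * (K * (\int[leb2]_z g z)%R).
Proof.
move=> Vi gi K0 Vg D4.
pose X := a * v1 + b * v2; rewrite -/X.
have mV : measurable_fun setT V by apply/measurable_EFinP; exact: measurable_int Vi.
have Kgi : leb2.-integrable setT (EFin \o (fun z => K * g z)) by exact: integrable_scale.
have IE : (\int[leb2]_z (K * g z))%R = K * (\int[leb2]_z g z)%R.
  by rewrite RintegralZl.
rewrite -IE.
have f_le : `|fcos c V a b| <= (\int[leb2]_z (K * g z))%R.
  apply: le_norm_Rintegral => //; first exact: fcos_integrable.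
  by move=> z; rewrite normrM; apply: le_trans (Vg z); rewrite ler_piMl// normr_cos_le1.
have X4 : X ^+ 4 = `|X| ^+ 4 by rewrite -normrX ger0_norm// exprn_even_ge0.
(* For |X| <= pi the bound without oscillation suffices. *)
have [Xpi|piX] := lerP `|X| pi.
  rewrite mulrC X4; apply: ler_pM => //; rewrite ?exprn_ge0//.
  by apply: lerXn2r; rewrite ?nnegrE ?normr_ge0 ?pi_ge0.
have X0 : X != 0 by rewrite -normr_gt0 (le_lt_trans _ piX)// pi_ge0.
(* Translation by [h] times the step advances the phase by pi, and |h| <= 1 because |X| > pi. *)
pose h := pi / X.
have h0 : h != 0 by rewrite mulf_neq0 ?invr_neq0// gt_eqF// pi_gt0.
have h1 : -1 <= h <= 1.
  rewrite -ler_norml normrM normfV (ger0_norm (pi_ge0 R)) ler_pdivrMr ?normr_gt0// mul1r.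
  exact: ltW.
pose Vj (j : nat) (z : TR * TR) := V ((z.1 : R) + j%:R * h * v1, (z.2 : R) + j%:R * h * v2)%R.
pose cs (z : TR * TR) : R := cos (z.1 * a + z.2 * b + c).
have mcs : measurable_fun setT (cs : TR * TR -> TR) by exact: measurable_phase.
have Vji j : leb2.-integrable setT (EFin \o Vj j).
  exact: (preserving_integrable (preserving_shift (j%:R * h * v1) (j%:R * h * v2)) Vi).
have csVji j : leb2.-integrable setT (EFin \o (fun z => cs z * Vj j z)).
  by apply: (@integrable_bounded _ _ _ _ _ _ 1) => // z; exact: normr_cos_le1.
have sgn j : fcos c V a b = (-1) ^+ j * (\int[leb2]_z (cs z * Vj j z))%R.
  rewrite -RintegralZl// /fcos.
  rewrite -[LHS](preserving_integral (preserving_shift (j%:R * h * v1) (j%:R * h * v2)))//; last first.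
    exact: measurable_funM.
  apply: eq_Rintegral => z _ /=; rewrite mulrA; congr (_ * _); rewrite /cs.
  have -> : (z.1 + j%:R * h * v1) * a + (z.2 + j%:R * h * v2) * b + c =
     z.1 * a + z.2 * b + c + j%:R * pi.
    by rewrite /h /X; move: X0; rewrite /X => X0; field.
  elim: j {Vji csVji} => [|j IH]; first by rewrite mul0r addr0 expr0 mul1r.
  by rewrite -natr1 mulrDl mul1r addrA cosDpi IH exprS mulN1r mulNr.
(* The signs of the translated integrals match those of the binomial coefficients, so all five add
   up: 1 + 4 + 6 + 4 + 1 = 16. *)
pose D z := Vj 4%N z + (- 4 * Vj 3%N z + (6 * Vj 2%N z + (- 4 * Vj 1%N z + Vj 0%N z))).
have csD : (\int[leb2]_z (cs z * D z))%R = 16 * fcos c V a b.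
  have -> : (fun z => cs z * D z) = (fun z => cs z * Vj 4%N z + (- 4 * (cs z * Vj 3%N z) +
     (6 * (cs z * Vj 2%N z) + (- 4 * (cs z * Vj 1%N z) + cs z * Vj 0%N z)))).
    by apply/funext => z; rewrite /D; ring.
  do 3 (rewrite RintegralD//; [|by repeat (apply: integrable_add || apply: integrable_scale)..]).
  rewrite RintegralD//; [|by repeat (apply: integrable_add || apply: integrable_scale)..].
  rewrite !RintegralZl//.
  have := sgn 4%N; have := sgn 3%N; have := sgn 2%N; have := sgn 1%N; have := sgn 0%N.
  rewrite !exprS !expr0; lra.
have Di : leb2.-integrable setT (EFin \o (fun z => cs z * D z)).
  apply: (@integrable_bounded _ _ _ _ _ _ 1) => //.
    by move=> z; exact: normr_cos_le1.
  by repeat (apply: integrable_add || apply: integrable_scale).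
have DE z : D z = h ^+ 4 * fdiff h (fun j _ => V ((z.1 : R) + j%:R * h * v1, (z.2 : R) + j%:R * h * v2)%R) 4 0 0.
  rewrite /fdiff -!/(Vj _ z) /D.
  by move: (Vj 4%N z) (Vj 3%N z) (Vj 2%N z) (Vj 1%N z) (Vj 0%N z) => x4 x3 x2 x1 x0; field.
have le16 : `|16 * fcos c V a b| <= h ^+ 4 * (\int[leb2]_z (K * g z))%R.
  rewrite -csD -RintegralZl//; apply: le_norm_Rintegral => //; first exact: integrable_scale.
  move=> z; rewrite normrM; apply: (@le_trans _ _ `|D z|).
    by rewrite ler_piMl// normr_cos_le1.
  rewrite DE normrM ger0_norm ?exprn_even_ge0// ler_wpM2l ?exprn_even_ge0//.
  exact: D4.
have Xp : 0 < X ^+ 4 by rewrite exprn_even_gt0.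
rewrite -ler_pdivlMr//.
have -> : pi ^+ 4 * (\int[leb2]_z (K * g z))%R / X ^+ 4 = h ^+ 4 * (\int[leb2]_z (K * g z))%R.
  by rewrite /h; field.
apply: le_trans le16; rewrite normrM ger0_norm// ler_peMl//; lra.
Qed.

End oscillation.

Section spectral_kernel.
Context {R : realType}.
Notation TR := (measurableTypeR R).
Notation mu := (@lebesgue_measure R).
Variables (A t : R).
Hypothesis t0 : 0 < t.
Let L := shear_len A t.
Let S := Num.sqrt t.
Let L0 : 0 < L. Proof. exact: shear_len_gt0. Qed.
Let S0 : 0 < S. Proof. by rewrite sqrtr_gt0. Qed.
Let SS : S ^+ 2 = t. Proof. by rewrite sqr_sqrtr// ltW. Qed.

Let g (z : TR * TR) : R := spec_gauss A t z.1 z.2.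

Let gE z : g z = gauss_fun (((z.1 : R) - 0) / (16 / (S * L))) *
   gauss_fun (((z.2 : R) - A * t / 2 * z.1) / (16 / S)).
Proof.
rewrite /g /spec_gauss /alpha /beta -/S -/L; have S1 := lt0r_neq0 S0; have L1 := lt0r_neq0 L0.
by congr (gauss_fun _ * gauss_fun _); field; rewrite ?S1 ?L1.
Qed.

Let g0 z : 0 <= g z. Proof. by rewrite mulr_ge0 ?gauss_fun_ge0. Qed.

Let mg : measurable_fun setT (g : TR * TR -> TR).
Proof.
rewrite /g /spec_gauss /alpha /beta; apply: measurable_funM; apply: measurableT_comp => //.
- exact: measurable_gauss_fun.
- by apply: measurable_funM => //; apply: measurable_funM.
- exact: measurable_gauss_fun.
- apply: measurable_funM => //; apply: measurable_funM => //; apply: measurable_funB => //.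
  by apply: measurable_funM.
Qed.

Let g_int : (\int[leb2]_z (g z)%:E = (256 * pi / (t * L))%:E)%E.
Proof.
have a0 : 0 < 16 / (S * L) by rewrite divr_gt0// mulr_gt0.
have b0 : 0 < 16 / S by rewrite divr_gt0.
rewrite /leb2 fubini_tonelli1//; last exact/measurable_EFinP.
rewrite /fubini_F/=.
have inner (x : TR) : (\int[mu]_y (g (x, y))%:E = (16 / S * Num.sqrt pi)%:E *
    (gauss_fun (((x : R) - 0) / (16 / (S * L))))%:E)%E.
  under eq_integral => y _ do rewrite gE EFinM /=.
  rewrite ge0_integralZl//; last 3 first.
  - apply/measurable_EFinP; exact: measurable_gauss_scaled.
  - by move=> y _; rewrite lee_fin gauss_fun_ge0.
  - by rewrite lee_fin gauss_fun_ge0.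
  by rewrite integral_gauss_scaled// muleC.
under eq_integral do rewrite inner.
rewrite ge0_integralZl//; last 3 first.
- apply/measurable_EFinP; exact: measurable_gauss_scaled.
- by move=> y _; rewrite lee_fin gauss_fun_ge0.
- by rewrite lee_fin mulr_ge0 ?sqrtr_ge0 ?ltW.
rewrite integral_gauss_scaled// -EFinM; congr EFin.
have pi2 := sqr_sqrtr (pi_ge0 R); rewrite -SS -[in RHS]pi2.
have S1 := lt0r_neq0 S0; have L1 := lt0r_neq0 L0.
by field; rewrite S1 L1.
Qed.

Lemma integrable_spec_gauss :
  leb2.-integrable setT (EFin \o (fun z : TR * TR => spec_gauss A t z.1 z.2)).
Proof.
apply/integrableP; split; first exact/measurable_EFinP.
under eq_integral do rewrite /= ger0_norm ?g0//.
by rewrite g_int ltry.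
Qed.

Lemma integral_spec_gauss :
  (\int[leb2]_z (spec_gauss A t z.1 z.2))%R = 256 * pi / (t * L).
Proof. by rewrite /Rintegral g_int. Qed.

Variables (c0 c1 : R) (W0 W1 : R -> R -> R -> R).
Hypothesis spec : spectral_solution A c0 c1 W0 W1.
Variables (k1 k2 : nat) (sg : R).
Hypothesis sg01 : 0 <= sg <= 1.

(* The pairings of (X, Y) with the steps (1, A t / 2) / (sqrt t L) and
   (0, 1 / sqrt t), along which the rate changes by at most 1 / t. *)
Definition shear_coord1 (X Y : R) := (X + Y * (A * t / 2)) / (S * L).
Definition shear_coord2 (Y : R) := Y / S.

Let V (W : R -> R -> R -> R) (z : TR * TR) : R :=
  poly_weight A t k1 k2 sg z.1 z.2 * W z.1 z.2 t.

Let mpw : measurable_fun setT (fun z : TR * TR => poly_weight A t k1 k2 sg z.1 z.2 : TR).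
Proof.
rewrite /poly_weight /alpha /gam; apply: measurable_funM; apply: measurable_funX.
  by apply: measurable_funM.
by apply: measurable_funM => //; apply: measurable_funB => //; apply: measurable_funM.
Qed.

(** The difference of order zero, taken along the null step. *)
Lemma spectral_bound W : W = W0 \/ W = W1 -> forall xi eta,
  `|poly_weight A t k1 k2 sg xi eta * W xi eta t| <= spec_const (k1 + k2) * spec_gauss A t xi eta.
Proof.
move=> WE xi eta.
have := @spectral_difference R A t t0 c0 c1 W0 W1 spec k1 k2 sg sg01 0 0 1.
rewrite oner_eq0 lexx andbT /alpha /gam.
have -> : -1 <= 1 :> R by lra.
move=> /(_ erefl erefl).
move=> H; have [] := H _ _ _ 0%N _ xi eta.
- by move=> s _; rewrite mulr0 subr0 expr0n/= addr0 invr_ge0 ltW.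
- by rewrite mulr0 normr0.
- by rewrite !mulr0 subr0 mulr0 normr0.
- by left.
by move=> {H}; case: WE => ->; rewrite /= !mul0r !addr0.
Qed.

Lemma spectral_integrable W : W = W0 \/ W = W1 ->
  measurable_fun setT (fun z : TR * TR => W z.1 z.2 t : TR) ->
  leb2.-integrable setT (EFin \o (fun z : TR * TR =>
    poly_weight A t k1 k2 sg z.1 z.2 * W z.1 z.2 t)).
Proof.
move=> WE mW; apply: (@integrable_dom _ _ _ _ _ (fun z => spec_const (k1 + k2) * g z)).
- exact: measurable_funM.
- by move=> z; exact: spectral_bound.
- by apply: integrable_scale; exact: integrable_spec_gauss.
Qed.

(** [fcos_decay] along the two steps bounds the integral times a^4 and times b^4, where a and b are
    the two shear coordinates; the trivial bound controls the integral itself. They combine by (1 +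
    a^2) (1 + b^2) <= 2 + a^4 + b^4, which gives 2 + 2 pi^4. *)
Lemma spectral_kernel_bound W : W = W0 \/ W = W1 ->
  measurable_fun setT (fun z : TR * TR => W z.1 z.2 t : TR) -> forall c X Y,
  `|fcos c (fun z : TR * TR => poly_weight A t k1 k2 sg z.1 z.2 * W z.1 z.2 t) X Y| <=
  (2 + 2 * pi ^+ 4) * (spec_const (k1 + k2) * (256 * pi / (t * L))) *
   ((1 + shear_coord1 X Y ^+ 2)^-1 * (1 + shear_coord2 Y ^+ 2)^-1).
Proof.
move=> WE mW c X Y; rewrite -integral_spec_gauss.
have Vi := spectral_integrable WE mW.
have S1 := lt0r_neq0 S0; have L1 := lt0r_neq0 L0.
have D v1 v2 :
  (forall s, 0 < s <= t -> v1 ^+ 2 + (v2 - A * s * v1) ^+ 2 <= t^-1) ->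
  `|alpha A t v1| <= 1 -> `|gam A t sg v1 v2| <= 1 ->
  `|fcos c (V W) X Y| * (X * v1 + Y * v2) ^+ 4 <=
    pi ^+ 4 * (spec_const (k1 + k2) * (\int[leb2]_z (g z))%R).
  move=> kap_le av gv; apply: fcos_decay => //.
  - exact: integrable_spec_gauss.
  - exact: spec_const_ge0.
  - by move=> z; exact: spectral_bound.
  - move=> h h0 h1 z.
    have [b0 b1] := @spectral_difference R A t t0 c0 c1 W0 W1 spec k1 k2 sg sg01 v1 v2 h h0 h1
       kap_le av gv 4%N (or_intror erefl) z.1 z.2.
    by case: WE => E; rewrite /V E; [exact: b0|exact: b1].
have L2 : L ^+ 2 = 1 + (A * t) ^+ 2 by exact: shear_len_sqr.
have SL : S * L != 0 by rewrite mulf_neq0.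
have atL : `|A * t / L| <= 1.
  rewrite normrM normfV (gtr0_norm L0) ler_pdivrMr// mul1r.
  rewrite -[leRHS](ger0_norm (ltW L0)) -ler_sqr ?nnegrE//.
  by rewrite !real_normK ?num_real// L2 lerDr.
have D1 := D (S * L)^-1 (A * t / 2 / (S * L)).
have D2 := D 0 S^-1.
have {D2} : `|fcos c (V W) X Y| * shear_coord2 Y ^+ 4 <=
    pi ^+ 4 * (spec_const (k1 + k2) * (\int[leb2]_z (g z))%R).
  move: D2; rewrite mulr0 add0r -/(shear_coord2 Y); apply.
  - by move=> s _; rewrite mulr0 subr0 expr0n/= add0r exprVn SS.
  - by rewrite /alpha mulr0 normr0.
  - by rewrite /gam mulr0 subr0 divff// normr1.
have {D1} : `|fcos c (V W) X Y| * shear_coord1 X Y ^+ 4 <=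
    pi ^+ 4 * (spec_const (k1 + k2) * (\int[leb2]_z (g z))%R).
  have -> : shear_coord1 X Y = X * (S * L)^-1 + Y * (A * t / 2 / (S * L)).
    by rewrite /shear_coord1 -/S -/L; field; rewrite S1 L1.
  apply: D1.
  - move=> s /andP[s0 st].
    (* The drifting component of this step vanishes at s = t / 2; as |t / 2 - s| <= t / 2 on (0, t],
       its rate stays below 1 / t. *)
    have -> : (S * L)^-1 ^+ 2 + (A * t / 2 / (S * L) - A * s / (S * L)) ^+ 2 =
       (1 + A ^+ 2 * (t / 2 - s) ^+ 2) / (t * L ^+ 2).
      by rewrite -SS; field; rewrite S1 L1.
    rewrite invfM mulrCA ler_piMr ?invr_ge0 ?(ltW t0)//.
    rewrite ler_pdivrMr ?exprn_gt0// mul1r L2 lerD2l exprMn ler_wpM2l ?sqr_ge0//.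
    have : 0 <= s * (t - s) by rewrite mulr_ge0 ?(ltW s0)// subr_ge0.
    have := sqr_ge0 t; have -> : (t / 2 - s) ^+ 2 = t ^+ 2 / 4 - s * (t - s) by field.
    lra.
  - by rewrite /alpha -/S -/L divff// normr1.
  - have -> : gam A t sg (S * L)^-1 (A * t / 2 / (S * L)) = (1 / 2 - sg) * (A * t / L).
      by rewrite /gam -/S; field; rewrite S1 L1.
    rewrite normrM mulr_ile1//.
    by case/andP: sg01 => *; rewrite ler_norml; apply/andP; split; lra.
have : `|fcos c (V W) X Y| <= spec_const (k1 + k2) * (\int[leb2]_z (g z))%R.
  rewrite -RintegralZl//; last exact: integrable_spec_gauss.
  apply: le_norm_Rintegral.
  - exact: fcos_integrable.
  - by apply: integrable_scale; exact: integrable_spec_gauss.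
  - move=> z; rewrite normrM; apply: le_trans (spectral_bound WE z.1 z.2).
    by rewrite ler_piMl// normr_cos_le1.
rewrite -/(V W) -/g -invfM.
have p0 : 0 < (1 + shear_coord1 X Y ^+ 2) * (1 + shear_coord2 Y ^+ 2).
  by rewrite mulr_gt0// ltr_pwDl// sqr_ge0.
rewrite ler_pdivlMr//.
move: (spec_const _ * _) `|fcos c (V W) X Y| (normr_ge0 (fcos c (V W) X Y)) (shear_coord1 X Y) (shear_coord2 Y) => B f f0 a b h1 h2 h3.
have h4 : f * ((1 + a ^+ 2) * (1 + b ^+ 2)) <= f * (2 + a ^+ 4 + b ^+ 4).
  rewrite ler_wpM2l//.
  have := sqr_ge0 (a ^+ 2 - 1); have := sqr_ge0 (b ^+ 2 - 1); have := sqr_ge0 (a ^+ 2 - b ^+ 2).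
  have -> : (a ^+ 2 - b ^+ 2) ^+ 2 = a ^+ 4 - 2 * (a ^+ 2 * b ^+ 2) + b ^+ 4 by ring.
  have -> : (a ^+ 2 - 1) ^+ 2 = a ^+ 4 - 2 * a ^+ 2 + 1 by ring.
  have -> : (b ^+ 2 - 1) ^+ 2 = b ^+ 4 - 2 * b ^+ 2 + 1 by ring.
  have -> : (1 + a ^+ 2) * (1 + b ^+ 2) = 1 + a ^+ 2 + b ^+ 2 + a ^+ 2 * b ^+ 2 by ring.
  lra.
apply: le_trans h4 _; rewrite !mulrDr mulrDl -!mulrA; lra.
Qed.

End spectral_kernel.

(** * Differentiation of the kernel *)

Section smooth_families.
Context {R : realType}.

(** Matrices are differentiated entry by entry, and a family closed under both derivatives
    identifies all iterated ones, existence included. *)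
Lemma partial_family (k : nat -> nat -> R -> R -> 'M[R]_2) (k1 k2 : nat) :
  (forall m1 m2 u v i j, is_derive u (1 : R) (fun w => k m1 m2 w v i j) (k m1.+1 m2 u v i j)) ->
  (forall m1 m2 u v i j, is_derive v (1 : R) (fun w => k m1 m2 u w i j) (k m1 m2.+1 u v i j)) ->
  has_partial k1 k2 (k 0%N 0%N) /\
  forall u v, partial k1 k2 (k 0%N 0%N) u v = k k1 k2 u v.
Proof.
move=> d1 d2.
have D (f f' : R -> 'M[R]_2) : (forall u i j, is_derive u (1 : R) (fun w => f w i j) (f' u i j)) ->
    (forall u, derivable f u 1) /\ derive1 f = f'.
  move=> ff'; have df u : derivable f u 1.
    by apply/derivable_mxP => i j; have [] := ff' u i j.
  split => //; apply/funext => u; apply/matrixP => i j.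
  by rewrite derive1E (derive_mx (df u)) mxE; have [_ ->] := ff' u i j.
have D2 m1 m2 u : (forall v, derivable (k m1 m2 u) v 1) /\ derive1 (k m1 m2 u) = k m1 m2.+1 u.
  by apply: D => v i j; exact: d2.
have D1 m1 m2 v : (forall u, derivable (fun u => k m1 m2 u v) u 1) /\
    derive1 (fun u => k m1 m2 u v) = (fun u => k m1.+1 m2 u v).
  by apply: D => u i j; exact: d1.
have E2 u m : derive1n m (k 0%N 0%N u) = k 0%N m u.
  by elim: m => [|m IH]; rewrite ?derive1n0// derive1nS IH; exact: (D2 _ _ _).2.
have E1 v m1 m2 : derive1n m1 (fun u => k 0%N m2 u v) = (fun u => k m1 m2 u v).
  by elim: m1 => [|m IH]; rewrite ?derive1n0// derive1nS IH; exact: (D1 _ _ _).2.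
have PE m1 m2 : partial m1 m2 (k 0%N 0%N) = k m1 m2.
  apply/funext => u; apply/funext => v; rewrite /partial.
  by under eq_fun do rewrite E2; rewrite E1.
split; last by move=> u v; rewrite PE.
split => [j a b _|j a b _]; first by rewrite E2; exact: (D2 _ _ _).1.
by rewrite PE; exact: (D1 _ _ _).1.
Qed.

End smooth_families.

Section oscillatory_integrals.
Context {R : realType}.
Notation TR := (measurableTypeR R).
Variables al be ga W : TR * TR -> R.
Hypothesis mal : measurable_fun setT (al : TR * TR -> TR).
Hypothesis mbe : measurable_fun setT (be : TR * TR -> TR).
Hypothesis mga : measurable_fun setT (ga : TR * TR -> TR).
Hypothesis Wi : forall m1 m2 : nat,
  leb2.-integrable setT (EFin \o (fun z : TR * TR => al z ^+ m1 * be z ^+ m2 * W z)).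

(** Each derivative multiplies the integrand by [al] or [be] and advances the cosine by a quarter
    period, so one formula covers all orders without distinguishing sines from cosines. [ga]
    collects the phase that is not differentiated. *)
Definition osc (m1 m2 : nat) (u v : R) : R :=
  (\int[leb2]_z (cos (u * al z + v * be z + ga z + (m1 + m2)%:R * (pi / 2)) *
     (al z ^+ m1 * be z ^+ m2 * W z)))%R.

Let quarter (th a : R) (w m : R) : is_derive w (1 : R) (fun w => cos (w * a + th + m * (pi / 2)))
  (a * cos (w * a + th + (m + 1) * (pi / 2))).
Proof.
have -> : w * a + th + (m + 1) * (pi / 2) = (w * a + th + m * (pi / 2)) + pi / 2 by ring.
by rewrite cosDpihalf; apply: is_derive_eq; rewrite /GRing.scale/=; ring.
Qed.

Let osc_integrable m1 m2 (u v c : R) : leb2.-integrable setT (EFin \o (fun z : TR * TR =>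
  cos (u * al z + v * be z + ga z + c) * (al z ^+ m1 * be z ^+ m2 * W z))).
Proof.
apply: (@integrable_bounded _ _ _ _ _ _ 1) => //; last by move=> z; exact: normr_cos_le1.
apply: measurableT_comp; first exact: measurable_cos.
apply: measurable_funD => //; apply: measurable_funD => //.
by apply: measurable_funD; apply: measurable_funM.
Qed.

Lemma is_derive_osc1 m1 m2 u v :
  is_derive u (1 : R) (fun w => osc m1 m2 w v) (osc m1.+1 m2 u v).
Proof.
rewrite /osc.
have -> : (fun z : TR * TR => cos (u * al z + v * be z + ga z + (m1.+1 + m2)%:R * (pi / 2)) *
     (al z ^+ m1.+1 * be z ^+ m2 * W z)) = (fun z => al z * cos (u * al z + (v * be z + ga z) + ((m1 + m2)%:R + 1) * (pi / 2)) *
     (al z ^+ m1 * be z ^+ m2 * W z)).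
  apply/funext => z; rewrite addSn -natr1 exprS.
  by rewrite -[u * al z + _ + _]addrA; ring.
apply: (@is_derive_under_integral _ _ _ _ (fun w z => cos (w * al z + v * be z + ga z + (m1 + m2)%:R * (pi / 2)) *
     (al z ^+ m1 * be z ^+ m2 * W z)) (fun w z => al z * cos (w * al z + (v * be z + ga z) + ((m1 + m2)%:R + 1) * (pi / 2)) *
     (al z ^+ m1 * be z ^+ m2 * W z)) (fun z => `|al z ^+ m1.+1 * be z ^+ m2 * W z|)).
- move=> w z; have := quarter (v * be z + ga z) (al z) w (m1 + m2)%:R.
  under eq_fun do rewrite addrA.
  move=> dq; apply: is_derive_eq; rewrite /GRing.scale/=; ring.
- by move=> w; exact: osc_integrable.
- exact: integrable_norm.
- move=> w z _; have -> : al z * cos (w * al z + (v * be z + ga z) + ((m1 + m2)%:R + 1) * (pi / 2)) *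
     (al z ^+ m1 * be z ^+ m2 * W z) = cos (w * al z + (v * be z + ga z) + ((m1 + m2)%:R + 1) * (pi / 2)) *
     (al z ^+ m1.+1 * be z ^+ m2 * W z) by rewrite exprS; ring.
  by rewrite normrM ler_piMl// normr_cos_le1.
Qed.

Lemma is_derive_osc2 m1 m2 u v :
  is_derive v (1 : R) (fun w => osc m1 m2 u w) (osc m1 m2.+1 u v).
Proof.
rewrite /osc.
have -> : (fun z : TR * TR => cos (u * al z + v * be z + ga z + (m1 + m2.+1)%:R * (pi / 2)) *
     (al z ^+ m1 * be z ^+ m2.+1 * W z)) = (fun z => be z * cos (v * be z + (u * al z + ga z) + ((m1 + m2)%:R + 1) * (pi / 2)) *
     (al z ^+ m1 * be z ^+ m2 * W z)).
  apply/funext => z; rewrite addnS -natr1 exprS.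
  by rewrite [v * be z + _]addrA [v * be z + _]addrC; ring.
apply: (@is_derive_under_integral _ _ _ _ (fun w z => cos (u * al z + w * be z + ga z + (m1 + m2)%:R * (pi / 2)) *
     (al z ^+ m1 * be z ^+ m2 * W z)) (fun w z => be z * cos (w * be z + (u * al z + ga z) + ((m1 + m2)%:R + 1) * (pi / 2)) *
     (al z ^+ m1 * be z ^+ m2 * W z)) (fun z => `|al z ^+ m1 * be z ^+ m2.+1 * W z|)).
- move=> w z; have := quarter (u * al z + ga z) (be z) w (m1 + m2)%:R.
  under eq_fun do rewrite addrA [_ * be z + _]addrC.
  move=> dq; apply: is_derive_eq; rewrite /GRing.scale/=; ring.
- by move=> w; exact: osc_integrable.
- exact: integrable_norm.
- move=> w z _; have -> : be z * cos (w * be z + (u * al z + ga z) + ((m1 + m2)%:R + 1) * (pi / 2)) *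
     (al z ^+ m1 * be z ^+ m2 * W z) = cos (w * be z + (u * al z + ga z) + ((m1 + m2)%:R + 1) * (pi / 2)) *
     (al z ^+ m1 * be z ^+ m2.+1 * W z) by rewrite exprS; ring.
  by rewrite normrM ler_piMl// normr_cos_le1.
Qed.

End oscillatory_integrals.

(** * Fourier representation of the Green's function *)

Section representation.
Context {R : realType}.
Notation TR := (measurableTypeR R).

Lemma entry_jcont (A x0 y0 : R) F i j : solution_from_delta A x0 y0 F ->
  jcont (fun x y t => F x y t i j).
Proof. by move=> sol; apply/jcont_entry/(sol_cont sol). Qed.

Lemma entry_integrable (A x0 y0 : R) F i j t : solution_from_delta A x0 y0 F -> 0 < t ->
  leb2.-integrable setT (EFin \o (fun z : TR * TR => F z.1 z.2 t i j)).
Proof.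
move=> sol t0; have [M HM] := sol_L1 sol t0.
have [] // := @L1norm_bound R (fun x y => F x y t) i j M.
  by move=> k l; exact: (@jcont_measurable _ (fun x y t => F x y t k l) _ (@entry_jcont _ _ _ _ k l sol)).
by apply: HM; rewrite t0 lexx.
Qed.

Lemma fcos_continuous1 (c a b : R) (f : TR * TR -> R) :
  leb2.-integrable setT (EFin \o f) -> continuous (fun a => fcos c f a b).
Proof.
move=> fi a0; rewrite /fcos.
have aI : a0 \in `](a0 - 1), (a0 + 1)[%classic.
  by apply/mem_set; rewrite /= in_itv/=; apply/andP; split; lra.
apply: (@continuity_under_integral R _ _ leb2 (fun a z => cos (z.1 * a + z.2 * b + c) * f z)
  setT measurableT (a0 - 1) (a0 + 1) _ _ (fun z => `|f z|)) => //.
- by move=> x _; exact: fcos_integrable.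
- apply/aeW => z _ x _; apply: cvgM; last exact: cvg_cst.
  apply: continuous_comp; last exact: continuous_cos.
  apply: cvgD; last exact: cvg_cst.
  apply: cvgD; last exact: cvg_cst.
  by apply: cvgM; [exact: cvg_cst|exact: cvg_id].
- exact: integrable_norm.
- by move=> x _; apply/aeW => z _; rewrite normrM ler_piMl// normr_cos_le1.
Qed.

Lemma measurable_hat (A x0 y0 : R) F i j c s : solution_from_delta A x0 y0 F -> 0 < s ->
  measurable_fun setT (fun z : TR * TR => hat A F i j c z.1 z.2 s : TR).
Proof.
move=> sol s0; rewrite /hat; set f := (fun z : TR * TR => F z.1 z.2 s i j).
have fi : leb2.-integrable setT (EFin \o f) by exact: (entry_integrable _ _ sol).
have mF : measurable_fun setT (fun z : TR * TR => fcos c f z.1 z.2 : TR).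
  apply: (@measurable_continuous2 R (fcos c f)) => [b|a]; first exact: fcos_continuous1.
  exact: fcos_continuous.
apply: (measurableT_comp mF (g := fun z : TR * TR => ((z.1 : R), (z.2 : R) - A * s * z.1)%R : TR * TR)).
apply/measurable_fun_pair => //=; apply: measurable_funB => //.
by apply: measurable_funM.
Qed.

Variables (A : R) (G : R -> R -> R -> R -> R -> 'M[R]_2).
Hypothesis green : green_function A G.

Definition green_hat (i j : 'I_2) (xi eta s : R) : R :=
  hat A (fun x y t => G x y t 0 0) i j 0 xi eta s.

Let ord2P (i : 'I_2) : i = ord0 \/ i = ord_max.
Proof. by case: i => [[|[|k]] kk] //; [left|right]; apply/val_inj. Qed.

(** The two columns of the identity have energy (c0 - c1)^2 + c1^2 equal to 1 and 2, whence the
    bound in [spec_data]. *)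
Lemma green_hat_spectral j : spectral_solution A (ord0 == j)%:R (ord_max == j)%:R
  (green_hat ord0 j) (green_hat ord_max j).
Proof.
have I i xi eta : green_hat i j xi eta s @[s --> 0^'+] --> ((i == j)%:R : R).
  by have := @hat_init _ _ _ _ _ (green 0 0) i j 0 xi eta; rewrite !mul0r !addr0 cos0.
split => //; first by move=> xi eta; exact: (hat_ode (green 0 0)).
by case: (ord2P j) => ->; rewrite /= ?expr0n/=; lra.
Qed.

Lemma hat_translate x' y' i j c xi eta s : 0 < s ->
  hat A (fun x y t => G x y t x' y') i j c xi eta s =
  cos (x' * xi + y' * eta + c) * green_hat i j xi eta s.
Proof.
move=> s0; set C := cos _.
pose p i s := hat A (fun x y t => G x y t x' y') i j c xi eta s - C * green_hat i j xi eta s.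
have r0 s' : 0 <= rate A xi eta s' by rewrite addr_ge0 ?sqr_ge0.
have ode : micropolar_ode (rate A xi eta) (p ord0) (p ord_max).
  move=> u u0; have [h1 h2] := @hat_ode _ _ _ _ _ (green x' y') j c xi eta u u0.
  have [h3 h4] := @spec_ode _ _ _ _ _ _ (green_hat_spectral j) xi eta u u0.
  split; rewrite /p; apply: is_derive_eq; rewrite /rate /GRing.scale/=; ring.
have ini k : p k s @[s --> 0^'+] --> (0 : R).
  have -> : nbhs (0 : R) = nbhs (C *+ (k == j) - C * (k == j)%:R) by rewrite mulr_natr subrr.
  apply: cvgB; first exact: (@hat_init _ _ _ _ _ (green x' y')).
  apply: cvgM; first exact: cvg_cst.
  by case: (ord2P k) => ->; [exact: (spec_init0 (green_hat_spectral j))|exact: (spec_init1 (green_hat_spectral j))].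
have [e0 e1] := micropolar_ode_unique r0 ode (ini _) (ini _) s0.
by case: (ord2P i) => ->; apply/eqP; rewrite -subr_eq0; apply/eqP.
Qed.

Variable t : R.
Hypothesis t0 : 0 < t.

Lemma green_hat_or i j : green_hat i j = green_hat ord0 j \/ green_hat i j = green_hat ord_max j.
Proof. by case: (ord2P i) => ->; [left|right]. Qed.

Lemma measurable_green_hat i j :
  measurable_fun setT (fun z : TR * TR => green_hat i j z.1 z.2 t : TR).
Proof. exact: (measurable_hat _ _ _ (green 0 0)). Qed.

Lemma integrable_green_hat i j :
  leb2.-integrable setT (EFin \o (fun z : TR * TR => green_hat i j z.1 z.2 t)).
Proof.
have s01 : 0 <= (0 : R) <= 1 by rewrite lexx ler01.
have := spectral_integrable t0 (green_hat_spectral j) 0 0 s01 (green_hat_or i j) (measurable_green_hat i j).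
by apply: eq_integrable => // z _; rewrite /= /poly_weight !expr0 !mul1r.
Qed.

(** Inversion is applied to the kernel pulled back along the shear, at the point
    [(x - A * t * y, y)]: its transform at the initial frequency is [hat], which [hat_translate]
    reduces to [green_hat], and the Gaussian bound makes that integrable. *)
Lemma green_representation x y x' y' i j :
  4 * pi ^+ 2 * G x y t x' y' i j =
  (\int[leb2]_z (cos ((x - x' - A * t * y) * z.1 + (y - y') * z.2) * green_hat i j z.1 z.2 t))%R.
Proof.
pose f (z : TR * TR) := G ((z.1 : R) + A * t * z.2)%R z.2 t x' y' i j.
have Gi := entry_integrable i j (green x' y') t0.
have fi : leb2.-integrable setT (EFin \o f) by exact: (integrable_shear (A * t) Gi).
have mG : measurable_fun setT (fun z : TR * TR => G z.1 z.2 t x' y' i j : TR).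
  by apply/measurable_EFinP; exact: measurable_int Gi.
pose X0 := x - A * t * y.
have fc (e : R) : 0 < e -> exists2 d : R, 0 < d & forall u v : R, `|u - X0| < d -> `|v - y| < d ->
    `|f (u, v) - f (X0, y)| <= e.
  move=> e0; have [d d0 H] := jcont_dist (X0 + A * t * y) y (@entry_jcont _ _ _ _ i j (green x' y')) t0 e0.
  have k0 : 0 < 1 + `|A * t| by rewrite ltr_wpDr.
  exists (d / (1 + `|A * t|)); first exact: divr_gt0.
  move=> u v; rewrite !ltr_pdivlMr// => hu hv; apply: H => /=; last by rewrite subrr normr0.
    have -> : u + A * t * v - (X0 + A * t * y) = (u - X0) + A * t * (v - y) by ring.
    apply: le_lt_trans (ler_normD _ _) _; rewrite normrM.
    move: (`|A * t|) (normr_ge0 (A * t)) `|u - X0| `|v - y| hu hv => k k0' a b hu hv.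
    have [ab|ba] := lerP a b.
      by apply: le_lt_trans hv; rewrite mulrDr mulr1 [k * b]mulrC lerD2r.
    by apply: le_lt_trans hu; rewrite mulrDr mulr1 lerD2l [leRHS]mulrC ler_wpM2l// ltW.
  by apply: le_lt_trans hv; rewrite ler_peMr// lerDl.
have gE (z : TR * TR) : (\int[leb2]_w (f w * cos (((w.1 : R) - X0) * z.1 + ((w.2 : R) - y) * z.2)))%R =
   cos ((x - x' - A * t * y) * z.1 + (y - y') * z.2) * green_hat i j z.1 z.2 t.
  have -> : cos ((x - x' - A * t * y) * z.1 + (y - y') * z.2) = cos (x' * z.1 + y' * z.2 + (- X0 * z.1 - y * z.2)) :> R.
    by rewrite -cosN; congr cos; rewrite /X0; ring.
  rewrite -hat_translate// /hat -(fcos_shear _ _ _ _ mG).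
  apply: eq_Rintegral => w _; rewrite mulrC; congr (cos _ * _); ring.
have fE : f (X0, y) = G x y t x' y' i j by rewrite /f /X0 /= subrK.
rewrite -fE -(@fourier_inversion R f X0 y fi fc).
  by apply: eq_Rintegral => z _; rewrite gE.
have := @integrable_bounded _ _ _ leb2 _
  (fun z : TR * TR => cos ((x - x' - A * t * y) * z.1 + (y - y') * z.2)) 1 _ _ (integrable_green_hat i j).
move=> H; apply: eq_integrable (H _ _) => //.
- by move=> z _ /=; rewrite gE.
- have := measurable_cos2 (x - x' - A * t * y) (y - y') 0.
  by apply: eq_measurable_fun => z _; rewrite addr0.
- by move=> z; exact: normr_cos_le1.
Qed.

Section differentiated_kernel.
Variables (sgn sg : R) (ga : TR * TR -> R).
Hypothesis sgn1 : `|sgn| = 1.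
Hypothesis sg01 : 0 <= sg <= 1.
Hypothesis mga : measurable_fun setT (ga : TR * TR -> TR).

Let al (z : TR * TR) : R := sgn * z.1.
Let be (z : TR * TR) : R := sgn * ((z.2 : R) - sg * (A * t) * z.1)%R.
Let S := Num.sqrt t.
Let L := shear_len A t.
Let S0 : S != 0. Proof. by rewrite gt_eqF// sqrtr_gt0. Qed.
Let L0 : L != 0. Proof. by rewrite gt_eqF// shear_len_gt0. Qed.

Let weightE m1 m2 (z : TR * TR) : al z ^+ m1 * be z ^+ m2 =
  sgn ^+ (m1 + m2) * (S ^- (m1 + m2) * L ^- m1) * poly_weight A t m1 m2 sg z.1 z.2.
Proof.
rewrite /poly_weight /alpha /gam /al /be -/S -/L !exprMn !exprD.
have := expf_neq0 m1 S0; have := expf_neq0 m2 S0; have := expf_neq0 m1 L0.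
by move=> l s2 s1; field; rewrite l s1 s2.
Qed.

Let Wi i j m1 m2 : leb2.-integrable setT (EFin \o (fun z : TR * TR =>
  al z ^+ m1 * be z ^+ m2 * green_hat i j z.1 z.2 t)).
Proof.
have := spectral_integrable t0 (green_hat_spectral j) m1 m2 sg01 (green_hat_or i j) (measurable_green_hat i j).
move/(integrable_scale (sgn ^+ (m1 + m2) * (S ^- (m1 + m2) * L ^- m1))).
by apply: eq_integrable => // z _; rewrite /= weightE; congr EFin; ring.
Qed.

(* (sgn, sg) = (1, 1) for derivatives in (x, y) and (-1, 0) for (x', y'). *)
Definition green_osc (i j : 'I_2) (m1 m2 : nat) (u v : R) : R :=
  osc (fun z => sgn * z.1) (fun z => sgn * (z.2 - sg * (A * t) * z.1)) ga
    (fun z => green_hat i j z.1 z.2 t) m1 m2 u v.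

(** [K] is the kernel in two of its four space variables; the other two are frozen inside [ga]. *)
Lemma green_osc_partial (k1 k2 : nat) (K : R -> R -> 'M[R]_2) :
  (forall u v i j, 4 * pi ^+ 2 * K u v i j = green_osc i j 0 0 u v) ->
  has_partial k1 k2 K /\
  forall u v i j, partial k1 k2 K u v i j = (4 * pi ^+ 2)^-1 * green_osc i j k1 k2 u v.
Proof.
move=> KE.
have mal : measurable_fun setT (al : TR * TR -> TR) by apply: measurable_funM.
have mbe : measurable_fun setT (be : TR * TR -> TR).
  by apply: measurable_funM => //; apply: measurable_funB => //; apply: measurable_funM.
have p0 : 4 * pi ^+ 2 != 0 :> R by rewrite mulf_neq0 ?expf_neq0 ?gt_eqF ?pi_gt0.
pose k m1 m2 u v : 'M[R]_2 := \matrix_(i, j) ((4 * pi ^+ 2)^-1 * green_osc i j m1 m2 u v).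
have -> : K = k 0%N 0%N.
  apply/funext => u; apply/funext => v; apply/matrixP => i j.
  by rewrite mxE -KE mulKf.
have [||h1 h2] := @partial_family R k k1 k2.
- move=> m1 m2 u v i j; rewrite mxE; under eq_fun do rewrite mxE.
  have D : is_derive u (1 : R) (fun w => green_osc i j m1 m2 w v) (green_osc i j m1.+1 m2 u v).
    exact: (is_derive_osc1 mal mbe mga (Wi i j)).
  by apply: is_derive_eq; rewrite /GRing.scale/=; ring.
- move=> m1 m2 u v i j; rewrite mxE; under eq_fun do rewrite mxE.
  have D : is_derive v (1 : R) (fun w => green_osc i j m1 m2 u w) (green_osc i j m1 m2.+1 u v).
    exact: (is_derive_osc2 mal mbe mga (Wi i j)).
  by apply: is_derive_eq; rewrite /GRing.scale/=; ring.
by split => // u v i j; rewrite h2 mxE.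
Qed.

Lemma green_osc_bound (i j : 'I_2) (m1 m2 : nat) (u v X Y : R) :
  (forall z, u * (sgn * z.1) + v * (sgn * (z.2 - sg * (A * t) * z.1)) + ga z = z.1 * X + z.2 * Y) ->
  `|green_osc i j m1 m2 u v| <= S ^- (m1 + m2) * L ^- m1 *
    ((2 + 2 * pi ^+ 4) * (spec_const (m1 + m2) * (256 * pi / (t * L))) *
     ((1 + shear_coord1 A t X Y ^+ 2)^-1 * (1 + shear_coord2 t Y ^+ 2)^-1)).
Proof.
move=> XY; have := spectral_kernel_bound t0 (green_hat_spectral j) m1 m2 sg01 (green_hat_or i j)
  (measurable_green_hat i j) ((m1 + m2)%:R * (pi / 2)) X Y.
set V := fun z : TR * TR => _ => VB.
have Vi : leb2.-integrable setT (EFin \o V).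
  exact: (spectral_integrable t0 (green_hat_spectral j) m1 m2 sg01 (green_hat_or i j) (measurable_green_hat i j)).
have -> : green_osc i j m1 m2 u v =
    sgn ^+ (m1 + m2) * (S ^- (m1 + m2) * L ^- m1) * fcos ((m1 + m2)%:R * (pi / 2)) V X Y.
  rewrite /fcos -RintegralZl//; last exact: fcos_integrable.
  by apply: eq_Rintegral => z _; rewrite weightE XY /V; ring.
have c0 : 0 <= S ^- (m1 + m2) * L ^- m1.
  by rewrite mulr_ge0// invr_ge0 exprn_ge0 ?sqrtr_ge0.
rewrite normrM normrM normrX sgn1 expr1n mul1r (ger0_norm c0).
by rewrite ler_wpM2l.
Qed.

End differentiated_kernel.

End representation.

(** * Norms *)

Section norms.
Context {R : realType}.
Notation TR := (measurableTypeR R).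
Notation mu := (@lebesgue_measure R).

(** The integral of a nonnegative function is a supremum over the simple functions below it, so
    monotonicity asks no measurability; it is applied to powers of [N] of the kernel, for an
    arbitrary norm [N]. *)
Lemma le_integral_majorant d (T : measurableType d) (m : {measure set T -> \bar R})
    (f g : T -> \bar R) : (forall x, 0 <= f x)%E -> (forall x, f x <= g x)%E ->
  (\int[m]_x f x <= \int[m]_x g x)%E.
Proof.
move=> f0 fg; rewrite !ge0_integralTE//; last by move=> x; exact: le_trans (f0 x) (fg x).
apply: le_ereal_sup => _ [h /= hf <-]; exists h => // x; exact: le_trans (hf x) (fg x).
Qed.

(** As 0 <= q <= 1, q^r <= q for r >= 1, so the integral of [q] alone controls every L^r norm. For p
    = +oo the exponent [fine (p^-1)] is 0 and the bound reads [D]. *)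
Lemma Lnorm_majorant (p : \bar R) (f q : TR * TR -> R) (D I : R) : (1 <= p)%E ->
  (forall z, 0 <= f z) -> (forall z, f z <= D * q z) -> 0 <= D -> (forall z, 0 <= q z <= 1) ->
  measurable_fun setT (q : TR * TR -> TR) -> (\int[leb2]_z (q z)%:E = I%:E)%E ->
  (Lnorm leb2 p (EFin \o f) <= (D * I `^ fine (p^-1)%E)%:E)%E.
Proof.
move=> p1 f0 fq D0 q01 mq qI.
have q0 z : 0 <= q z by case/andP: (q01 z).
rewrite unlock; case: p p1 => [r|_|//].
- rewrite lee_fin => r1.
  have r0 : 0 < r by exact: lt_le_trans r1.
  rewrite fine_invr.
  have le : (\int[leb2]_z `|(EFin \o f) z| `^ r <= (D `^ r * I)%:E)%E.
    rewrite EFinM -qI -ge0_integralZl//; last 3 first.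
    - exact/measurable_EFinP.
    - by move=> z _; rewrite lee_fin.
    - by rewrite lee_fin powR_ge0.
    apply: le_integral_majorant => z; first exact: poweR_ge0.
    rewrite /= ger0_norm// lee_fin.
    apply: (@le_trans _ _ ((D * q z) `^ r)).
      by apply: ge0_ler_powR; rewrite ?nnegrE ?(ltW r0) ?mulr_ge0.
    rewrite powRM// ler_wpM2l ?powR_ge0//.
    have [->|qz] := eqVneq (q z) 0; first by rewrite powR0 ?gt_eqF.
    by apply: ge1r_powR => //; rewrite lt0r qz q01.
  have I0 : 0 <= I by rewrite -lee_fin -qI integral_ge0// => z _; rewrite lee_fin.
  have -> : (D * I `^ r^-1)%:E = ((D `^ r * I)%:E `^ r^-1)%E.
    by rewrite poweR_EFin powRM ?powR_ge0// -powRrM mulfV ?gt_eqF// powRr1.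
  apply: gt0_ler_poweR => //.
  - by rewrite invr_ge0 ltW.
  - by rewrite in_itv/= integral_ge0 ?leey// => z _; exact: poweR_ge0.
  - by rewrite in_itv/= lee_fin mulr_ge0 ?powR_ge0// leey.
- rewrite invey [fine _]/= powRr0 mulr1.
  case: ifP => _; last by rewrite lee_fin.
  apply/ess_supP; apply/aeW => z /=; rewrite lee_fin ger0_norm//.
  by apply: le_trans (fq z) _; rewrite ler_piMr//; case/andP: (q01 z).
Qed.

(** A product of two Cauchy profiles of widths [a] and [b], whose centre in the first variable
    depends affinely on the second; this slope does not change the integral. *)
Definition bump_kernel (a b c1 c2 y0 : R) (z : TR * TR) : R :=
  (1 + (((z.1 : R) - (c1 + c2 * z.2)) / a) ^+ 2)^-1 * (1 + (((z.2 : R) - y0) / b) ^+ 2)^-1.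

Lemma continuous_cauchy : continuous (fun x : R => (1 + x ^+ 2)^-1).
Proof.
move=> x; apply: cvgV; first by rewrite gt_eqF// ltr_pwDl// sqr_ge0.
apply: cvgD; first exact: cvg_cst.
by apply: cvgM; exact: cvg_id.
Qed.

Lemma bump_kernel01 a b c1 c2 y0 z : 0 <= bump_kernel a b c1 c2 y0 z <= 1.
Proof.
have h (x : R) : 0 <= (1 + x ^+ 2)^-1 <= 1.
  have p : 0 < 1 + x ^+ 2 by rewrite ltr_pwDl// sqr_ge0.
  by rewrite invr_ge0 (ltW p)/= invf_le1// lerDl sqr_ge0.
by rewrite /bump_kernel; have /andP[? ?] := h ((z.1 - (c1 + c2 * z.2)) / a);
   have /andP[? ?] := h ((z.2 - y0) / b); rewrite mulr_ge0//= mulr_ile1.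
Qed.

Lemma measurable_bump_kernel a b c1 c2 y0 :
  measurable_fun setT (bump_kernel a b c1 c2 y0 : TR * TR -> TR).
Proof.
have mc := continuous_measurable_fun continuous_cauchy.
rewrite /bump_kernel; apply: measurable_funM.
  apply: (measurableT_comp mc); apply: measurable_funM => //; apply: measurable_funB => //.
  by apply: measurable_funD => //; apply: measurable_funM.
by apply: (measurableT_comp mc); apply: measurable_funM => //; apply: measurable_funB.
Qed.

Lemma integral_bump_kernel a b c1 c2 y0 : 0 < a -> 0 < b ->
  (\int[leb2]_z (bump_kernel a b c1 c2 y0 z)%:E = (pi ^+ 2 * (a * b))%:E)%E.
Proof.
move=> a0 b0.
have c0 (x : R) : 0 <= (1 + x ^+ 2)^-1 by rewrite invr_ge0 addr_ge0// sqr_ge0.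
have cI (s c : R) : 0 < s -> (\int[mu]_x ((1 + (((x : R) - c) / s) ^+ 2)^-1)%:E = (s * pi)%:E)%E.
  move=> s0; rewrite (@ge0_integral_affine R (fun x => (1 + x ^+ 2)^-1))//; last exact: continuous_cauchy.
  by rewrite integral_cauchy.
have mc (s c : R) : measurable_fun setT (fun x : TR => ((1 + (((x : R) - c) / s) ^+ 2)^-1)%:E).
  apply/measurable_EFinP.
  apply: (measurableT_comp (continuous_measurable_fun continuous_cauchy)).
  by apply: measurable_funM => //; apply: measurable_funB.
rewrite /leb2 fubini_tonelli2//; last 2 first.
- by apply/measurable_EFinP; exact: measurable_bump_kernel.
- by move=> z; rewrite lee_fin; case/andP: (bump_kernel01 a b c1 c2 y0 z).
rewrite /fubini_G/=.
have inner (y : TR) : (\int[mu]_x (bump_kernel a b c1 c2 y0 (x, y))%:E =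
    (a * pi)%:E * ((1 + (((y : R) - y0) / b) ^+ 2)^-1)%:E)%E.
  rewrite /bump_kernel/=; under eq_integral do rewrite EFinM.
  rewrite ge0_integralZr//.
  - by rewrite cI.
  - by move=> x _; rewrite lee_fin.
  - by rewrite lee_fin.
under eq_integral do rewrite inner.
rewrite ge0_integralZl//.
- by rewrite cI// -EFinM; congr EFin; ring.
- by move=> x _; rewrite lee_fin.
- by rewrite lee_fin mulr_ge0 ?pi_ge0 ?(ltW a0).
Qed.

Definition norm_const (N : 'M[R]_2 -> R) : R := \sum_i \sum_j N (delta_mx i j).

(** 0 = N (M - M) <= 2 N M by the triangle inequality and homogeneity. *)
Lemma matrix_norm_ge0 (N : 'M[R]_2 -> R) M : is_matrix_norm N -> 0 <= N M.
Proof.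
move=> [_ ND NZ]; have N0 : N 0 = 0 by rewrite -(scale0r (0 : 'M[R]_2)) NZ normr0 mul0r.
have := ND M (-1 *: M); rewrite NZ normrN1 mul1r scaleN1r subrr N0; lra.
Qed.

Lemma matrix_norm_le (N : 'M[R]_2 -> R) (M : 'M[R]_2) (B : R) : is_matrix_norm N ->
  (forall i j, `|M i j| <= B) -> N M <= norm_const N * B.
Proof.
move=> hN MB; have [_ ND NZ] := hN.
have N0 : N 0 = 0 by rewrite -(scale0r (0 : 'M[R]_2)) NZ normr0 mul0r.
have Nsum (I : finType) (F : I -> 'M[R]_2) : N (\sum_i F i) <= \sum_i N (F i).
  elim/big_ind2 : _ => [|x1 x2 y1 y2 h1 h2|//]; first by rewrite N0.
  by apply: le_trans (ND _ _) _; exact: lerD.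
rewrite {1}(matrix_sum_delta M) /norm_const mulr_suml.
apply: le_trans (Nsum _ _) _; apply: ler_sum => i _.
rewrite mulr_suml; apply: le_trans (Nsum _ _) _; apply: ler_sum => j _.
by rewrite NZ mulrC ler_wpM2l// matrix_norm_ge0.
Qed.

Variables (A t : R).
Hypothesis t0 : 0 < t.
Let S := Num.sqrt t.
Let L := shear_len A t.
Let S0 : 0 < S. Proof. by rewrite sqrtr_gt0. Qed.
Let L0 : 0 < L. Proof. exact: shear_len_gt0. Qed.
Let SS : S ^+ 2 = t. Proof. by rewrite sqr_sqrtr// ltW. Qed.

(** The majorant depends on x - x' - A t (y + y') / 2 and y - y'. With either pair of variables
    frozen it is a [bump_kernel] in the other pair, with slopes of opposite signs and the same
    integral, so both suprema obey the same bound. *)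
Lemma kernel_norm_le (N : 'M[R]_2 -> R) (p : \bar R) (K : R -> R -> R -> R -> 'M[R]_2) (D : R) :
  is_matrix_norm N -> (1 <= p)%E -> 0 <= D ->
  (forall x y x' y', N (K x y x' y') <= D *
    ((1 + shear_coord1 A t (x - x' - A * t * y) (y - y') ^+ 2)^-1 *
     (1 + shear_coord2 t (y - y') ^+ 2)^-1)) ->
  (kernel_norm N p K <= (D * (pi ^+ 2 * (S * L * S)) `^ fine (p^-1)%E)%:E)%E.
Proof.
move=> hN p1 D0 KD.
have SL0 : 0 < S * L by rewrite mulr_gt0.
have S1 := lt0r_neq0 S0; have L1 := lt0r_neq0 L0.
rewrite /kernel_norm ge_max; apply/andP; split.
  apply: ge_ereal_sup => _ [[x' y'] _ <-] /=.
  apply: (@Lnorm_majorant p _ (bump_kernel (S * L) S (x' + A * t / 2 * y') (A * t / 2) y')) => //.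
  - by move=> z; exact: matrix_norm_ge0.
  - move=> [x y] /=; apply: le_trans (KD x y x' y') _; rewrite ler_wpM2l//.
    rewrite /bump_kernel /shear_coord1 /shear_coord2 -/S -/L /= le_eqVlt; apply/orP; left; apply/eqP.
    by congr ((1 + _ ^+ 2)^-1 * _); field; rewrite S1 L1.
  - by move=> z; exact: bump_kernel01.
  - exact: measurable_bump_kernel.
  - exact: integral_bump_kernel.
apply: ge_ereal_sup => _ [[x y] _ <-] /=.
apply: (@Lnorm_majorant p _ (bump_kernel (S * L) S (x - A * t / 2 * y) (- (A * t / 2)) y)) => //.
- by move=> z; exact: matrix_norm_ge0.
- move=> [x' y'] /=; apply: le_trans (KD x y x' y') _; rewrite ler_wpM2l//.
  rewrite /bump_kernel /shear_coord1 /shear_coord2 -/S -/L /= le_eqVlt; apply/orP; left; apply/eqP.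
  by congr ((1 + _)^-1 * (1 + _)^-1); field; rewrite ?S1 ?L1.
- by move=> z; exact: bump_kernel01.
- exact: measurable_bump_kernel.
- exact: integral_bump_kernel.
Qed.

(** All powers of t and L agree exactly, since S^2 = t and L^2 = 1 + (A t)^2; the inequality only
    replaces (pi^2)^(1/p) by pi^2. *)
Lemma green_bound_scaling (k1 k2 : nat) (p : \bar R) : (1 <= p)%E ->
  S ^- (k1 + k2) * L ^- k1 * (t * L)^-1 * (pi ^+ 2 * (S * L * S)) `^ fine (p^-1)%E <=
  pi ^+ 2 * green_bound A k1 k2 p t.
Proof.
move=> p1; rewrite /green_bound; set e := fine _.
have [e0 e1] : 0 <= e /\ e <= 1.
  rewrite /e; case: p p1 {e} => [r|_|//].
    by rewrite lee_fin fine_invr => r1; rewrite invr_ge0 invf_le1 ?(lt_le_trans _ r1)// (le_trans _ r1).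
  by rewrite invey/= lexx ler01.
have pi1 : 1 <= pi ^+ 2 :> R.
  by rewrite exprn_ege1// (le_trans _ (pi_ge2 R))// ler1n.
have -> : S * L * S = t * L by rewrite -SS; ring.
have tL : 0 < t * L by rewrite mulr_gt0.
have -> : t `^ (- (1 - e) - (k1 + k2)%:R / 2) = S ^- (k1 + k2) * t^-1 * t `^ e.
  have -> : - (1 - e) - (k1 + k2)%:R / 2 = - (2^-1 * (k1 + k2)%:R) + (- 1) + e by field.
  rewrite !powRD ?(gt_eqF t0) ?implybT// !powRN powRr1 ?(ltW t0)//.
  by rewrite powRrM powR12_sqrt ?(ltW t0)// powR_mulrn ?sqrtr_ge0.
have -> : (1 + (A * t) ^+ 2) `^ (- (1 / 2) * (1 - e + k1%:R)) = L ^- k1 * L^-1 * L `^ e.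
  rewrite -shear_len_sqr -/L -powR_mulrn ?(ltW L0)// -powRrM.
  have -> : 2 * (- (1 / 2) * (1 - e + k1%:R)) = - k1%:R + (- 1) + e by field.
  rewrite !powRD ?(gt_eqF L0) ?implybT// !powRN powRr1 ?(ltW L0)//.
  by rewrite powR_mulrn ?(ltW L0).
rewrite powRM ?(le_trans _ pi1) ?(ltW tL)// powRM ?(ltW t0) ?(ltW L0)//.
have -> : S ^- (k1 + k2) * L ^- k1 * (t * L)^-1 * ((pi ^+ 2) `^ e * (t `^ e * L `^ e)) =
  (pi ^+ 2) `^ e * (S ^- (k1 + k2) * t^-1 * t `^ e * (L ^- k1 * L^-1 * L `^ e)).
  by rewrite invfM; ring.
apply: ler_wpM2r; last exact: ler1_powR.
by rewrite !mulr_ge0 ?powR_ge0 ?invr_ge0 ?exprn_ge0 ?(ltW t0) ?(ltW L0) ?(ltW S0).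
Qed.

End norms.

(** Serves the derivatives in either pair of variables. The existential data may depend on all four
    coordinates because the pointwise bound depends only on the total phase. *)
Lemma green_derivative_bound (R : realType) (N : 'M[R]_2 -> R) (p : \bar R) (k1 k2 : nat) (A t : R)
    (P : R -> R -> R -> R -> 'M[R]_2) (G : R -> R -> R -> R -> R -> 'M[R]_2) (sgn sg : R) :
  is_matrix_norm N -> (1 <= p)%E -> 0 < t -> green_function A G -> `|sgn| = 1 -> 0 <= sg <= 1 ->
  (forall x y x' y', exists ga u v, [/\
     measurable_fun setT (ga : measurableTypeR R * measurableTypeR R -> measurableTypeR R),
     (forall z, u * (sgn * z.1) + v * (sgn * (z.2 - sg * (A * t) * z.1)) + ga z =
       z.1 * (x - x' - A * t * y) + z.2 * (y - y')) &
     forall i j, P x y x' y' i j = (4 * pi ^+ 2)^-1 * green_osc A G t sgn sg ga i j k1 k2 u v]) ->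
  (kernel_norm N p P <=
    (norm_const N * ((4 * pi ^+ 2)^-1 * ((2 + 2 * pi ^+ 4) * (spec_const (k1 + k2) * (256 * pi)))) *
     pi ^+ 2 * green_bound A k1 k2 p t)%:E)%E.
Proof.
move=> hN p1 t0 green sgn1 sg01 PE.
pose S := Num.sqrt t; pose L := shear_len A t.
have L0 : 0 < L by exact: shear_len_gt0.
have C0 : 0 <= norm_const N.
  by apply: sumr_ge0 => i _; apply: sumr_ge0 => j _; exact: matrix_norm_ge0.
pose E := (4 * pi ^+ 2)^-1 * ((2 + 2 * pi ^+ 4) * (spec_const (k1 + k2) * (256 * pi))) : R.
have E0 : 0 <= E.
  have pi0 := pi_ge0 R; have k0 := spec_const_ge0 (R := R) (k1 + k2).
  have h1 : 0 <= 256 * pi :> R by exact: mulr_ge0 (ler0n _ _) pi0.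
  have h2 : 0 <= 2 + 2 * pi ^+ 4 :> R by apply: addr_ge0 => //; apply: mulr_ge0 => //; exact: exprn_ge0.
  have h3 : 0 <= (4 * pi ^+ 2)^-1 :> R by rewrite invr_ge0; apply: mulr_ge0 => //; exact: exprn_ge0.
  exact: mulr_ge0 h3 (mulr_ge0 h2 (mulr_ge0 k0 h1)).
have F0 : 0 <= S ^- (k1 + k2) * L ^- k1 * (t * L)^-1.
  by rewrite !mulr_ge0 ?invr_ge0 ?exprn_ge0 ?mulr_ge0 ?sqrtr_ge0 ?(ltW t0) ?(ltW L0).
apply: (@le_trans _ _ (norm_const N * E * (S ^- (k1 + k2) * L ^- k1 * (t * L)^-1) *
    (pi ^+ 2 * (S * L * S)) `^ fine (p^-1)%E)%:E).
  apply: kernel_norm_le => //; first exact: mulr_ge0 (mulr_ge0 C0 E0) F0.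
  move=> x y x' y'; have [ga [u [v [mga XY EP]]]] := PE x y x' y'.
  rewrite -[norm_const N * E * _]mulrA -[leRHS]mulrA.
  apply: matrix_norm_le => // i j.
  have B := green_osc_bound green t0 sgn1 sg01 i j k1 k2 XY.
  have q0 : 0 <= (4 * pi ^+ 2)^-1 :> R by rewrite invr_ge0 mulr_ge0 ?exprn_ge0 ?pi_ge0.
  rewrite EP normrM (ger0_norm q0); apply: le_trans (ler_wpM2l q0 B) _.
  rewrite le_eqVlt; apply/orP; left; apply/eqP.
  rewrite /E -/S -/L; move: (spec_const _) (1 + shear_coord1 _ _ _ _ ^+ 2) (1 + shear_coord2 _ _ ^+ 2) => c q1 q2.
  ring.
rewrite lee_fin -[leLHS]mulrA -[leRHS]mulrA.
apply: ler_wpM2l; first exact: mulr_ge0 C0 E0.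
exact: green_bound_scaling.
Qed.

Theorem proposition4p1 (R : realType) :
  exists mu0 : R, 0 < mu0 < 1 /\
  forall (N : 'M[R]_2 -> R), is_matrix_norm N ->
  forall (k1 k2 : nat) (p : \bar R),
    (2%:E <= p)%E \/
    ((1%:E <= p)%E /\ (k1, k2) \in [:: (0, 0); (1, 0); (0, 1)]%N) ->
  exists C : R,
  forall mu : R, 0 < mu <= mu0 ->
  forall G : R -> R -> R -> R -> R -> 'M[R]_2, green_function (1 / mu) G ->
  forall t : R, 0 < t ->
    [/\ forall x' y', has_partial k1 k2 (fun x y => G x y t x' y'),
        (kernel_norm N p (fun x y x' y' =>
           partial k1 k2 (fun u v => G u v t x' y') x y)
         <= (C * green_bound (1 / mu) k1 k2 p t)%:E)%E,
        forall x y, has_partial k1 k2 (fun x' y' => G x y t x' y')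
      & (kernel_norm N p (fun x y x' y' =>
           partial k1 k2 (fun u v => G x y t u v) x' y')
         <= (C * green_bound (1 / mu) k1 k2 p t)%:E)%E].
Proof.
exists 2^-1; split; first by apply/andP; split; lra.
move=> N hN k1 k2 p hp.
have p1 : (1 <= p)%E.
  by case: hp => [|[]//]; apply: le_trans; rewrite lee_fin ler1n.
exists (norm_const N * ((4 * pi ^+ 2)^-1 * ((2 + 2 * pi ^+ 4) * (spec_const (k1 + k2) * (256 * pi)))) * pi ^+ 2).
move=> mu _ G green t t0; set A := 1 / mu in green *.
pose ga (X Y : R) (z : measurableTypeR R * measurableTypeR R) : R := X * z.1 + Y * z.2.
have mga X Y : measurable_fun setT (ga X Y : _ -> measurableTypeR R).
  by apply: measurable_funD; apply: measurable_funM.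
have n1 : `|1 : R| = 1 by rewrite normr1.
have nN1 : `|-1 : R| = 1 by rewrite normrN1.
have s0 : 0 <= (0 : R) <= 1 by rewrite lexx ler01.
have s1 : 0 <= (1 : R) <= 1 by rewrite ler01 lexx.
have osc00 X Y sgn sg x y x' y' i j u v :
   (forall z, u * (sgn * z.1) + v * (sgn * (z.2 - sg * (A * t) * z.1)) + ga X Y z =
       z.1 * (x - x' - A * t * y) + z.2 * (y - y')) ->
   4 * pi ^+ 2 * G x y t x' y' i j = green_osc A G t sgn sg (ga X Y) i j 0 0 u v.
  move=> XY; rewrite (green_representation green t0) /green_osc /osc.
  apply: eq_Rintegral => z _; rewrite XY !expr0 !mul1r mul0r addr0.
  by congr (cos _ * _); ring.
(* The total phase z1 (x - x' - A t y) + z2 (y - y') is affine in each pair of variables. In (x, y)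
   its coefficients are z1 and z2 - A t z1, in (x', y') they are - z1 and - z2; the remainder is
   [ga]. *)
have P1 x' y' := green_osc_partial green t0 s1 (mga (- x') (- y')) k1 k2
  (fun x y i j => osc00 (- x') (- y') 1 1 x y x' y' i j x y
     (fun z => ltac:(rewrite /ga; ring))).
have P2 x y := green_osc_partial green t0 s0 (mga (x - A * t * y) y) k1 k2
  (fun x' y' i j => osc00 (x - A * t * y) y (-1) 0 x y x' y' i j x' y'
     (fun z => ltac:(rewrite /ga; ring))).
split.
- by move=> x' y'; exact: (P1 x' y').1.
- apply: (green_derivative_bound hN p1 t0 green n1 s1) => x y x' y'.
  exists (ga (- x') (- y')), x, y; split => //; first by move=> z; rewrite /ga; ring.
  by move=> i j; exact: (P1 x' y').2.
- by move=> x y; exact: (P2 x y).1.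
- apply: (green_derivative_bound hN p1 t0 green nN1 s0) => x y x' y'.
  exists (ga (x - A * t * y) y), x', y'; split => //; first by move=> z; rewrite /ga; ring.
  by move=> i j; exact: (P2 x y).2.
Qed.
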